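(* Let $n\ge1$, $\tau>0$, $T>0$, $P_0>0$, and let $a:[0,T]\to\mathbb C$ satisfy $\int_0^T|\mathbf D_T^\tau a(t)|dt<\infty$ and $\int_0^Tt|\mathbf D_T^\tau a(t)|^2dt<\infty$. Let $$\mathcal D_0=\Big\{f:\ \frac1{2\pi}\int_{-\infty}^\infty f(\lambda)d\lambda\le P_0\Big\}.$$ Consider, for functions $\varphi$ on $[0,T]$, the equations $$\mathbf D_T^\tau\mathbf A_T\mathbf W^\tau\varphi=\alpha\overline\varphi,\ \alpha\in\mathbb C,\quad(\mathrm E_1)\qquad \mathbf D_T^\tau\widehat{\mathbf A}_T\mathbf W^\tau\varphi=\beta\overline\varphi,\ \beta\in\mathbb C,\quad(\mathrm E_2)$$ and densities of the form $$f^0(\lambda)=\Big|c\int_0^T(\mathbf D_T^\tau\mathbf A_T\varphi^0_\tau)(t)e^{i\lambda t}dt\Big|^2,\qquad(\mathrm F)$$ where $c$ is a constant, $\varphi^0$ (on $[0,T]$) is the function of the canonical factorization $f^0(\lambda)=|\int_0^T\varphi^0(t)e^{-i\lambda t}dt|^2$ and $\varphi^0_\tau=\mathbf W^\tau\varphi^0$. Let $\nu_0^TP_0$ be the maximum of $\|\mathbf D_T^\tau\mathbf A_T\mathbf W^\tau\varphi\|^2=\|\mathbf D_T^\tau\widehat{\mathbf A}_T\mathbf W^\tau\varphi\|^2$ over the set $S$ of solutions $\varphi$ of $(\mathrm E_1)$ or $(\mathrm E_2)$ such that $\|\varphi\|^2=P_0$ and $\varphi$ determines the canonical factorization of the density $|\int_0^T\varphi(t)e^{-i\lambda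 t}dt|^2\in\mathcal D_0$. Let $\nu_0^{T+}P_0$ be the maximum of $\|\mathbf D_T^\tau\mathbf A_T\mathbf W^\tau\varphi\|^2$ over those $\varphi$ with $\|\varphi\|^2=P_0$ which determine the canonical factorization of a density $f^0$ of the form $(\mathrm F)$ (with $\varphi^0=\varphi$). (i) If there exists $\varphi^0\in S$ with $\nu_0^TP_0=\nu_0^{T+}P_0=\|\mathbf D_T^\tau\mathbf A_T\mathbf W^\tau\varphi^0\|^2$, then $f^0(\lambda)=|\int_0^T\varphi^0(t)e^{-i\lambda t}dt|^2$ is least favorable in $\mathcal D_0$ for the optimal estimation of the functional $A_T\xi=\int_0^Ta(t)\xi(t)dt$ of the unknown values $\xi(t)$, $t\in[0,T]$, of the random process $\xi(t)$ with stationary $n$th increments, and the corresponding increment $\xi^{(n)}(t,\tau)$ admits a one-sided moving average representation. (ii) If $\nu_0^T<\nu_0^{T+}$, then the density $f^0$ of the form $(\mathrm F)$ which admits the canonical factorization is least favorable in $\mathcal D_0$, where the function $c\varphi^0_\tau(t)$, $t\in[0,T]$, is determined by the equality $\varphi^0_\tau=\mathbf W^\tau\varphi^0$, by the condition that $\varphi^0$ is a solution of the extremum problem $\|\mathbf D_T^\tau\mathbf A_T\mathbf W^\tau\varphi\|^2\to\max$ subject to $|\int_0^T\varphi(t)e^{-i\lambda t}dt|^2\in\mathcal D_0$, and by the condition $\|\varphi^0\|^2=P_0$. (iii) In both cases, provided $h_{\tau,T}^{(a)}(f^0)\in H_{\mathcal D_0}$, the minimax-robust spectral characteristic is $h^0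=h_{\tau,T}^{(a)}(f^0)$.
   Context: Process and density. The $n$th increment of $\xi$ with step $\tau>0$ is $\xi^{(n)}(t,\tau)=\sum_{l=0}^n(-1)^l\binom nl\xi(t-l\tau)$; $\xi$ has stationary $n$th increments if the first two moments $\mathsf E\xi^{(n)}(t_0,\tau)$ (assumed $0$) and $\mathsf E\xi^{(n)}(t_0+t,\tau_1)\overline{\xi^{(n)}(t_0,\tau_2)}$ do not depend on $t_0$. Then $\xi^{(n)}(t,\tau)=\int e^{it\lambda}\chi_\tau(\lambda)dZ(\lambda)$, $\chi_\tau(\lambda)=(1-e^{-i\lambda\tau})^n\frac{(1+i\lambda)^n}{(i\lambda)^n}$, with $Z$ an orthogonal random measure, $\mathsf E Z(A_1)\overline{Z(A_2)}=F(A_1\cap A_2)$; the spectral density $f\ge0$ is normalized by $dF=\frac1{2\pi}f\,d\lambda$. $H^t(\xi^{(n)})$ is the closed span of $\{\xi^{(n)}(u,\sigma):u\le t,\sigma>0\}$. A function $\varphi\in L_2([0,\infty))$ defines the canonical factorization $f=|\Phi|^2$, $\Phi(\lambda)=\int_0^\infty e^{-i\lambda t}\varphi(t)dt$, if for the increment process with density $f$ there is a process $\eta$ with orthogonal increments, $\mathsf E|\eta(t)-\eta(s)|^2=|t-s|$, $H^z(\xi^{(n)})=H^z(\eta)$ for all $z$ ($H^z(\eta)$ = closed span of increments of $\eta$ on $(-\infty,z]$), and $\xi^{(n)}(t,\sigma)=\int_{-\infty}^t\varphi_\sigma(t-s)d\eta(s)$ (one-sided moving average representation) for all $\sigma>0$,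 where $\varphi_\sigma\in L_2([0,\infty))$ has Fourier transform $\Phi_\sigma(\lambda)=\int_0^\infty e^{-i\lambda t}\varphi_\sigma(t)dt=\chi_\sigma(\lambda)\Phi(\lambda)$. Functions on $[0,T]$ are extended by $0$ to $[0,\infty)$. Operators. $\|\cdot\|$ is the $L_2$ norm, so $\|\varphi\|^2=\frac1{2\pi}\int|\Phi|^2d\lambda$. $\mathbf W^\tau$ is the operator $\varphi\mapsto\varphi_\tau$ (causal convolution operator with Fourier multiplier $\chi_\tau$), its values being used on $[0,T]$. $[x]$ is the integer part; $d(k)$ are defined by $\sum_{k\ge0}d(k)x^k=(\sum_{j\ge0}x^j)^n$; $\mathbf D_T^\tau a(t)=\sum_{k=0}^{[(T-t)/\tau]}a(t+\tau k)d(k)$, $t\in[0,T]$. For $t\in[0,T]$: $(\mathbf D_T^\tau\mathbf A_T\psi)(t)=\sum_{k=0}^{[(T-t)/\tau]}d(k)\int_0^{T-t-\tau k}a(u+t+\tau k)\psi(u)du$ and $(\mathbf D_T^\tau\widehat{\mathbf A}_T\psi)(t)=\sum_{k=0}^{[t/\tau]}d(k)\int_0^{t-\tau k}a(T-t+u+\tau k)\psi(u)du$. Estimation. With $b_{\tau,T}=\mathbf D_T^\tau a$ and $v_{\tau,T}(t)=\sum_{l=\lceil-t/\tau\rceil}^{\min\{[(T-t)/\tau],n\}}(-1)^l\binom nl b_{\tau,T}(t+l\tau)$, one has $A_T\xi=\int_0^Tb_{\tau,T}(t)\xi^{(n)}(t,\tau)dt-\int_{-\tau n}^0v_{\tau,T}(t)\xi(t)dt$.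 Given observations $\xi(t)$, $t<0$, linear estimates are $-\int_{-\tau n}^0v_{\tau,T}\xi\,dt+\int h\chi_\tau dZ$ with spectral characteristic $h$; under density $f$ the mean square error is $\Delta(h;f)=\frac1{2\pi}\int|A_{\tau,T}-h|^2|\chi_\tau|^2f\,d\lambda$, $A_{\tau,T}(\lambda)=\int_0^T\mathbf D_T^\tau a(t)e^{i\lambda t}dt$. For $f$ admitting the canonical factorization the optimal characteristic is $h_{\tau,T}^{(a)}(f)=A_{\tau,T}-r_{\tau,T}^{(a)}\Phi_\tau^{-1}$, $r_{\tau,T}^{(a)}(\lambda)=\int_0^T(\mathbf D_T^\tau\mathbf A_T\varphi_\tau)(t)e^{i\lambda t}dt$, and $\Delta(h_{\tau,T}^{(a)}(f);f)=\|\mathbf D_T^\tau\mathbf A_T\varphi_\tau\|^2$. Minimax notions. For a class $\mathcal D$ of spectral densities, $f^0\in\mathcal D$ is least favorable if $\Delta(h_{\tau,T}^{(a)}(f^0);f^0)=\max_{f\in\mathcal D}\Delta(h_{\tau,T}^{(a)}(f);f)$ (over densities admitting the canonical factorization). $L_2^{0-}(f)$ is the closed subspace of $L_2(f)$ generated by functions $\chi_\tau(\lambda)\int_0^\infty g(t)e^{-i\lambda t}dt$; a characteristic $h$ is said to belong to it if $h\chi_\tau$ does. $H_{\mathcal D}=\bigcap_{f\in\mathcal D}L_2^{0-}(f)$. $h^0\in H_{\mathcal D}$ is minimax-robust if $\min_{h\in H_{\mathcal D}}\sup_{f\in\mathcal D}\Delta(h;f)=\sup_{f\in\mathcal D}\Delta(h^0;f)$.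 *)

(* Defs.v *)
From HB Require Import structures.
From mathcomp Require Import all_boot all_order all_algebra.
From mathcomp Require Import all_classical all_reals all_analysis.
From mathcomp Require Import complex.

Set Implicit Arguments.
Unset Strict Implicit.
Unset Printing Implicit Defensive.

Import Order.TTheory GRing.Theory Num.Theory.
Import numFieldNormedType.Exports.
Local Open Scope classical_set_scope.
Local Open Scope ring_scope.

Section ComplexValued.
Variable R : realType.

Definition normc2 (z : R[i]) : R := complex.Re z ^+ 2 + complex.Im z ^+ 2.

(* e^{i x} for real x *)
Definition expi (x : R) : R[i] := Complex (cos x) (sin x).

Variables (d : measure_display) (U : measurableType d).

Definition cmeasurable (f : U -> R[i]) : Prop :=
  measurable_fun setT (fun x => complex.Re (f x)) /\
  measurable_fun setT (fun x => complex.Im (f x)).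

Variable m : {measure set U -> \bar R}.

Definition cintegral (D : set U) (f : U -> R[i]) : R[i] :=
  Complex (Rintegral m D (fun x => complex.Re (f x)))
          (Rintegral m D (fun x => complex.Im (f x))).

Definition cintegrable (D : set U) (f : U -> R[i]) : Prop :=
  m.-integrable D (fun x => (complex.Re (f x))%:E) /\
  m.-integrable D (fun x => (complex.Im (f x))%:E).

Definition sqnorm (D : set U) (f : U -> R[i]) : \bar R :=
  (\int[m]_(x in D) (normc2 (f x))%:E)%E.

Definition square_integrable (f : U -> R[i]) : Prop :=
  cmeasurable f /\ (sqnorm setT f < +oo)%E.

End ComplexValued.

Section Fourier.
Variable R : realType.
Notation mu := (@lebesgue_measure R).

(* Elements of L_2([0,oo)) and of L_2([0,T]) are represented by functions on
   the whole line that vanish outside the half-line, resp. the segment. *)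
Definition L2_halfline (phi : R -> R[i]) : Prop :=
  square_integrable mu phi /\ forall t, t < 0 -> phi t = 0.

Definition L2_segment (T : R) (phi : R -> R[i]) : Prop :=
  square_integrable mu phi /\ forall t, ~~ (0 <= t <= T) -> phi t = 0.

(* int_0^T g(t) e^{-i lambda t} dt  and  int_0^T g(t) e^{i lambda t} dt *)
Definition fourier_neg (T : R) (g : R -> R[i]) (lambda : R) : R[i] :=
  cintegral mu `[0, T] (fun t => g t * expi (- (lambda * t))).

Definition fourier_pos (T : R) (g : R -> R[i]) (lambda : R) : R[i] :=
  cintegral mu `[0, T] (fun t => g t * expi (lambda * t)).

(* For phi in L_2([0,oo)), int_0^oo e^{-i lambda t} phi(t) dt is a limit in
   mean of the integrals over [0,N]; it is determined up to a null set. *)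
Definition is_fourier (phi Phi : R -> R[i]) : Prop :=
  square_integrable mu Phi /\
  (fun N : nat => sqnorm mu setT
     (fun lambda => Phi lambda - fourier_neg N%:R phi lambda))
    @ \oo --> (0 : \bar R)%E.

Definition fourier (phi : R -> R[i]) : R -> R[i] :=
  xget (fun=> 0) [set Phi | is_fourier phi Phi].

(* At lambda = 0 the division by zero yields 0; the value on this null set is
   irrelevant. *)
Definition chi (n : nat) (tau lambda : R) : R[i] :=
  (1 - expi (- (lambda * tau))) ^+ n * (Complex 1 lambda) ^+ n
    / (Complex 0 lambda) ^+ n.

(* phi |-> phi_tau: the causal convolution operator with multiplier chi_tau,
   determined up to a null set. *)
Definition W (n : nat) (tau : R) (phi : R -> R[i]) : R -> R[i] :=
  xget (fun=> 0) [set psi | L2_halfline psi /\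
    {ae mu, forall lambda,
       fourier psi lambda = chi n tau lambda * fourier phi lambda}].

End Fourier.

Section Processes.
Variables (R : realType) (d : measure_display) (Omega : measurableType d).
Variable P : probability Omega R.
Notation mu := (@lebesgue_measure R).
Notation rv := (Omega -> R[i]).

Definition expectation_c (X : rv) : R[i] := cintegral P setT X.

Definition cov (X Y : rv) : R[i] :=
  expectation_c (fun w => X w * conjc (Y w)).

Definition closed_span (G : set rv) : set rv :=
  [set X | square_integrable P X /\
    forall eps : R, 0 < eps ->
      exists (m : nat) (c : 'I_m -> R[i]) (Y : 'I_m -> rv),
        (forall k, G (Y k)) /\
        (sqnorm P setT (fun w => X w - \sum_(k < m) c k * Y k w)%R
           < eps%:E)%E].

(* X is the integral of g against an orthogonal random set function M, indexed
   by the j in D, with M j attached to the set supp j and structure measure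
   w(x) dx: simple functions \sum c_k 1_{supp j_k} that approximate g in
   L_2(w dx) have integrals \sum c_k M(j_k) that approximate X in mean
   square. *)
Definition stoch_integral (J : Type) (D : set J) (supp : J -> set R)
    (M : J -> rv) (w : R -> R) (g : R -> R[i]) (X : rv) : Prop :=
  square_integrable P X /\
  forall eps : R, 0 < eps ->
    exists (m : nat) (c : 'I_m -> R[i]) (j : 'I_m -> J),
      [/\ forall k, D (j k),
          (\int[mu]_x (normc2 (g x - \sum_(k < m) c k * (\1_(supp (j k)) x)%:C%C)
                         * w x)%:E < eps%:E)%E &
          (sqnorm P setT (fun v => X v - \sum_(k < m) c k * M (j k) v)%R
             < eps%:E)%E].

Definition incr (n : nat) (xi : R -> rv) (t tau : R) : rv :=
  fun w => \sum_(l < n.+1)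
    (-1) ^+ l * ('C(n, l))%:R * xi (t - l%:R * tau) w.

Definition stationary_increments (n : nat) (xi : R -> rv) : Prop :=
  [/\ forall t, cmeasurable (xi t),
      forall t tau, 0 < tau -> square_integrable P (incr n xi t tau),
      forall t tau, 0 < tau -> expectation_c (incr n xi t tau) = 0 &
      forall t0 t1 t tau1 tau2, 0 < tau1 -> 0 < tau2 ->
        cov (incr n xi (t0 + t) tau1) (incr n xi t0 tau2) =
        cov (incr n xi (t1 + t) tau1) (incr n xi t1 tau2)].

Definition spectral_density (f : R -> R) : Prop :=
  [/\ measurable_fun setT f, forall lambda, 0 <= f lambda &
      (\int[mu]_lambda (f lambda)%:E < +oo)%E].

Definition spectral_measure (f : R -> R) (A : set R) : \bar R :=
  (\int[mu]_(lambda in A) (f lambda / (2 * pi))%:E)%E.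

(* Countable additivity in mean square follows from the last clause. *)
Definition orthogonal_random_measure (f : R -> R) (Z : set R -> rv) : Prop :=
  [/\ forall A, measurable A -> square_integrable P (Z A),
      forall A B, measurable A -> measurable B -> A `&` B = set0 ->
        {ae P, forall w, Z (A `|` B) w = Z A w + Z B w} &
      forall A B, measurable A -> measurable B ->
        cov (Z A) (Z B) = (fine (spectral_measure f (A `&` B)))%:C%C].

Definition has_spectral_density (n : nat) (xi : R -> rv) (f : R -> R) : Prop :=
  [/\ stationary_increments n xi, spectral_density f &
      exists Z : set R -> rv,
        orthogonal_random_measure f Z /\
        forall t tau, 0 < tau ->
          stoch_integral (fun A : set R => measurable A) id Z
            (fun lambda => f lambda / (2 * pi))
            (fun lambda => expi (t * lambda) * chi n tau lambda)
            (incr n xi t tau)].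

(* H^z(xi^(n)) *)
Definition H_incr (n : nat) (xi : R -> rv) (z : R) : set rv :=
  closed_span [set X | exists u sigma, [/\ u <= z, 0 < sigma &
                                           X = incr n xi u sigma]].

(* H^z(eta) *)
Definition H_orth (eta : R -> rv) (z : R) : set rv :=
  closed_span [set X | exists s t, [/\ s <= t, t <= z &
                                       X = fun w => eta t w - eta s w]].

Definition orthogonal_increments (eta : R -> rv) : Prop :=
  [/\ forall s t, square_integrable P (fun w => eta t w - eta s w),
      forall s t, sqnorm P setT (fun w => eta t w - eta s w) = `|t - s|%:E &
      forall s t u v, s <= t -> t <= u -> u <= v ->
        cov (fun w => eta t w - eta s w) (fun w => eta v w - eta u w) = 0].

Definition orth_integral (eta : R -> rv) (g : R -> R[i]) (X : rv) : Prop :=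
  stoch_integral [set st : R * R | st.1 <= st.2]
    (fun st : R * R => `]st.1, st.2]%classic)
    (fun (st : R * R) w => eta st.2 w - eta st.1 w) (fun=> 1) g X.

(* X(t) = int_{-oo}^t psi(t - s) d eta(s) *)
Definition one_sided_MA (eta : R -> rv) (psi : R -> R[i]) (X : R -> rv)
    : Prop :=
  forall t, orth_integral eta (fun s => if s <= t then psi (t - s) else 0)
              (X t).

End Processes.

(* The increment process with density f is determined up to a unitary
   equivalence of its span, hence the quantification over all processes. *)
Definition canonical_factorization (R : realType) (n : nat) (f : R -> R)
    (phi : R -> R[i]) : Prop :=
  [/\ L2_halfline phi,
      {ae (@lebesgue_measure R),
         forall lambda, f lambda = normc2 (fourier phi lambda)} &
      forall (d : measure_display) (Omega : measurableType d)
        (P : probability Omega R) (xi : R -> Omega -> R[i]),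
        has_spectral_density P n xi f ->
        exists eta : R -> Omega -> R[i],
          [/\ orthogonal_increments P eta,
              forall z, H_incr P n xi z = H_orth P eta z &
              forall sigma, 0 < sigma ->
                one_sided_MA P eta (W n sigma phi)
                  (fun t => incr n xi t sigma)]].

Section Estimation.
Variables (R : realType) (n : nat) (tau T : R) (a : R -> R[i]).
Notation mu := (@lebesgue_measure R).

(* The coefficient of x^k in (\sum_{j >= 0} x^j)^n; truncating the geometric
   series after x^k does not change it. *)
Definition dcoef (k : nat) : R[i] :=
  ((\poly_(j < k.+1) (1 : R[i])) ^+ n)`_k.

(* D_T^tau applied to a *)
Definition Da (t : R) : R[i] :=
  \sum_(k < (Num.truncn ((T - t) / tau)).+1) a (t + tau * k%:R) * dcoef k.

(* D_T^tau A_T *)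
Definition DA (psi : R -> R[i]) (t : R) : R[i] :=
  \sum_(k < (Num.truncn ((T - t) / tau)).+1)
    dcoef k * cintegral mu `[0, T - t - tau * k%:R]
                (fun u => a (u + t + tau * k%:R) * psi u).

(* D_T^tau \hat A_T *)
Definition DAhat (psi : R -> R[i]) (t : R) : R[i] :=
  \sum_(k < (Num.truncn (t / tau)).+1)
    dcoef k * cintegral mu `[0, t - tau * k%:R]
                (fun u => a (T - t + u + tau * k%:R) * psi u).

(* || D_T^tau A_T W^tau phi ||^2 *)
Definition DAW_norm2 (phi : R -> R[i]) : \bar R :=
  sqnorm mu `[0, T] (DA (W n tau phi)).

Definition A_char (lambda : R) : R[i] := fourier_pos T Da lambda.

Definition mse (h : R -> R[i]) (f : R -> R) : \bar R :=
  (((2 * pi)^-1)%:E *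
   \int[mu]_lambda (normc2 (A_char lambda - h lambda)
                    * normc2 (chi n tau lambda) * f lambda)%:E)%E.

(* h(f), written in terms of the function phi of the canonical factorization
   of f: A - r / Phi_tau. *)
Definition opt_char (phi : R -> R[i]) (lambda : R) : R[i] :=
  A_char lambda
    - fourier_pos T (DA (W n tau phi)) lambda / fourier (W n tau phi) lambda.

Definition is_opt_char (f : R -> R) (h : R -> R[i]) : Prop :=
  exists phi, canonical_factorization n f phi /\ h = opt_char phi.

Definition least_favorable (D : set (R -> R)) (f0 : R -> R) : Prop :=
  D f0 /\
  exists h0, is_opt_char f0 h0 /\
    forall f h, D f -> is_opt_char f h -> (mse h f <= mse h0 f0)%E.

(* Membership of h chi_tau in L_2^{0-}(f); the functions chi_tau G, with G the
   transform of an integrable g on [0,oo), already form a linear space. *)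
Definition L2_minus (f : R -> R) (h : R -> R[i]) : Prop :=
  let X := fun lambda => h lambda * chi n tau lambda in
  [/\ cmeasurable X,
      (\int[mu]_lambda (normc2 (X lambda) * f lambda)%:E < +oo)%E &
      forall eps : R, 0 < eps ->
        exists g : R -> R[i],
          cintegrable mu `[0, +oo[ g /\
          (\int[mu]_lambda (normc2 (X lambda - chi n tau lambda *
              cintegral mu `[0, +oo[ (fun t => g t * expi (- (lambda * t)))%R)
              * f lambda)%:E < eps%:E)%E].

Definition H_class (D : set (R -> R)) : set (R -> R[i]) :=
  [set h | forall f, D f -> L2_minus f h].

Definition minimax_robust (D : set (R -> R)) (h0 : R -> R[i]) : Prop :=
  H_class D h0 /\
  forall h, H_class D h ->
    (ereal_sup [set mse h0 f | f in D] <= ereal_sup [set mse h f | f in D])%E.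

(* |int_0^T phi(t) e^{-i lambda t} dt|^2 *)
Definition density_of (phi : R -> R[i]) (lambda : R) : R :=
  normc2 (fourier_neg T phi lambda).

Definition E1 (phi : R -> R[i]) : Prop :=
  exists alpha : R[i], {ae mu, forall t, 0 <= t <= T ->
    DA (W n tau phi) t = alpha * conjc (phi t)}.

Definition E2 (phi : R -> R[i]) : Prop :=
  exists beta : R[i], {ae mu, forall t, 0 <= t <= T ->
    DAhat (W n tau phi) t = beta * conjc (phi t)}.

(* the density of phi has the form |c int_0^T (D A phi_tau)(t) e^{i lambda t} dt|^2 *)
Definition F_form (phi : R -> R[i]) : Prop :=
  exists c : R[i], {ae mu, forall lambda,
    density_of phi lambda =
    normc2 (c * fourier_pos T (DA (W n tau phi)) lambda)}.

Variable P0 : R.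

Definition D0 : set (R -> R) :=
  [set f | spectral_density f /\
    (((2 * pi)^-1)%:E * \int[mu]_lambda (f lambda)%:E <= P0%:E)%E].

Definition S_eq : set (R -> R[i]) :=
  [set phi | [/\ L2_segment T phi, E1 phi \/ E2 phi,
    sqnorm mu `[0, T] phi = P0%:E, D0 (density_of phi) &
    canonical_factorization n (density_of phi) phi]].

Definition S_plus : set (R -> R[i]) :=
  [set phi | [/\ L2_segment T phi, sqnorm mu `[0, T] phi = P0%:E,
    F_form phi & canonical_factorization n (density_of phi) phi]].

(* v is the maximum of || D_T^tau A_T W^tau phi ||^2 over E; the maximum over
   the empty set is -oo. *)
Definition is_max_DAW (E : set (R -> R[i])) (v : \bar R) : Prop :=
  v = ereal_sup [set DAW_norm2 phi | phi in E] /\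
  (E !=set0 -> exists2 phi, E phi & DAW_norm2 phi = v).

Definition extremal (phi0 : R -> R[i]) : Prop :=
  [/\ L2_segment T phi0, D0 (density_of phi0),
      sqnorm mu `[0, T] phi0 = P0%:E &
      forall phi, L2_segment T phi -> D0 (density_of phi) ->
        (DAW_norm2 phi <= DAW_norm2 phi0)%E].

End Estimation.

(* Main.v *)
Require Import Defs.
From HB Require Import structures.
From mathcomp Require Import all_boot all_order all_algebra.
From mathcomp Require Import all_classical all_reals all_analysis.
From mathcomp Require Import measurable_realfun complex ring lra.

Set Implicit Arguments.
Unset Strict Implicit.
Unset Printing Implicit Defensive.

Import Order.TTheory GRing.Theory Num.Theory.
Import numFieldNormedType.Exports.
Local Open Scope classical_set_scope.
Local Open Scope ring_scope.

(* For phi in L_2([0,oo)) let Phi and Psi = chi_tau Phi be the transforms of phi and W^tau phi, and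
   let r(phi) be the transform of (D A W^tau phi)(-t).  Then r(phi) is the projection of A Psi to the
   transforms of functions of the past, orthogonal to the Hardy class, and |D A W^tau phi|^2 is
   |r(phi)|^2 / (2 pi).  If phi0 has the form (F) then |r(phi0)| = s |Phi0| for a constant s, so that
   g = r(phi0) / Phi0 is bounded by s and k = A chi_tau - g is a bounded multiplier with k Phi0 in the
   Hardy class.  As phi0 is canonical, the functions e^{i lambda u} chi_sigma Phi0 with u <= 0,
   sigma > 0 span the Hardy class, which k hence preserves.  Therefore r(phi) is the projection of
   g Phi for every phi, and |r(phi)| <= s |phi| in norm, with equality only if r(phi) = g Phi, that is
   |r(phi)| <= s |Phi| almost everywhere.  This makes s^2 P_0 the value of the game: the optimal
   characteristic of an extremal phi has error at most s^2 P_0 at every density of D_0, and no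
   characteristic has a smaller error at the density of phi. *)

(** * Complex-valued functions and their real inner product *)

(** Canonicity is stated through all processes with the given density and yields nothing until one
    such process exists; hence a probability space carrying a process with density f is built
    explicitly. Its innovation process eta turns an equality of spans of random variables into a
    density statement about transforms. The Fourier transform is set up in the same way, as the
    integral against a family in L_2 of the frequencies whose increments are orthogonal up to the
    factor 2 pi. A single relation, the closure of a map on step functions, thus covers Plancherel's
    theorem, the moving average and the density of step functions, and its isometry is proved once.
    Causality is orthogonality to transforms of the past; as the past is a complex subspace, the
    real part of the inner product suffices. [fourier] and [W] are choices with default value 0: on
    L_2([0,oo)) [fourier] never takes the default, while for [W] both outcomes are carried along.
    Parts (i) and (ii) rest on one member phis of [S_plus]: its multiplier gives the upper bound,
    and every canonical phi0 with squared norm P_0 and the same value is least favorable. *)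

Section ComplexAlgebra.
Variable R : realType.
Implicit Types (z w c : R[i]) (x y r : R).
Local Notation Re := (@complex.Re R).
Local Notation Im := (@complex.Im R).

Lemma Re_add z w : Re (z + w) = Re z + Re w. Proof. by case: z; case: w. Qed.
Lemma Im_add z w : Im (z + w) = Im z + Im w. Proof. by case: z; case: w. Qed.
Lemma Re_opp z : Re (- z) = - Re z. Proof. by case: z. Qed.
Lemma Im_opp z : Im (- z) = - Im z. Proof. by case: z. Qed.
Lemma Re_mul z w : Re (z * w) = Re z * Re w - Im z * Im w.
Proof. by case: z; case: w. Qed.
Lemma Im_mul z w : Im (z * w) = Re z * Im w + Im z * Re w.
Proof. by case: z => a b; case: w => c d. Qed.
Lemma Re_conj z : Re (conjc z) = Re z. Proof. by case: z. Qed.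
Lemma Im_conj z : Im (conjc z) = - Im z. Proof. by case: z. Qed.

Definition ReImE := (Re_add, Im_add, Re_opp, Im_opp, Re_mul, Im_mul, Re_conj, Im_conj).

Lemma eq_ReIm z w : Re z = Re w -> Im z = Im w -> z = w.
Proof. by case: z => a b; case: w => c d /= -> ->. Qed.

Lemma Re_sum (I : Type) (s : seq I) (F : I -> R[i]) :
  Re (\sum_(i <- s) F i) = \sum_(i <- s) Re (F i).
Proof. by elim/big_rec2: _ => // i y1 y2 _ <-; rewrite Re_add. Qed.

Lemma Im_sum (I : Type) (s : seq I) (F : I -> R[i]) :
  Im (\sum_(i <- s) F i) = \sum_(i <- s) Im (F i).
Proof. by elim/big_rec2: _ => // i y1 y2 _ <-; rewrite Im_add. Qed.

Definition rdot z w : R := Re z * Re w + Im z * Im w.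

Lemma rdotC z w : rdot z w = rdot w z. Proof. by rewrite /rdot; ring. Qed.
Lemma rdotDl z1 z2 w : rdot (z1 + z2) w = rdot z1 w + rdot z2 w.
Proof. by rewrite /rdot !ReImE; ring. Qed.
Lemma rdotMl c z w : rdot (c * z) w = rdot z (conjc c * w).
Proof. by rewrite /rdot !ReImE; ring. Qed.
Lemma rdotZl c z w :
  rdot (c * z) w = Re c * rdot z w + Im c * rdot ('i%C * z) w.
Proof. by rewrite /rdot !ReImE /=; ring. Qed.
Lemma rdotRl r z w : rdot (r%:C%C * z) w = r * rdot z w.
Proof. by rewrite /rdot !ReImE /=; ring. Qed.
Lemma rdotNl z w : rdot (- z) w = - rdot z w.
Proof. by rewrite /rdot !ReImE; ring. Qed.

Lemma normc2_rdot z : normc2 z = rdot z z.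
Proof. by rewrite /normc2 /rdot !expr2. Qed.
Lemma normc2_ge0 z : 0 <= normc2 z.
Proof. by rewrite addr_ge0 ?sqr_ge0. Qed.
Lemma normc2M z w : normc2 (z * w) = normc2 z * normc2 w.
Proof. by rewrite /normc2 !ReImE; ring. Qed.
Lemma normc2D z w : normc2 (z + w) = normc2 z + 2 * rdot z w + normc2 w.
Proof. by rewrite /normc2 /rdot !ReImE; ring. Qed.
Lemma normc2N z : normc2 (- z) = normc2 z.
Proof. by rewrite /normc2 !ReImE; ring. Qed.
Lemma normc2_conj z : normc2 (conjc z) = normc2 z.
Proof. by rewrite /normc2 !ReImE; ring. Qed.
Lemma normc2_real r : normc2 r%:C%C = r ^+ 2.
Proof. by rewrite /normc2 /= expr0n addr0. Qed.
Lemma normc2_0 : normc2 (0 : R[i]) = 0.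
Proof. by rewrite /normc2 /= expr0n addr0. Qed.
Lemma normc2_1 : normc2 (1 : R[i]) = 1.
Proof. by rewrite /normc2 /= expr0n expr1n addr0. Qed.
Lemma normc2_eq0 z : (normc2 z == 0) = (z == 0).
Proof.
by case: z => a b; rewrite /normc2 /= paddr_eq0 ?sqr_ge0// !sqrf_eq0 eq_complex.
Qed.
Lemma normc2V z : normc2 z^-1 = (normc2 z)^-1.
Proof.
have [->|z0] := eqVneq z 0; first by rewrite invr0 normc2_0 invr0.
have n0 : normc2 z != 0 by rewrite normc2_eq0.
by apply: (mulfI n0); rewrite -normc2M !mulfV// normc2_1.
Qed.
Lemma normc2X z k : normc2 (z ^+ k) = normc2 z ^+ k.
Proof.
by elim: k => [|k ih]; rewrite ?expr0 ?normc2_1// !exprS normc2M ih.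
Qed.
Lemma normc2D_le z w : normc2 (z + w) <= 2 * normc2 z + 2 * normc2 w.
Proof.
rewrite -subr_ge0 (_ : _ - _ = normc2 (z - w)) ?normc2_ge0//.
by rewrite /normc2 !ReImE; ring.
Qed.
Lemma normr_rdot_le z w : `|rdot z w| <= (normc2 z + normc2 w) / 2.
Proof.
rewrite ler_norml; apply/andP; split.
  have := normc2_ge0 (z + w); rewrite normc2D; lra.
have := normc2_ge0 (z - w); rewrite normc2D normc2N rdotC rdotNl rdotC; lra.
Qed.
Lemma sqr_Re_le z : Re z ^+ 2 <= normc2 z.
Proof. by rewrite lerDl sqr_ge0. Qed.
Lemma sqr_Im_le z : Im z ^+ 2 <= normc2 z.
Proof. by rewrite lerDr sqr_ge0. Qed.

Lemma conjcM z w : conjc (z * w) = conjc z * conjc w.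
Proof. by apply: eq_ReIm; rewrite !ReImE; ring. Qed.

Lemma expiD x y : expi (x + y) = expi x * expi y :> R[i].
Proof. by rewrite /expi; apply: eq_ReIm; rewrite !ReImE /= ?cosD ?sinD//; ring. Qed.
Lemma expi0 : expi 0 = 1 :> R[i].
Proof. by rewrite /expi cos0 sin0. Qed.
Lemma expiN x : expi (- x) = conjc (expi x) :> R[i].
Proof. by rewrite /expi cosN sinN. Qed.
Lemma normc2_expi x : normc2 (expi x : R[i]) = 1.
Proof. by rewrite /normc2 /= cos2Dsin2. Qed.

End ComplexAlgebra.

Section ComplexMeasurability.
Context (R : realType) (d : measure_display) (U : measurableType d).
Implicit Types f g : U -> R[i].

Lemma cmeasurable_cst (c : R[i]) : cmeasurable (fun _ : U => c).
Proof. by split; exact: measurable_cst. Qed.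

Lemma cmeasurableD f g : cmeasurable f -> cmeasurable g ->
  cmeasurable (fun x => f x + g x).
Proof.
by move=> [f1 f2] [g1 g2]; split;
  [under eq_fun do rewrite Re_add | under eq_fun do rewrite Im_add];
  exact: measurable_funD.
Qed.

Lemma cmeasurableN f : cmeasurable f -> cmeasurable (fun x => - f x).
Proof.
by move=> [f1 f2]; split;
  [under eq_fun do rewrite Re_opp | under eq_fun do rewrite Im_opp];
  exact: measurableT_comp.
Qed.

Lemma cmeasurableB f g : cmeasurable f -> cmeasurable g ->
  cmeasurable (fun x => f x - g x).
Proof. by move=> mf mg; apply: cmeasurableD => //; exact: cmeasurableN. Qed.

Lemma cmeasurableM f g : cmeasurable f -> cmeasurable g ->
  cmeasurable (fun x => f x * g x).
Proof.
by move=> [f1 f2] [g1 g2]; split;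
  [under eq_fun do rewrite Re_mul; apply: measurable_funB |
   under eq_fun do rewrite Im_mul; apply: measurable_funD];
  exact: measurable_funM.
Qed.

Lemma cmeasurable_conj f : cmeasurable f -> cmeasurable (fun x => conjc (f x)).
Proof.
by move=> [f1 f2]; split;
  [under eq_fun do rewrite Re_conj | under eq_fun do rewrite Im_conj];
  try exact: measurableT_comp.
Qed.

Lemma cmeasurable_real (f : U -> R) : measurable_fun setT f ->
  cmeasurable (fun x => (f x)%:C%C).
Proof. by move=> mf; split => //=; exact: measurable_cst. Qed.

Lemma cmeasurableX f k : cmeasurable f -> cmeasurable (fun x => f x ^+ k).
Proof.
move=> mf; elim: k => [|k ih]; first exact: cmeasurable_cst.
by under eq_fun do rewrite exprS; exact: cmeasurableM.
Qed.

Lemma cmeasurable_sum (I : Type) (s : seq I) (F : I -> U -> R[i]) :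
  (forall i, cmeasurable (F i)) -> cmeasurable (fun x => \sum_(i <- s) F i x).
Proof.
move=> mF; elim: s => [|i s ih].
  by under eq_fun do rewrite big_nil; exact: cmeasurable_cst.
by under eq_fun do rewrite big_cons; exact: cmeasurableD.
Qed.

Lemma measurable_rdot f g : cmeasurable f -> cmeasurable g ->
  measurable_fun setT (fun x => rdot (f x) (g x)).
Proof.
by move=> [f1 f2] [g1 g2]; apply: measurable_funD; exact: measurable_funM.
Qed.

Lemma measurable_normc2 f : cmeasurable f ->
  measurable_fun setT (fun x => normc2 (f x)).
Proof.
by move=> mf; under eq_fun do rewrite normc2_rdot; exact: measurable_rdot.
Qed.

Lemma cmeasurableV f : cmeasurable f -> cmeasurable (fun x => (f x)^-1).
Proof.
move=> mf; have mn := measurable_normc2 mf.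
have mV : measurable_fun setT (fun x => (normc2 (f x))^-1).
  (* On nonnegative reals the inverse is the power -1, a measurable function on the whole line; at 0
     both are 0. *)
  under eq_fun do rewrite -powR_inv1 ?normc2_ge0//.
  by apply: (measurableT_comp (measurable_powR _)).
rewrite (_ : (fun _ => _) = fun x => conjc (f x) * ((normc2 (f x))^-1)%:C%C); last first.
  apply/funext => x; have [->|z0] := eqVneq (f x) 0.
    by rewrite invr0 normc2_0 invr0 mulr0.
  apply: (mulfI z0); rewrite mulfV// mulrA.
  have -> : f x * conjc (f x) = (normc2 (f x))%:C%C.
    by apply: eq_ReIm; rewrite !ReImE /normc2 /=; ring.
  by rewrite -rmorphM mulfV// normc2_eq0.
apply: cmeasurableM; first exact: cmeasurable_conj.
exact: cmeasurable_real.
Qed.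

Lemma cmeasurable_indic (A : set U) : measurable A ->
  cmeasurable (fun x => (\1_A x : R)%:C%C).
Proof. by move=> mA; apply: cmeasurable_real; exact: measurable_indic. Qed.

End ComplexMeasurability.

(** * Real inner product and norm on L_2 *)

Section SquareIntegrable.
Context (R : realType) (d : measure_display) (U : measurableType d).
Variable m : {measure set U -> \bar R}.
Implicit Types (f g h : U -> R[i]) (c : R[i]).
Local Notation L2 := (square_integrable m).

(** The real part of the complex inner product. It determines norms and orthogonality to complex
    subspaces, and keeps all identities real-valued. *)
Definition rip f g : R := Rintegral m setT (fun x => rdot (f x) (g x)).
(** The squared norm, without a root, so that estimates stay polynomial. [fine] sends an infinite
    integral to 0, hence membership in L_2 always accompanies its use. *)
Definition nrm2 f : R := fine (sqnorm m setT f).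

Lemma nrm2_rip f : nrm2 f = rip f f.
Proof. by rewrite /rip /Rintegral; under eq_integral do rewrite -normc2_rdot. Qed.

Lemma sqnorm_ge0 D f : (0 <= sqnorm m D f)%E.
Proof. by apply: integral_ge0 => x _; rewrite lee_fin normc2_ge0. Qed.

Lemma nrm2_ge0 f : 0 <= nrm2 f.
Proof. by rewrite fine_ge0// sqnorm_ge0. Qed.

Lemma sqnormE f : L2 f -> sqnorm m setT f = (nrm2 f)%:E.
Proof. by move=> [_ f2]; rewrite fineK// ge0_fin_numE// sqnorm_ge0. Qed.

Lemma le_sqnorm f (g : U -> R) : cmeasurable f -> measurable_fun setT g ->
  (forall x, normc2 (f x) <= g x) ->
  (sqnorm m setT f <= \int[m]_x (g x)%:E)%E.
Proof.
move=> mf mg fg; apply: ge0_le_integral => //.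
- by move=> x _; rewrite lee_fin normc2_ge0.
- by apply/measurable_EFinP; exact: measurable_normc2.
- exact/measurable_EFinP.
- by move=> x _; rewrite lee_fin.
Qed.

Lemma sqintM (k : U -> R[i]) C f : cmeasurable k ->
  (forall x, normc2 (k x) <= C) -> L2 f -> L2 (fun x => k x * f x).
Proof.
move=> mk kC [mf f2]; split; first exact: cmeasurableM.
have mn := measurable_normc2 mf.
apply: (@le_lt_trans _ _ (\int[m]_x (C * normc2 (f x))%:E)%E).
  apply: le_sqnorm; [exact: cmeasurableM|exact: measurable_funM|].
  by move=> x; rewrite normc2M ler_wpM2r// normc2_ge0.
under eq_integral do rewrite EFinM.
(* A negative C is contradicted at any point of the domain, so the integrand is then vacuously 0. *)
have [C0|C0] := leP 0 C; last first.
  rewrite (_ : (fun x => _) = cst 0%E) ?integral0//.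
  apply/funext => x; have := le_lt_trans (kC x) C0.
  by rewrite ltNge normc2_ge0.
rewrite ge0_integralZl//.
- by rewrite lte_mul_pinfty// lee_fin.
- exact/measurable_EFinP.
- by move=> x _; rewrite lee_fin normc2_ge0.
Qed.

Lemma sqintZ c f : L2 f -> L2 (fun x => c * f x).
Proof.
by apply: (@sqintM (fun=> c) (normc2 c)) => //; exact: cmeasurable_cst.
Qed.

Lemma sqintN f : L2 f -> L2 (fun x => - f x).
Proof. by move=> /(@sqintZ (-1)); under eq_fun do rewrite mulN1r. Qed.

Lemma sqintD f g : L2 f -> L2 g -> L2 (fun x => f x + g x).
Proof.
move=> [mf f2] [mg g2]; split; first exact: cmeasurableD.
have mnf := measurable_normc2 mf; have mng := measurable_normc2 mg.
apply: (@le_lt_trans _ _ (\int[m]_x (2 * normc2 (f x) + 2 * normc2 (g x))%:E)%E).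
  apply: le_sqnorm => [||x]; [exact: cmeasurableD| |exact: normc2D_le].
  by apply: measurable_funD; exact: measurable_funM.
under eq_integral do rewrite EFinD !EFinM.
rewrite ge0_integralD//=; last first.
- by under eq_fun do rewrite -EFinM; apply/measurable_EFinP; exact: measurable_funM.
- by move=> x _; rewrite mule_ge0// lee_fin normc2_ge0.
- by under eq_fun do rewrite -EFinM; apply/measurable_EFinP; exact: measurable_funM.
- by move=> x _; rewrite mule_ge0// lee_fin normc2_ge0.
rewrite !ge0_integralZl//; try (by move=> x _; rewrite lee_fin normc2_ge0);
  try exact/measurable_EFinP.
by rewrite lte_add_pinfty// lte_mul_pinfty// lee_fin.
Qed.

Lemma sqintB f g : L2 f -> L2 g -> L2 (fun x => f x - g x).
Proof. by move=> f2 g2; apply: sqintD => //; exact: sqintN. Qed.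

Lemma sqint0 : L2 (fun=> 0).
Proof.
split; first exact: cmeasurable_cst.
by rewrite /sqnorm; under eq_integral do rewrite normc2_0; rewrite integral0.
Qed.

Lemma sqint_sum (I : Type) (s : seq I) (F : I -> U -> R[i]) :
  (forall i, L2 (F i)) -> L2 (fun x => \sum_(i <- s) F i x).
Proof.
move=> FL; elim: s => [|i s ih].
  by under eq_fun do rewrite big_nil; exact: sqint0.
by under eq_fun do rewrite big_cons; exact: sqintD.
Qed.

Lemma integrable_normc2 f : L2 f -> m.-integrable setT (EFin \o (fun x => normc2 (f x))).
Proof.
move=> [mf f2]; apply/integrableP; split.
  by apply/measurable_EFinP; exact: measurable_normc2.
by under eq_integral => x _ do rewrite /= ger0_norm ?normc2_ge0//.
Qed.

Lemma integrable_rdot f g : L2 f -> L2 g ->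
  m.-integrable setT (EFin \o (fun x => rdot (f x) (g x))).
Proof.
move=> f2 g2.
apply: (@le_integrable _ _ _ _ _ _ _ (EFin \o (fun x => normc2 (f x) + normc2 (g x)))) => //.
- by apply/measurable_EFinP; apply: measurable_rdot; [case: f2|case: g2].
- move=> x _ /=; rewrite lee_fin.
  have f0 := normc2_ge0 (f x); have g0 := normc2_ge0 (g x).
  rewrite (le_trans (normr_rdot_le _ _))// (ger0_norm (addr_ge0 f0 g0)).
  lra.
- exact: (integrableD measurableT (integrable_normc2 f2) (integrable_normc2 g2)).
Qed.

Lemma ripC f g : rip f g = rip g f.
Proof. by apply: eq_Rintegral => x _; rewrite rdotC. Qed.

Lemma ripDl f g h : L2 f -> L2 g -> L2 h ->
  rip (fun x => f x + g x) h = rip f h + rip g h.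
Proof.
move=> f2 g2 h2; rewrite /rip -RintegralD//; try exact: integrable_rdot.
by apply: eq_Rintegral => x _; rewrite rdotDl.
Qed.

Lemma ripDr f g h : L2 f -> L2 g -> L2 h ->
  rip h (fun x => f x + g x) = rip h f + rip h g.
Proof. by move=> *; rewrite ripC ripDl// !(ripC h). Qed.

Lemma ripMl (k : U -> R[i]) f g :
  rip (fun x => k x * f x) g = rip f (fun x => conjc (k x) * g x).
Proof. by apply: eq_Rintegral => x _; rewrite rdotMl. Qed.

Lemma ripRl r f g : L2 f -> L2 g -> rip (fun x => r%:C%C * f x) g = r * rip f g.
Proof.
move=> f2 g2; rewrite /rip -RintegralZl//; last exact: integrable_rdot.
by apply: eq_Rintegral => x _; rewrite rdotRl.
Qed.

Lemma ripNl f g : L2 f -> L2 g -> rip (fun x => - f x) g = - rip f g.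
Proof.
move=> f2 g2; rewrite -[RHS]mulN1r -ripRl//.
by apply: eq_Rintegral => x _; rewrite rmorphN1 mulN1r.
Qed.

Lemma ripNr f g : L2 f -> L2 g -> rip f (fun x => - g x) = - rip f g.
Proof. by move=> *; rewrite ripC ripNl// ripC. Qed.

Lemma ripBl f g h : L2 f -> L2 g -> L2 h ->
  rip (fun x => f x - g x) h = rip f h - rip g h.
Proof. by move=> f2 g2 h2; rewrite ripDl ?ripNl//; exact: sqintN. Qed.

Lemma rip0l g : rip (fun=> 0) g = 0.
Proof.
rewrite /rip (_ : (fun x => _) = cst 0) ?Rintegral0//; last first.
  by apply/funext => x; rewrite /rdot !mul0r addr0.
by rewrite /Rintegral integral0.
Qed.

Lemma rip_suml (I : Type) (s : seq I) (F : I -> U -> R[i]) g :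
  (forall i, L2 (F i)) -> L2 g ->
  rip (fun x => \sum_(i <- s) F i x) g = \sum_(i <- s) rip (F i) g.
Proof.
move=> FL gL; elim: s => [|i s ih].
  by under [in LHS]eq_fun do rewrite big_nil; rewrite big_nil rip0l.
under [in LHS]eq_fun do rewrite big_cons.
by rewrite big_cons -ih ripDl//; exact: sqint_sum.
Qed.

Lemma ripZl c f g : L2 f -> L2 g ->
  rip (fun x => c * f x) g =
  complex.Re c * rip f g + complex.Im c * rip (fun x => 'i%C * f x) g.
Proof.
move=> f2 g2; have i2 := @sqintZ 'i%C _ f2.
rewrite -!ripRl// -ripDl//; try exact: sqintZ.
apply: eq_Rintegral => x _; congr rdot.
by apply: eq_ReIm; rewrite !ReImE /=; ring.
Qed.

Lemma nrm2D f g : L2 f -> L2 g ->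
  nrm2 (fun x => f x + g x) = nrm2 f + 2 * rip f g + nrm2 g.
Proof.
move=> f2 g2; rewrite !nrm2_rip ripDl ?ripDr//; try exact: sqintD.
by rewrite (ripC g f); ring.
Qed.

Lemma nrm2N f : nrm2 (fun x => - f x) = nrm2 f.
Proof.
by rewrite /nrm2 /sqnorm; under eq_integral do rewrite normc2N.
Qed.

Lemma nrm2B f g : L2 f -> L2 g ->
  nrm2 (fun x => f x - g x) = nrm2 f - 2 * rip f g + nrm2 g.
Proof.
by move=> f2 g2; rewrite nrm2D ?nrm2N ?ripNr//; [ring|exact: sqintN].
Qed.

Lemma nrm2BC f g : nrm2 (fun x => f x - g x) = nrm2 (fun x => g x - f x).
Proof. by rewrite -nrm2N; congr nrm2; apply/funext => x; rewrite opprB. Qed.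

Lemma nrm2Z c f : L2 f -> nrm2 (fun x => c * f x) = normc2 c * nrm2 f.
Proof.
move=> f2; rewrite !nrm2_rip /rip -RintegralZl//; last exact: integrable_rdot.
by apply: eq_Rintegral => x _; rewrite -!normc2_rdot normc2M.
Qed.

Lemma nrm2D_le f g : L2 f -> L2 g ->
  nrm2 (fun x => f x + g x) <= 2 * nrm2 f + 2 * nrm2 g.
Proof.
move=> f2 g2; have := nrm2_ge0 (fun x => f x - g x).
by rewrite nrm2B// nrm2D//; lra.
Qed.

Lemma nrm2_triangle f g h : L2 f -> L2 g -> L2 h ->
  nrm2 (fun x => f x - h x) <=
    2 * nrm2 (fun x => f x - g x) + 2 * nrm2 (fun x => g x - h x).
Proof.
move=> f2 g2 h2; rewrite (_ : (fun x => f x - h x) =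
  fun x => (f x - g x) + (g x - h x)); first by apply: nrm2D_le; exact: sqintB.
by apply/funext => x; rewrite addrA subrK.
Qed.

Lemma cauchy_schwarz f g : L2 f -> L2 g -> rip f g ^+ 2 <= nrm2 f * nrm2 g.
Proof.
move=> f2 g2.
have q r : 0 <= nrm2 f - 2 * (r * rip f g) + r ^+ 2 * nrm2 g.
  have := nrm2_ge0 (fun x => f x - r%:C%C * g x).
  rewrite nrm2B//; last exact: sqintZ.
  by rewrite nrm2Z// normc2_real ripC ripRl// (ripC g).
have [g0|g0] := eqVneq (nrm2 g) 0; last first.
  have gp : 0 < nrm2 g by rewrite lt_neqAle eq_sym g0 nrm2_ge0.
  have := q (rip f g / nrm2 g); rewrite -(pmulr_rge0 _ gp).
  rewrite [X in 0 <= X](_ : _ = nrm2 f * nrm2 g - rip f g ^+ 2) ?subr_ge0//.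
  by field.
rewrite g0 mulr0 leNgt; apply/negP => r0.
have rn : rip f g != 0 by move: r0; rewrite exprn_even_gt0.
(* With g of norm 0 the quadratic is affine in r, and this r gives it the value -1. *)
have := q ((nrm2 f + 1) / (2 * rip f g)); rewrite g0 mulr0 addr0.
rewrite (_ : 2 * _ = nrm2 f + 1); last by field.
by rewrite leNgt; apply/negP/negPn; lra.
Qed.

Lemma nrm2_eq0 f : L2 f -> nrm2 f = 0 -> {ae m, forall x, f x = 0}.
Proof.
move=> f2 f0; have := sqnormE f2; rewrite f0 => h.
have mE : measurable_fun setT (EFin \o (fun x => normc2 (f x))).
  by apply/measurable_EFinP; case: f2 => mf _; exact: measurable_normc2.
have /(@ae_eq_integral_abs _ _ _ m _ measurableT _ mE) :
    (\int[m]_x `|(EFin \o (fun x => normc2 (f x))) x| = 0)%E.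
  rewrite -[RHS]h; apply: eq_integral => x _.
  by rewrite /= ger0_norm// normc2_ge0.
apply: filterS => x /(_ Logic.I) /= [] /eqP; rewrite normc2_eq0 => /eqP.
by [].
Qed.

Lemma eq_rip_ae f f' g : L2 f -> L2 f' -> L2 g ->
  {ae m, forall x, f x = f' x} -> rip f g = rip f' g.
Proof.
move=> f2 f2' g2 ff'; rewrite /rip /Rintegral; congr fine.
apply: ae_eq_integral => //.
- by apply: measurable_int; exact: (integrable_rdot f2 g2).
- by apply: measurable_int; exact: (integrable_rdot f2' g2).
- by apply: filterS ff' => x /= -> _.
Qed.

Lemma eq_sqnorm_ae f f' : cmeasurable f -> cmeasurable f' ->
  {ae m, forall x, f x = f' x} -> sqnorm m setT f = sqnorm m setT f'.
Proof.
move=> f2 f2' ff'; apply: ae_eq_integral => //.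
- by apply/measurable_EFinP; exact: measurable_normc2.
- by apply/measurable_EFinP; exact: measurable_normc2.
- by apply: filterS ff' => x /= -> _.
Qed.

Lemma eq_nrm2_ae f f' : cmeasurable f -> cmeasurable f' ->
  {ae m, forall x, f x = f' x} -> nrm2 f = nrm2 f'.
Proof. by move=> *; rewrite /nrm2 (eq_sqnorm_ae (f' := f')). Qed.

Lemma sqint_ae f f' : cmeasurable f' -> L2 f ->
  {ae m, forall x, f x = f' x} -> L2 f'.
Proof. by move=> mf' [mf f2] h; split; rewrite // -(eq_sqnorm_ae mf). Qed.

End SquareIntegrable.

(** * Completeness of L_2 *)

Section Completeness.
Context (R : realType) (d : measure_display) (U : measurableType d).
Variable m : {measure set U -> \bar R}.
Implicit Types (f g h : U -> R[i]) (c : R[i]).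
Local Notation L2 := (square_integrable m).

Definition cconv (z_ : nat -> R[i]) (z : R[i]) :=
  ((fun k => complex.Re (z_ k)) @ \oo --> complex.Re z) /\
  ((fun k => complex.Im (z_ k)) @ \oo --> complex.Im z).

Lemma cconvB (z_ w_ : nat -> R[i]) z w : cconv z_ z -> cconv w_ w ->
  cconv (fun k => z_ k - w_ k) (z - w).
Proof.
move=> [z1 z2] [w1 w2]; split; rewrite ?ReImE.
  by under eq_fun do rewrite !ReImE; exact: cvgB.
by under eq_fun do rewrite !ReImE; exact: cvgB.
Qed.

Lemma cconv_cst (z : R[i]) : cconv (fun=> z) z.
Proof. by split; exact: cvg_cst. Qed.

Lemma cconv_normc2 z_ (z : R[i]) : cconv z_ z ->
  (fun k => normc2 (z_ k)) @ \oo --> normc2 z.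
Proof. by move=> [h1 h2]; apply: cvgD; rewrite expr2; under eq_fun do rewrite expr2; exact: cvgM. Qed.

Lemma limn_einf_le (u : (\bar R)^nat) C : (forall k, (u k <= C)%E) ->
  (limn_einf u <= C)%E.
Proof.
move=> uC; rewrite limn_einf_lim; apply: lime_le; first exact: is_cvg_einfs.
apply: nearW => k; apply: le_trans (uC k); apply: ereal_inf_lbound.
by exists k => //=.
Qed.

(** Fatou's lemma, delivering membership in L_2 and the bound together: the way in which a merely
    pointwise limit is recognized as a limit in norm. *)
Lemma nrm2_fatou (f_ : nat -> U -> R[i]) f C :
  (forall k, L2 (f_ k)) -> cmeasurable f ->
  {ae m, forall x, cconv (f_ ^~ x) (f x)} ->
  (forall k, nrm2 m (f_ k) <= C) -> L2 f /\ nrm2 m f <= C.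
Proof.
move=> fL mf ff fC.
have mk k : measurable_fun setT (fun x => (normc2 (f_ k x))%:E).
  by apply/measurable_EFinP; apply: measurable_normc2; case: (fL k).
have := @fatou _ _ _ m setT measurableT (fun k x => (normc2 (f_ k x))%:E) mk.
have nk (k : nat) x : setT x -> (0 <= (normc2 (f_ k x))%:E)%E.
  by rewrite lee_fin normc2_ge0.
move=> /(_ nk) F.
have F1 : (sqnorm m setT f <= C%:E)%E.
  apply: le_trans (le_trans F _); last first.
    by apply: limn_einf_le => k; rewrite -/(sqnorm m setT _) sqnormE// lee_fin.
  rewrite le_eqVlt; apply/orP; left; apply/eqP; apply: ae_eq_integral => //.
  - by apply/measurable_EFinP; exact: measurable_normc2.
  - apply: (@emeasurable_fun_cvg _ _ _ _
      (fun n x => einfs (fun k => (normc2 (f_ k x))%:E) n)) => [n|x _].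
      exact: measurable_fun_einfs.
    by rewrite limn_einf_lim; exact: is_cvg_einfs.
  - apply: filterS ff => x /cconv_normc2 h _.
    have /cvg_limn_einf_sup[-> _] : (normc2 (f_ k x))%:E @[k --> \oo] --> (normc2 (f x))%:E.
      by apply: cvg_EFin => //; exact: nearW.
    by [].
have L : L2 f by split=> //; apply: le_lt_trans F1 _; rewrite ltry.
by split=> //; rewrite -lee_fin -sqnormE.
Qed.

Lemma sum_geometric4 k : \sum_(0 <= i < k) (4^-1 : R) ^+ i <= 2.
Proof.
suff : 3 * \sum_(0 <= i < k) (4^-1 : R) ^+ i = 4 - 4 * (4^-1) ^+ k.
  by have : 0 <= (4^-1 : R) ^+ k by []; lra.
elim: k => [|k ih]; first by rewrite big_geq// expr0; lra.
by rewrite big_nat_recr//= mulrDr ih exprS; lra.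
Qed.

Lemma fast_cauchy_cvg (u : nat -> R) C :
  (forall k, 4 ^+ k * (u k.+1 - u k) ^+ 2 <= C) -> cvgn u.
Proof.
move=> uC.
have C0 : 0 <= C by apply: le_trans (uC 0%N); rewrite mulr_ge0 ?sqr_ge0.
(* C + 1 stands in for the square root of C, as C is at most (C + 1)^2; the factor 4^k then leaves a
   geometric series of ratio 1/2. *)
have b k : `|u k.+1 - u k| <= (C + 1) * (2^-1) ^+ k.
  rewrite -(@ler_pXn2r _ 2)//; last first.
    by rewrite nnegrE mulr_ge0// addr_ge0.
  have p4 : 0 < (4 : R) ^+ k by rewrite exprn_gt0.
  rewrite -normrX ger0_norm ?sqr_ge0// -(ler_pM2l p4) (le_trans (uC k))//.
  rewrite exprMn mulrCA -exprM mulnC exprM -exprMn.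
  rewrite (_ : 4 * 2^-1 ^+ 2 = 1 :> R) ?expr1n ?mulr1; last by field.
  by rewrite expr2; nra.
have : cvgn (series (telescope u)).
  apply: normed_cvg; apply: (@series_le_cvg _ _ (geometric (C + 1) 2^-1)) => //.
  - by move=> k; rewrite /=.
  - by move=> k; rewrite /geometric /= mulr_ge0// addr_ge0.
  - by apply: is_cvg_geometric_series; rewrite ger0_norm// invf_lt1// ltr1n.
move=> cs; rewrite (_ : u = fun k => u 0%N + series (telescope u) k); last first.
  by apply/funext => k; exact: eq_sum_telescope.
by apply: is_cvgD => //; exact: is_cvg_cst.
Qed.

(** The squared increments, of integral at most 16^-k, remain summable after weighting by 4^k. The
    weighted series is integrable, hence finite almost everywhere, and where it is finite it bounds
    all its terms, which forces convergence by [fast_cauchy_cvg]. *)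
Lemma square_integrable_complete_fast (f_ : nat -> U -> R[i]) :
  (forall k, L2 (f_ k)) ->
  (forall k, nrm2 m (fun x => f_ k.+1 x - f_ k x) <= 16^-1 ^+ k) ->
  exists f, cmeasurable f /\ {ae m, forall x, cconv (f_ ^~ x) (f x)}.
Proof.
move=> fL fC.
pose g (k : nat) x : \bar R := (4 ^+ k * normc2 (f_ k.+1 x - f_ k x))%:E.
have gL k : L2 (fun x => f_ k.+1 x - f_ k x) by exact: sqintB.
have mn k : measurable_fun setT (fun x => normc2 (f_ k.+1 x - f_ k x)).
  by apply: measurable_normc2; case: (gL k).
have mg k : measurable_fun setT (g k).
  by apply/measurable_EFinP; exact: measurable_funM.
have g0 k x : (0 <= g k x)%E.
  by rewrite lee_fin mulr_ge0// ?normc2_ge0// exprn_ge0.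
pose e x := (\sum_(0 <= k <oo) g k x)%E.
have me : measurable_fun setT e.
  by apply: (@ge0_emeasurable_sum _ _ _ _ _ xpredT) => // k x _ _.
have e0 x : (0 <= e x)%E by apply: nneseries_ge0.
have ie : m.-integrable setT e.
  apply/integrableP; split=> //.
  under eq_integral => x _ do rewrite gee0_abs//.
  rewrite integral_nneseries//; apply: (@le_lt_trans _ _ 2%:E); last exact: ltry.
  apply: lime_le; first by apply: is_cvg_nneseries => *; exact: integral_ge0.
  apply: nearW => k; apply: (@le_trans _ _ (\sum_(0 <= i < k) (4^-1 ^+ i)%:E)%E).
    apply: lee_sum => i _; rewrite /g.
    under eq_integral do rewrite EFinM.
    rewrite ge0_integralZl//; last 2 first.
    - exact/measurable_EFinP.
    - by move=> x _; rewrite lee_fin normc2_ge0.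
    rewrite -/(sqnorm m setT _) sqnormE// -EFinM lee_fin.
    have p4 : 0 <= (4 : R) ^+ i by rewrite exprn_ge0.
    apply: le_trans (ler_wpM2l p4 (fC i)) _.
    by rewrite -exprMn (_ : 4 / 16 = 4^-1 :> R)//; field.
  by rewrite sumEFin lee_fin sum_geometric4.
pose A := [set x | (e x < +oo)%E].
have mA : measurable A.
  by have := emeasurable_fun_infty_o measurableT me +oo%E; rewrite setTI.
have cA x : A x -> cvgn (fun k => complex.Re (f_ k x)) /\
                   cvgn (fun k => complex.Im (f_ k x)).
  move=> Ax.
  have b k : 4 ^+ k * normc2 (f_ k.+1 x - f_ k x) <= fine (e x).
    rewrite -lee_fin fineK; last by rewrite ge0_fin_numE.
    rewrite -/(g k x).
    apply: le_trans (@nneseries_lim_ge _ (g ^~ x) xpredT 0%N k.+1 _) => //.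
    by rewrite big_nat_recr//= leeDr// sume_ge0.
  have p4 k : 0 <= (4 : R) ^+ k by rewrite exprn_ge0.
  split; apply: (@fast_cauchy_cvg _ (fine (e x))) => k.
    rewrite (le_trans _ (b k))// ler_wpM2l//.
    by rewrite -Re_opp -Re_add sqr_Re_le.
  rewrite (le_trans _ (b k))// ler_wpM2l//.
  by rewrite -Im_opp -Im_add sqr_Im_le.
(* Replaced by 0 off A, the sequence converges at every point, and its limit is measurable. *)
pose h k x := (\1_A x : R)%:C%C * f_ k x.
have mh k : cmeasurable (h k).
  by apply: cmeasurableM; [exact: cmeasurable_indic|case: (fL k)].
have ch x : cvgn (fun k => complex.Re (h k x)) /\ cvgn (fun k => complex.Im (h k x)).
  rewrite /h indicE; have [xA|xA] := boolP (x \in A).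
    rewrite (_ : (true%:R)%:C%C = 1)//; under eq_fun do rewrite mul1r.
    by under [X in _ /\ cvgn X]eq_fun do rewrite mul1r; apply: cA; rewrite -in_setE.
  rewrite (_ : (false%:R)%:C%C = 0)//; under eq_fun do rewrite mul0r.
  by under [X in _ /\ cvgn X]eq_fun do rewrite mul0r; split; exact: is_cvg_cst.
exists (fun x => Complex (limn (fun k => complex.Re (h k x))) (limn (fun k => complex.Im (h k x)))).
split.
  split=> /=.
    apply: (@measurable_fun_cvg _ _ _ _ (fun k x => complex.Re (h k x))) => [k|x _].
      by case: (mh k).
    by case: (ch x).
  apply: (@measurable_fun_cvg _ _ _ _ (fun k x => complex.Im (h k x))) => [k|x _].
    by case: (mh k).
  by case: (ch x).
apply: filterS (integrable_ae measurableT ie) => x /(_ Logic.I) fx.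
have Ax : x \in A by rewrite in_setE /A /= -ge0_fin_numE.
have hE k : f_ k x = h k x by rewrite /h indicE Ax mul1r.
rewrite /cconv /=; under eq_fun do rewrite hE.
by under [X in _ /\ (X @ \oo --> _)]eq_fun do rewrite hE; exact: ch.
Qed.

Lemma square_integrable_complete (f_ : nat -> U -> R[i]) :
  (forall k, L2 (f_ k)) ->
  (forall e, 0 < e -> exists N, forall k l, (N <= k)%N -> (N <= l)%N ->
     nrm2 m (fun x => f_ k x - f_ l x) <= e) ->
  exists f, L2 f /\ forall e, 0 < e -> exists N, forall k, (N <= k)%N ->
     nrm2 m (fun x => f_ k x - f x) <= e.
Proof.
move=> fL fC.
have /choice[N NP] (k : nat) : exists N, forall p l, (N <= p)%N -> (N <= l)%N ->
    nrm2 m (fun x => f_ p x - f_ l x) <= 16^-1 ^+ k.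
  by apply: fC; rewrite exprn_gt0.
(* Summing the moduli gives indices that dominate [N k] and are also nondecreasing. *)
pose s (k : nat) := (\sum_(i < k.+1) N i)%N.
have sN k : (N k <= s k)%N by rewrite /s big_ord_recr/= leq_addl.
have sS k : (s k <= s k.+1)%N by rewrite {2}/s big_ord_recr/= leq_addr.
have [|k|f [mf ff]] := @square_integrable_complete_fast (fun k => f_ (s k)).
- by move=> k; exact: fL.
- by apply: NP => //; exact: leq_trans (sN k) (sS k).
have shom : {homo s : i j / (i <= j)%N}.
  by apply: homo_leq => //; exact: leq_trans.
(* Fatou along the subsequence transfers the Cauchy bound to the limit. *)
have key (k l : nat) : (N k <= l)%N ->
    L2 (fun x => f_ l x - f x) /\ nrm2 m (fun x => f_ l x - f x) <= 16^-1 ^+ k.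
  move=> kl; apply: (@nrm2_fatou (fun j x => f_ l x - f_ (s (k + j)%N) x)).
  - by move=> j; exact: sqintB.
  - by apply: cmeasurableB => //; case: (fL l).
  - apply: filterS ff => x fx; apply: cconvB; first exact: cconv_cst.
    by case: fx => f1 f2; split;
      [rewrite -(cvg_shiftn k) in f1|rewrite -(cvg_shiftn k) in f2];
      under eq_fun do rewrite addnC.
  - by move=> j; apply: NP => //; rewrite (leq_trans (sN k))// shom// leq_addr.
have Lf : L2 f.
  have [h _] := key 0%N (N 0%N) (leqnn _).
  have := sqintB (fL (N 0%N)) h.
  by under eq_fun do rewrite opprB addrC subrK.
exists f; split=> // e e0.
have [k ke] : exists k : nat, (16^-1 : R) ^+ k <= e.
  have : (fun k => (16^-1 : R) ^+ k) @ \oo --> (0 : R).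
    by apply: cvg_expr; rewrite ger0_norm// invf_lt1// ltr1n.
  move=> /cvgr0_norm_le/(_ _ e0)[k _ /(_ k (leqnn k))] h.
  by exists k; apply: le_trans h; exact: ler_norm.
by exists (N k) => l /key[_] /le_trans; exact.
Qed.

End Completeness.

(** * Integrals against processes with orthogonal increments *)

Section Steps.
Context (R : realType) (d : measure_display) (U : measurableType d).
Variable m : {measure set U -> \bar R}.
Local Notation mu := (@lebesgue_measure R).
Implicit Types (S : seq (R * R * R[i])) (eta : R -> U -> R[i]) (g : R -> R[i])
  (X : U -> R[i]).

Definition stepfun S (x : R) : R[i] :=
  \sum_(p <- S) p.2 * (\1_(`]p.1.1, p.1.2]%classic) x : R)%:C%C.

Definition stepint (V : Type) (eta : R -> V -> R[i]) S (w : V) : R[i] :=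
  \sum_(p <- S) p.2 * (eta p.1.2 w - eta p.1.1 w).

Definition ordered S := forall p, p \in S -> p.1.1 <= p.1.2.

Definition scale_step (c : R[i]) S := [seq (p.1, c * p.2) | p <- S].

Lemma ordered_cat S S' : ordered S -> ordered S' -> ordered (S ++ S').
Proof. by move=> h h' p; rewrite mem_cat => /orP[/h|/h']. Qed.

Lemma ordered_scale c S : ordered S -> ordered (scale_step c S).
Proof. by move=> h _ /mapP[p /h ps ->]. Qed.

Lemma stepfun_cat S S' x : stepfun (S ++ S') x = stepfun S x + stepfun S' x.
Proof. by rewrite /stepfun big_cat. Qed.

Lemma stepint_cat (V : Type) (eta : R -> V -> R[i]) S S' w :
  stepint eta (S ++ S') w = stepint eta S w + stepint eta S' w.
Proof. by rewrite /stepint big_cat. Qed.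

Lemma stepfun_scale c S x : stepfun (scale_step c S) x = c * stepfun S x.
Proof.
by rewrite /stepfun big_map mulr_sumr; apply: eq_bigr => p _; rewrite mulrA.
Qed.

Lemma stepint_scale (V : Type) (eta : R -> V -> R[i]) c S w :
  stepint eta (scale_step c S) w = c * stepint eta S w.
Proof.
by rewrite /stepint big_map mulr_sumr; apply: eq_bigr => p _; rewrite mulrA.
Qed.

Lemma sqint_indic_itv (s t : R) :
  square_integrable mu (fun x => (\1_(`]s, t]%classic) x : R)%:C%C).
Proof.
split; first exact: cmeasurable_indic.
rewrite /sqnorm; under eq_integral => x _.
  rewrite normc2_real (_ : _ ^+ 2 = \1_(`]s, t]%classic) x); last first.
    by rewrite indicE; case: (_ \in _); rewrite ?expr1n ?expr0n.
  over.
rewrite [X in (X < _)%E](_ : _ = mu `]s, t]%classic); last first.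
  by rewrite (@integral_indic _ _ _ mu setT measurableT _ (measurable_itv _)) setIT.
by rewrite lebesgue_measure_itv/=; case: ifP => _; rewrite ?ltry// -EFinD ltry.
Qed.

Lemma sqint_stepfun S : square_integrable mu (stepfun S).
Proof. by apply: sqint_sum => p; apply: sqintZ; exact: sqint_indic_itv. Qed.

Definition sqint_increments eta :=
  forall s t, square_integrable m (fun w => eta t w - eta s w).

Lemma sqint_stepint eta S : sqint_increments eta ->
  square_integrable m (stepint eta S).
Proof. by move=> h; apply: sqint_sum => p; exact: sqintZ. Qed.

(** The closure of the graph of [stepfun S] against [stepint eta S]. Taken as a relation it needs no
    choice of a limit. For [ray] it says that step functions are dense, for [Eproc] it is the
    Fourier-Plancherel transform, and for an innovation process it is the stochastic integral. *)
Definition ointegral eta g X :=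
  [/\ square_integrable mu g, square_integrable m X &
   forall e, 0 < e -> exists S, [/\ ordered S,
     nrm2 mu (fun x => g x - stepfun S x) <= e &
     nrm2 m (fun w => X w - stepint eta S w) <= e]].

Lemma ointegral_step eta S : sqint_increments eta -> ordered S ->
  ointegral eta (stepfun S) (stepint eta S).
Proof.
move=> h oS; split; [exact: sqint_stepfun|exact: sqint_stepint|move=> e e0].
exists S; split=> //.
  under [X in nrm2 _ X]eq_fun do rewrite subrr.
  by rewrite nrm2_rip rip0l ltW.
under [X in nrm2 _ X]eq_fun do rewrite subrr.
by rewrite nrm2_rip rip0l ltW.
Qed.

Lemma ointegralD eta g X g' X' : sqint_increments eta ->
  ointegral eta g X -> ointegral eta g' X' ->
  ointegral eta (fun x => g x + g' x) (fun w => X w + X' w).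
Proof.
move=> h [gL XL a] [gL' XL' a']; split; [exact: sqintD|exact: sqintD|move=> e e0].
have e4 : 0 < e / 4 by rewrite divr_gt0.
have [S [oS S1 S2]] := a _ e4; have [S' [oS' S1' S2']] := a' _ e4.
exists (S ++ S'); split; first exact: ordered_cat.
  under [X in nrm2 _ X]eq_fun do rewrite stepfun_cat opprD addrACA.
  apply: le_trans (nrm2D_le _ _) _; try by apply: sqintB => //; exact: sqint_stepfun.
  lra.
under [X in nrm2 _ X]eq_fun do rewrite stepint_cat opprD addrACA.
apply: le_trans (nrm2D_le _ _) _; try by apply: sqintB => //; exact: sqint_stepint.
lra.
Qed.

Lemma ointegralZ eta c g X : sqint_increments eta -> ointegral eta g X ->
  ointegral eta (fun x => c * g x) (fun w => c * X w).
Proof.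
move=> h [gL XL a]; split; [exact: sqintZ|exact: sqintZ|move=> e e0].
have c1 : 0 < normc2 c + 1 by rewrite ltr_wpDl// normc2_ge0.
have ec : 0 < e / (normc2 c + 1) by rewrite divr_gt0.
have bnd r : r <= e / (normc2 c + 1) -> normc2 c * r <= e.
  rewrite ler_pdivlMr// => re.
  by have := normc2_ge0 c; have [] := leP 0 r; nra.
have [S [oS S1 S2]] := a _ ec.
exists (scale_step c S); split; first exact: ordered_scale.
  under [X in nrm2 _ X]eq_fun do rewrite stepfun_scale -mulrBr.
  by rewrite nrm2Z ?bnd//; apply: sqintB => //; exact: sqint_stepfun.
under [X in nrm2 _ X]eq_fun do rewrite stepint_scale -mulrBr.
by rewrite nrm2Z ?bnd//; apply: sqintB => //; exact: sqint_stepint.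
Qed.

Lemma ointegralB eta g X g' X' : sqint_increments eta ->
  ointegral eta g X -> ointegral eta g' X' ->
  ointegral eta (fun x => g x - g' x) (fun w => X w - X' w).
Proof.
move=> h a /(ointegralZ (-1) h) b; have := ointegralD h a b.
by under eq_fun do rewrite mulN1r; under [X in ointegral _ _ X]eq_fun do rewrite mulN1r.
Qed.

Lemma ointegral_lim eta g X : sqint_increments eta ->
  square_integrable mu g -> square_integrable m X ->
  (forall e, 0 < e -> exists g' X', [/\ ointegral eta g' X',
     nrm2 mu (fun x => g x - g' x) <= e &
     nrm2 m (fun w => X w - X' w) <= e]) ->
  ointegral eta g X.
Proof.
move=> h gL XL a; split=> // e e0.
have e4 : 0 < e / 4 by rewrite divr_gt0.
have [g' [X' [[gL' XL' b] g1 X1]]] := a _ e4.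
have [S [oS S1 S2]] := b _ e4.
exists S; split=> //.
  apply: le_trans (nrm2_triangle gL gL' (sqint_stepfun S)) _; lra.
apply: le_trans (nrm2_triangle XL XL' (sqint_stepint S h)) _; lra.
Qed.

Lemma ointegral_sum eta (I : eqType) (s : seq I) (G : I -> R -> R[i])
    (Y : I -> U -> R[i]) : sqint_increments eta ->
  (forall i, i \in s -> ointegral eta (G i) (Y i)) ->
  ointegral eta (fun x => \sum_(i <- s) G i x) (fun w => \sum_(i <- s) Y i w).
Proof.
move=> h; elim: s => [_|i s ih a].
  under eq_fun do rewrite big_nil.
  under [X in ointegral _ _ X]eq_fun do rewrite big_nil.
  have := @ointegral_step eta [::] h (fun p => ltac:(done)).
  rewrite /stepfun /stepint; under eq_fun do rewrite big_nil.
  by under [X in ointegral _ _ X]eq_fun do rewrite big_nil.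
under eq_fun do rewrite big_cons.
under [X in ointegral _ _ X]eq_fun do rewrite big_cons.
apply: ointegralD => //; first by apply: a; rewrite inE eqxx.
by apply: ih => j js; apply: a; rewrite inE js orbT.
Qed.

End Steps.

Section OrthogonalProcess.
Context (R : realType) (d : measure_display) (U : measurableType d).
Variable m : {measure set U -> \bar R}.
Implicit Types (S : seq (R * R * R[i])) (eta : R -> U -> R[i]).

(* The last clause makes the complex inner products of increments real, so that they are determined by [kap]. *)
Definition orthogonal_process (kap : R) eta :=
  [/\ sqint_increments m eta,
      forall s t, nrm2 m (fun w => eta t w - eta s w) = kap * `|t - s| &
      forall s t u v, rip m (fun w => 'i%C * (eta t w - eta s w))
                            (fun w => eta v w - eta u w) = 0].

(** The length of the overlap of the two intervals, signed by their orientations, in the form that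
    polarization of |t - s| produces. *)
Definition gram (p q : R * R) : R :=
  (`|p.2 - q.1| + `|p.1 - q.2| - `|p.2 - q.2| - `|p.1 - q.1|) / 2.

(** Polarization: increments from a common origin have inner products determined by three variances,
    and any increment is a difference of two of them. *)
Lemma rip_increments kap eta s t u v : orthogonal_process kap eta ->
  rip m (fun w => eta t w - eta s w) (fun w => eta v w - eta u w) =
  kap * gram (s, t) (u, v).
Proof.
move=> [L O1 _].
have base x y : rip m (fun w => eta x w - eta s w) (fun w => eta y w - eta s w)
    = kap * (`|x - s| + `|y - s| - `|x - y|) / 2.
  have := nrm2B (L s x) (L s y).
  under [X in nrm2 _ X]eq_fun do rewrite opprB addrA subrK.
  by rewrite !O1; lra.
have -> : (fun w => eta v w - eta u w) =
    fun w => (eta v w - eta s w) - (eta u w - eta s w).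
  by apply/funext => w; rewrite opprB addrA subrK.
rewrite ripC ripBl//; try exact: L.
rewrite ripC base ripC base /gram /= (distrC s v) (distrC s u); lra.
Qed.

Lemma rip_scaled_increments kap eta (p q : R * R) (c c' : R[i]) :
  orthogonal_process kap eta ->
  rip m (fun w => c * (eta p.2 w - eta p.1 w)) (fun w => c' * (eta q.2 w - eta q.1 w))
  = rdot c c' * (kap * gram p q).
Proof.
move=> [L O1 O2].
rewrite ripC ripMl ripC.
under [X in rip _ X _]eq_fun do rewrite mulrA.
rewrite ripZl//; try exact: L.
have O : orthogonal_process kap eta by split.
rewrite O2 mulr0 addr0 (rip_increments _ _ _ _ O) -!surjective_pairing.
by rewrite /rdot !ReImE; ring.
Qed.

(** The right-hand side depends on [eta] only through [kap]. Step integrals against two such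
    processes therefore have proportional inner products, which is the source of every isometry
    below. *)
Lemma rip_stepint kap eta S S' : orthogonal_process kap eta ->
  rip m (stepint eta S) (stepint eta S') =
  kap * \sum_(p <- S) \sum_(q <- S') rdot p.2 q.2 * gram p.1 q.1.
Proof.
move=> O; have [L _ _] := O.
have LZ (p : R * R * R[i]) :
  square_integrable m (fun w => p.2 * (eta p.1.2 w - eta p.1.1 w)).
  exact: sqintZ.
rewrite rip_suml//; last exact: sqint_stepint.
rewrite mulr_sumr; apply: eq_bigr => p _.
rewrite ripC rip_suml// mulr_sumr; apply: eq_bigr => q _.
by rewrite ripC (@rip_scaled_increments kap)//; ring.
Qed.

End OrthogonalProcess.

Section Ray.
Variable R : realType.
Local Notation mu := (@lebesgue_measure R).

(** The model process with constant 1, to which all others are compared: the signs are such that its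
    step integrals are the step functions themselves. *)
Definition ray (t x : R) : R[i] :=
  ((\1_(`]0, t]%classic) x : R) - \1_(`]t, 0]%classic) x)%:C%C.

Lemma rayB s t x : s <= t -> ray t x - ray s x = (\1_(`]s, t]%classic) x : R)%:C%C.
Proof.
move=> st; rewrite /ray -rmorphB; congr (_%:C)%C.
rewrite !indicE !mem_setE !in_itv/=.
by case: (ltP 0 x) => h1; case: (leP x t) => h2; case: (ltP s x) => h3;
  case: (leP x 0) => h4; rewrite /=; lra.
Qed.

Lemma nrm2_indic_itv (s t : R) : s <= t ->
  nrm2 mu (fun x => (\1_(`]s, t]%classic) x : R)%:C%C) = t - s.
Proof.
move=> st; rewrite /nrm2 /sqnorm; under eq_integral => x _.
  rewrite normc2_real (_ : _ ^+ 2 = \1_(`]s, t]%classic) x); last first.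
    by rewrite indicE; case: (_ \in _); rewrite ?expr1n ?expr0n.
  over.
rewrite [X in fine X = _](_ : _ = mu `]s, t]%classic); last first.
  by rewrite (@integral_indic _ _ _ mu setT measurableT _ (measurable_itv _)) setIT.
rewrite lebesgue_measure_itv/= lte_fin; case: ifPn => //=.
by rewrite -leNgt => ts; apply/eqP; rewrite eq_sym subr_eq0 eq_le st ts.
Qed.

Lemma orthogonal_process_ray : orthogonal_process mu 1 ray.
Proof.
have L s t : square_integrable mu (fun w => ray t w - ray s w).
  have [st|ts] := leP s t.
    by under eq_fun do rewrite rayB//; exact: sqint_indic_itv.
  under eq_fun do rewrite -opprB rayB ?(ltW ts)//.
  by apply: sqintN; exact: sqint_indic_itv.
have N s t : s <= t -> nrm2 mu (fun w => ray t w - ray s w) = t - s.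
  by move=> st; under [X in nrm2 _ X]eq_fun do rewrite rayB//; exact: nrm2_indic_itv.
split=> // [s t|s t u v].
  have [st|ts] := leP s t; first by rewrite N// mul1r ger0_norm// subr_ge0.
  by rewrite nrm2BC N ?(ltW ts)// mul1r distrC ger0_norm// subr_ge0 ltW.
rewrite /rip (_ : (fun x => _) = cst 0) ?Rintegral_cst// ?mul0r//.
by apply/funext => x; rewrite /rdot /ray !ReImE /=; ring.
Qed.

Lemma stepint_ray S : ordered S -> stepint ray S = stepfun S.
Proof.
move=> oS; apply/funext => x; rewrite /stepint /stepfun.
by apply: eq_big_seq => p /oS ps; rewrite rayB.
Qed.

Lemma rip_stepfun S S' : ordered S -> ordered S' ->
  rip mu (stepfun S) (stepfun S') =
  \sum_(p <- S) \sum_(q <- S') rdot p.2 q.2 * gram p.1 q.1.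
Proof.
move=> oS oS'; rewrite -!stepint_ray// (rip_stepint _ _ orthogonal_process_ray).
by rewrite mul1r.
Qed.

Lemma ordered_nil : ordered ([::] : seq (R * R * R[i])).
Proof. by []. Qed.

End Ray.

Section StochasticIsometry.
Context (R : realType) (d : measure_display) (U : measurableType d).
Variable m : {measure set U -> \bar R}.
Local Notation mu := (@lebesgue_measure R).
Variables (kap : R) (eta : R -> U -> R[i]).
Hypothesis O : orthogonal_process m kap eta.
Let L : sqint_increments m eta. Proof. by case: O. Qed.

Lemma nrm2_stepint S : ordered S ->
  nrm2 m (stepint eta S) = kap * nrm2 mu (stepfun S).
Proof. by move=> oS; rewrite !nrm2_rip (rip_stepint _ _ O) rip_stepfun. Qed.

Lemma kap_ge0 : 0 <= kap.
Proof.
case: O => _ /(_ 0 1) O1 _; have := nrm2_ge0 m (fun w => eta 1 w - eta 0 w).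
by rewrite O1 subr0 normr1 mulr1.
Qed.

End StochasticIsometry.

Lemma nrm2_continuous (R : realType) d (U : measurableType d)
    (m : {measure set U -> \bar R}) (f : U -> R[i]) (D : R) :
  square_integrable m f -> 0 < D ->
  exists2 e, 0 < e & forall h, square_integrable m h ->
    nrm2 m (fun x => f x - h x) <= e -> `|nrm2 m f - nrm2 m h| <= D.
Proof.
move=> fL D0; pose K := nrm2 m f + 1.
have K0 : 0 < K by rewrite ltr_wpDl// nrm2_ge0.
have e1 : 0 < D ^+ 2 / (16 * K) by rewrite divr_gt0 ?exprn_gt0// mulr_gt0.
(* The first bound controls the norm of v = f - h by D/2; the second makes K times it at most
   (D/4)^2, so that twice the inner product of f and v is at most D/2 by Cauchy-Schwarz. *)
exists (Num.min (D / 2) (D ^+ 2 / (16 * K))).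
  by rewrite lt_min e1 divr_gt0.
move=> h hL; rewrite le_min => /andP[fh1 fh2].
pose v x := f x - h x; have vL : square_integrable m v by exact: sqintB.
have E : nrm2 m h = nrm2 m f - 2 * rip m f v + nrm2 m v.
  rewrite -nrm2B//; congr nrm2; apply/funext => x.
  by rewrite /v opprB addrC subrK.
have B : `|rip m f v| <= D / 4.
  rewrite -(@ler_pXn2r _ 2)// ?nnegrE ?divr_ge0 ?(ltW D0)//.
  rewrite -normrX ger0_norm ?sqr_ge0//.
  apply: le_trans (cauchy_schwarz fL vL) _.
  have fK : nrm2 m f <= K by rewrite /K; lra.
  apply: (@le_trans _ _ (K * (D ^+ 2 / (16 * K)))).
    by apply: ler_pM => //; exact: nrm2_ge0.
  by rewrite le_eqVlt; apply/orP; left; apply/eqP; field; rewrite gt_eqF.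
have v0 := nrm2_ge0 m v; rewrite E -/v in fh1 *.
move: B; rewrite !ler_norml => /andP[b1 b2]; apply/andP; split; lra.
Qed.

Section StochasticIsometry2.
Context (R : realType) (d : measure_display) (U : measurableType d).
Variable m : {measure set U -> \bar R}.
Local Notation mu := (@lebesgue_measure R).
Variables (kap : R) (eta : R -> U -> R[i]).
Hypothesis O : orthogonal_process m kap eta.
Let L : sqint_increments m eta. Proof. by case: O. Qed.

Lemma nrm2_ointegral g X : ointegral m eta g X -> nrm2 m X = kap * nrm2 mu g.
Proof.
move=> [gL XL a]; apply/eqP; rewrite -subr_eq0 -normr_le0.
apply/ler_addgt0Pr => D D0; rewrite add0r.
have k0 := kap_ge0 O.
have k1 : 0 < 2 * (kap + 1) by rewrite mulr_gt0// ltr_wpDl.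
have D2 : 0 < D / 2 by rewrite divr_gt0.
have Dk : 0 < D / (2 * (kap + 1)) by rewrite divr_gt0.
have [e1 e10 h1] := nrm2_continuous XL D2.
have [e2 e20 h2] := nrm2_continuous gL Dk.
have e0 : 0 < Num.min e1 e2 by rewrite lt_min e10.
have [S [oS]] := a _ e0; rewrite !le_min => /andP[_ S1] /andP[S2 _].
have {}h1 := h1 _ (sqint_stepint S L) S2.
have {}h2 := h2 _ (sqint_stepfun S) S1.
have E : nrm2 m X - kap * nrm2 mu g = (nrm2 m X - nrm2 m (stepint eta S))
   - kap * (nrm2 mu g - nrm2 mu (stepfun S)).
  by rewrite (nrm2_stepint O oS); ring.
rewrite E; apply: le_trans (ler_normB _ _) _; rewrite normrM (ger0_norm k0).
have : kap * `|nrm2 mu g - nrm2 mu (stepfun S)| <= D / 2.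
  apply: le_trans (ler_wpM2l k0 h2) _.
  rewrite mulrA ler_pdivrMr// -subr_ge0.
  rewrite (_ : _ - _ = D) ?ltW//; by field.
lra.
Qed.

Lemma rip_ointegral g X g' X' : ointegral m eta g X -> ointegral m eta g' X' ->
  rip m X X' = kap * rip mu g g'.
Proof.
move=> a a'; have := nrm2_ointegral (ointegralD L a a').
have [gL XL _] := a; have [gL' XL' _] := a'.
by rewrite !nrm2D// (nrm2_ointegral a) (nrm2_ointegral a'); lra.
Qed.

Lemma ointegral_unique g X X' : ointegral m eta g X -> ointegral m eta g X' ->
  {ae m, forall w, X w = X' w}.
Proof.
move=> a a'; have b := ointegralB L a a'; have := nrm2_ointegral b.
under [X in _ = kap * nrm2 mu X]eq_fun do rewrite subrr.
rewrite [X in _ * X]nrm2_rip rip0l mulr0 => /nrm2_eq0; have [_ bL _] := b.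
by move=> /(_ bL); apply: filterS => w /eqP; rewrite subr_eq0 => /eqP.
Qed.

End StochasticIsometry2.

(** * Density of step functions in L_2(R) *)

Section Density.
Variable R : realType.
Local Notation mu := (@lebesgue_measure R).
Local Notation approx g := (ointegral mu (@ray R) g g).
Let L : sqint_increments mu (@ray R).
Proof. by case: (orthogonal_process_ray R). Qed.

Lemma nrm2_dominated d (U : measurableType d) (m : {measure set U -> \bar R})
    (f_ : nat -> U -> R[i]) (f h : U -> R[i]) :
  (forall k, cmeasurable (f_ k)) -> cmeasurable f -> square_integrable m h ->
  (forall x, cconv (f_ ^~ x) (f x)) ->
  (forall k x, normc2 (f x - f_ k x) <= normc2 (h x)) ->
  forall e, 0 < e -> exists N, forall k, (N <= k)%N ->
    square_integrable m (fun x => f x - f_ k x) /\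
    nrm2 m (fun x => f x - f_ k x) <= e.
Proof.
move=> mf_ mf hL ff b e e0.
have Lk k : square_integrable m (fun x => f x - f_ k x).
  split; first exact: cmeasurableB.
  apply: le_lt_trans (proj2 hL); apply: le_sqnorm => //.
    exact: cmeasurableB.
  by apply: measurable_normc2; case: hL.
have mk k : measurable_fun setT (fun x => (normc2 (f x - f_ k x))%:E).
  by apply/measurable_EFinP; apply: measurable_normc2; exact: cmeasurableB.
have := @dominated_convergence _ _ _ m setT measurableT
  (fun k x => (normc2 (f x - f_ k x))%:E) (cst 0%E) (fun x => (normc2 (h x))%:E)
  mk (measurable_cst _).
case.
- apply: aeW => x _ /=; apply: cvg_EFin; first exact: nearW.
  have := cconv_normc2 (cconvB (cconv_cst (f x)) (ff x)).
  by rewrite subrr normc2_0.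
- exact: integrable_normc2.
- by apply: aeW => x k _ /=; rewrite ger0_norm ?normc2_ge0// lee_fin.
move=> _ _; rewrite integral0 => c.
have : (fun k => nrm2 m (fun x => f x - f_ k x)) @ \oo --> (0 : R).
  exact: (fine_cvg c).
move=> /cvgr0_norm_le/(_ _ e0)[N _ hN]; exists N => k /hN h1; split=> //.
exact: le_trans (ler_norm _) h1.
Qed.

Lemma approx_itv (s t : R) : approx (fun x => (\1_(`]s, t]%classic) x : R)%:C%C).
Proof.
have [st|ts] := leP s t.
  have oS : ordered [:: (s, t, 1 : R[i])] by move=> p; rewrite inE => /eqP ->.
  have := ointegral_step L oS; rewrite stepint_ray//.
  rewrite (_ : stepfun _ = fun x => (\1_(`]s, t]%classic) x : R)%:C%C)//.
  by apply/funext => x; rewrite /stepfun big_seq1 mul1r.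
have := ointegral_step L (@ordered_nil R); rewrite stepint_ray//.
rewrite (_ : stepfun _ = fun x => (\1_(`]s, t]%classic) x : R)%:C%C)//.
apply/funext => x; rewrite /stepfun big_nil set_itv_ge ?bnd_simp -?leNgt ?ltW//.
by rewrite indic0.
Qed.

(** A lambda-system argument starting from the open rays, which are stable under intersection. The
    cut to a bounded interval keeps every indicator square integrable, so that complements and
    increasing unions stay in L_2. *)
Lemma approx_indic (K : R) (A : set R) : measurable A ->
  approx (fun x => (\1_(A `&` `]- K, K]%classic) x : R)%:C%C).
Proof.
pose H : set (set R) := [set A | measurable A /\
  approx (fun x => (\1_(A `&` `]- K, K]%classic) x : R)%:C%C)].
suff : @measurable _ R `<=` H by move=> h /h[].
rewrite [X in X `<=` _]RGenOInfty.measurableE.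
apply: lambda_system_subset => //.
- move=> _ _ [x ->] [y ->]; exists (Num.max x y).
  by apply/seteqP; split=> z /=; rewrite !in_itv/= !andbT gt_max => /andP.
- split=> //.
  + by split=> //; rewrite setTI; exact: approx_itv.
  + move=> {}A B BA [mA hA] [mB hB]; split; first exact: measurableD.
    have := ointegralB L hA hB.
    rewrite (_ : (fun x => _ - _) =
      fun x => (\1_((A `\` B) `&` `]- K, K]%classic) x : R)%:C%C)//.
    apply/funext => x; rewrite -rmorphB; congr (_%:C)%C.
    rewrite setDE !indicE !in_setI in_setC.
    have : x \in B -> x \in A by rewrite !in_setE; exact: BA.
    by case: (x \in A); case: (x \in B); case: (x \in _);
      rewrite /= ?subr0 ?subrr// => /(_ isT).
  + move=> F ndF hF; split; first by apply: bigcup_measurable => k _; case: (hF k).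
    have mF k : measurable (F k `&` `]- K, K]%classic).
      by apply: measurableI; [case: (hF k)|exact: measurable_itv].
    have mU : measurable (\bigcup_k F k `&` `]- K, K]%classic).
      apply: measurableI; last exact: measurable_itv.
      by apply: bigcup_measurable => k _; case: (hF k).
    have b (x : R) (k : nat) : normc2 ((\1_(\bigcup_k F k `&` `]- K, K]%classic) x : R)%:C%C -
        (\1_(F k `&` `]- K, K]%classic) x : R)%:C%C) <=
        normc2 (\1_(`]- K, K]%classic) x : R)%:C%C.
      rewrite -rmorphB !normc2_real !indicE !in_setI.
      have sub : x \in F k -> x \in \bigcup_k F k.
        by rewrite !in_setE => Fx; exists k.
      by case: (x \in F k) sub; case: (x \in \bigcup_k _); case: (x \in _);
        rewrite /= ?subr0 ?subrr// => h; try (by have := h isT);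
        rewrite ?expr0n ?expr1n.
    have LU : square_integrable mu (fun x => (\1_(\bigcup_k F k `&` `]- K, K]%classic) x : R)%:C%C).
      split; first exact: cmeasurable_indic.
      apply: le_lt_trans (proj2 (sqint_indic_itv (- K) K)); apply: le_sqnorm.
      - exact: cmeasurable_indic.
      - by apply: measurable_normc2; exact: cmeasurable_indic.
      - move=> x; rewrite !normc2_real !indicE in_setI.
        by case: (x \in \bigcup_k _); case: (x \in _); rewrite /= ?expr0n ?expr1n.
    have cF x : cconv (fun k => (\1_(F k `&` `]- K, K]%classic) x : R)%:C%C)
        (\1_(\bigcup_k F k `&` `]- K, K]%classic) x : R)%:C%C.
      split; last exact: cvg_cst.
      apply: cvg_near_cst; rewrite /=.
      have [[k0 _ Fk0]|nF] := pselect ((\bigcup_k F k) x).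
        exists k0 => // k /= k0k; congr (_%:R); rewrite !in_setI; congr (_ && _).
        have Fk : F k x by have /subsetPset := ndF _ _ k0k; apply.
        by rewrite !mem_set//; exists k0.
      apply: nearW => k; congr (_%:R); rewrite !in_setI; congr (_ && _).
      rewrite !memNset// => Fk; apply: nF; by exists k.
    apply: ointegral_lim => // e e0.
    have [N hN] := @nrm2_dominated _ _ mu
      (fun k x => (\1_(F k `&` `]- K, K]%classic) x : R)%:C%C)
      (fun x => (\1_(\bigcup_k F k `&` `]- K, K]%classic) x : R)%:C%C)
      (fun x => (\1_(`]- K, K]%classic) x : R)%:C%C)
      (fun k => cmeasurable_indic R (mF k)) (cmeasurable_indic R mU)
      (sqint_indic_itv (- K) K) cF (fun k x => b x k) e e0.
    have [_ hN2] := hN N (leqnn N).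
    by exists (fun x => (\1_(F N `&` `]- K, K]%classic) x : R)%:C%C),
      (fun x => (\1_(F N `&` `]- K, K]%classic) x : R)%:C%C); split=> //; case: (hF N).
- move=> _ [x ->]; split; first exact: measurable_itv.
  rewrite (_ : `]x, +oo[%classic `&` `]- K, K]%classic = `]Num.max x (- K), K]%classic).
    exact: approx_itv.
  apply/seteqP; split=> z /=; rewrite !in_itv/= ?andbT gt_max.
    by move=> [-> /andP[-> ->]].
  by move=> /andP[/andP[-> ->] ->].
Qed.

Import HBNNSimple.

(** Simple functions below f, cut to ]-k, k] so that each level set has finite measure, converge to
    f under the dominating function f itself. *)
Lemma approx_nonneg (f : R -> R) : measurable_fun setT f -> (forall x, 0 <= f x) ->
  square_integrable mu (fun x => (f x)%:C%C) -> approx (fun x => (f x)%:C%C).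
Proof.
move=> mf f0 fL.
have mfE : measurable_fun setT (EFin \o f) by exact/measurable_EFinP.
pose s (k : nat) : R -> R := nnsfun_approx measurableT mfE k.
have sc x : (s ^~ x) @ \oo --> f x.
  have c : (EFin \o s ^~ x) @ \oo --> (f x)%:E.
    by apply: cvg_nnsfun_approx => // y _; rewrite lee_fin.
  by move/fine_cvg : c.
have sle k x : s k x <= f x.
  rewrite -(cvg_lim _ (sc x))//; apply: nondecreasing_cvgn_le.
    by move=> i j ij; exact/lefP/nd_nnsfun_approx.
  by apply/cvg_ex; exists (f x).
have mI (k : nat) : measurable `]- (k%:R : R), k%:R]%classic by exact: measurable_itv.
pose h k x : R[i] := (s k x * \1_(`]- k%:R, k%:R]%classic) x)%:C%C.
have mh k : cmeasurable (h k).
  by apply: cmeasurable_real; apply: measurable_funM.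
have hA k : approx (h k).
  pose r : seq R := finmap.enum_fset (fset_set (range (s k))).
  rewrite (_ : h k = fun x => \sum_(y <- r) y%:C%C *
     (\1_((s k @^-1` [set y]) `&` `]- k%:R, k%:R]%classic) x : R)%:C%C).
    apply: ointegral_sum => // y _; apply: ointegralZ => //.
    by apply: approx_indic; exact: measurable_sfunP.
  apply/funext => x; rewrite /h /s fimfunE fsbig_finite//= mulr_suml rmorph_sum/=.
  apply: eq_bigr => y _; rewrite -rmorphM; congr (_%:C)%C.
  by rewrite -mulrA; congr (_ * _); rewrite indicI.
apply: ointegral_lim => // e e0.
have [|k x|N hN] := @nrm2_dominated _ _ mu h (fun x => (f x)%:C%C) (fun x => (f x)%:C%C)
   mh (proj1 fL) fL _ _ e e0.
- move=> x; split; last exact: cvg_cst.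
  rewrite /h /=.
  rewrite -[X in _ --> X]mulr1; apply: cvgM => //.
  apply: cvg_near_cst.
  exists (Num.Def.archi_bound `|x|).+1 => // k /= xk.
  have xk' : `|x| < k%:R.
    by apply: lt_le_trans (archi_boundP (normr_ge0 x)) _; rewrite ler_nat ltnW.
  rewrite indicE mem_set// /= in_itv/=.
  by move: xk'; rewrite ltr_norml => /andP[-> /ltW].
- rewrite /h -rmorphB !normc2_real.
  rewrite ler_pXn2r ?nnegrE//.
    by rewrite lerBlDr lerDl mulr_ge0 ?fun_ge0// indicE.
  rewrite subr_ge0 indicE; case: (_ \in _); rewrite ?mulr1// mulr0//.
have [_ h2] := hN N (leqnn N).
by exists (h N), (h N).
Qed.

Lemma step_dense (g : R -> R[i]) : square_integrable mu g -> approx g.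
Proof.
move=> gL.
have real (f : R -> R) : measurable_fun setT f ->
    (forall x, f x ^+ 2 <= normc2 (g x)) -> approx (fun x => (f x)%:C%C).
  move=> mf fg.
  have part (p : R -> R) : measurable_fun setT p -> (forall x, 0 <= p x) ->
      (forall x, p x <= `|f x|) -> approx (fun x => (p x)%:C%C).
    move=> mp p0 pf; apply: approx_nonneg => //; split.
      exact: cmeasurable_real.
    apply: le_lt_trans (proj2 gL); apply: le_sqnorm.
    - exact: cmeasurable_real.
    - by apply: measurable_normc2; case: gL.
    - move=> x; rewrite normc2_real (le_trans _ (fg x))// -[leRHS]ger0_norm ?sqr_ge0//.
      by rewrite normrX ler_pXn2r ?nnegrE.
  have a1 := part (fun x => Num.max (f x) 0).
  have a2 := part (fun x => Num.max (- f x) 0).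
  have := ointegralB L (a1 _ _ _) (a2 _ _ _).
  rewrite (_ : (fun x => _ - _) = fun x => (f x)%:C%C); last first.
    apply/funext => x; rewrite -rmorphB; congr (_%:C)%C.
    by case: (leP (f x) 0) => h; case: (leP (- f x) 0) => h'; lra.
  apply.
  - by apply: measurable_maxr => //; exact: measurable_cst.
  - by move=> x; rewrite le_max lexx orbT.
  - by move=> x; rewrite ge_max ler_norm normr_ge0.
  - apply: measurable_maxr; last exact: measurable_cst.
    exact: measurableT_comp.
  - by move=> x; rewrite le_max lexx orbT.
  - by move=> x; rewrite ge_max normr_ge0 -normrN ler_norm.
have a1 := real (fun x => complex.Re (g x)) (proj1 (proj1 gL)) (fun x => sqr_Re_le _).
have a2 := real (fun x => complex.Im (g x)) (proj2 (proj1 gL)) (fun x => sqr_Im_le _).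
have := ointegralD L a1 (ointegralZ 'i%C L a2).
rewrite (_ : (fun x => _ + _) = g)//.
by apply/funext => x; apply: eq_ReIm; rewrite !ReImE /=; ring.
Qed.

End Density.

(** * The process with spectral representation (1 - exp(-i l t)) / (i l) *)

Section Invariance.
Variable R : realType.
Local Notation mu := (@lebesgue_measure R).

Definition preserving (phi : R -> R) :=
  measurable_fun setT phi /\
  forall A, measurable A -> mu (phi @^-1` A) = mu A.

(** The pushforward of Lebesgue measure agrees with it on half-open intervals, which determine the
    measure. *)
Lemma preserving_itv (phi : R -> R) :
  measurable_fun setT phi ->
  (forall a b, mu (phi @^-1` `]a, b]%classic) = mu `]a, b]%classic) -> preserving phi.
Proof.
move=> mphi H; split=> // A mA; apply/esym.
pose M : {measure set (measurableTypeR R) -> \bar R} :=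
  measure_function_pushforward__canonical__measure_function_Measure
    (T1 := measurableTypeR R) (T2 := measurableTypeR R) mu mphi.
have h X : ocitv X -> mu X = M X by move=> [[a b] _ <-]; exact/esym/H.
exact: (@lebesgue_measure_unique R M h A mA).
Qed.

Lemma preserving_shift (s : R) : preserving (fun x => x + s).
Proof.
apply: preserving_itv; first exact: measurable_funD.
move=> a b; rewrite (_ : _ @^-1` _ = `]a - s, b - s]%classic).
  rewrite !lebesgue_measure_itv/= !lte_fin ltrD2r -!EFinB.
  by case: ifP => // _; congr (_%:E); ring.
by apply/seteqP; split=> x /=; rewrite !in_itv/= ltrBlDr lerBrDr.
Qed.

Lemma preserving_opp : preserving (fun x => - x).
Proof.
apply: preserving_itv; first exact: measurableT_comp.
move=> a b; rewrite (_ : _ @^-1` _ = `[- b, - a[%classic).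
  rewrite !lebesgue_measure_itv/= !lte_fin ltrN2 -!EFinB.
  by case: ifP => // _; congr (_%:E); ring.
by apply/seteqP; split=> x /=; rewrite !in_itv/= lerNl ltrNr andbC.
Qed.

Lemma ge0_integral_preserving (phi : R -> R) (f : R -> \bar R) : preserving phi ->
  measurable_fun setT f -> (forall x, (0 <= f x)%E) ->
  (\int[mu]_x f (phi x) = \int[mu]_x f x)%E.
Proof.
move=> [mphi H] mf f0.
have := @ge0_integral_pushforward _ _ (measurableTypeR R) (measurableTypeR R) R phi mphi mu setT f measurableT mf (fun x _ => f0 x).
rewrite preimage_setT => <-.
by apply: eq_measure_integral => A mA _; exact: H.
Qed.

Lemma cmeasurable_preserving (phi : R -> R) (f : R -> R[i]) : preserving phi ->
  cmeasurable f -> cmeasurable (fun x => f (phi x)).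
Proof. by move=> [mphi _] [f1 f2]; split; [apply: (measurableT_comp f1)|apply: (measurableT_comp f2)]. Qed.

Lemma sqnorm_preserving (phi : R -> R) (f : R -> R[i]) : preserving phi ->
  cmeasurable f -> sqnorm mu setT (fun x => f (phi x)) = sqnorm mu setT f.
Proof.
move=> p mf; apply: (ge0_integral_preserving (f := fun x => (normc2 (f x))%:E)) => //.
- by apply/measurable_EFinP; exact: measurable_normc2.
- by move=> x; rewrite lee_fin normc2_ge0.
Qed.

Lemma nrm2_preserving (phi : R -> R) (f : R -> R[i]) : preserving phi ->
  cmeasurable f -> nrm2 mu (fun x => f (phi x)) = nrm2 mu f.
Proof. by move=> p mf; rewrite /nrm2 sqnorm_preserving. Qed.

Lemma sqint_preserving (phi : R -> R) (f : R -> R[i]) : preserving phi ->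
  square_integrable mu f -> square_integrable mu (fun x => f (phi x)).
Proof.
move=> p [mf f2]; split; first exact: (cmeasurable_preserving p mf).
by rewrite sqnorm_preserving.
Qed.

Lemma rip_preserving (phi : R -> R) (f g : R -> R[i]) : preserving phi ->
  square_integrable mu f -> square_integrable mu g ->
  rip mu (fun x => f (phi x)) (fun x => g (phi x)) = rip mu f g.
Proof.
move=> p fL gL.
have h1 := nrm2D fL gL.
have h2 := nrm2D (sqint_preserving p fL) (sqint_preserving p gL).
have mf := proj1 fL; have mg := proj1 gL.
rewrite !nrm2_preserving// in h2.
rewrite (@nrm2_preserving phi (fun x => f x + g x)) in h2; [|exact: p|exact: cmeasurableD].
lra.
Qed.

End Invariance.

(** * The integral of (1 - cos(h l)) / l^2 *)

Section FejerIntegral.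
Variable R : realType.
Local Notation mu := (@lebesgue_measure R).
Implicit Types u h l x : R.

Lemma cvgy0_bound (F : R -> R) (K : R) :
  (forall x, 0 < x -> `|F x| <= K / x) -> F x @[x --> +oo] --> (0 : R).
Proof.
move=> FK; apply/cvgr0Pnorm_le => e e0; near=> x.
have x0 : 0 < x by near: x; exact: nbhs_pinfty_gt.
have xK : K / e < x by near: x; apply: nbhs_pinfty_gt; exact: num_real.
apply: (le_trans (FK _ x0)); rewrite ler_pdivrMr// mulrC.
by move: xK; rewrite ltr_pdivrMr// => /ltW.
Unshelve. all: by end_near. Qed.

Lemma expRN_bound x : 0 < x -> expR (- x) <= x^-1.
Proof.
move=> x0; rewrite expRN lef_pV2 ?posrE ?expR_gt0//.
by apply: le_trans (expR_ge1Dx _); lra.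
Qed.

(** The square of [expRN_bound] at x/2. *)
Lemma expRN_bound2 x : 0 < x -> expR (- x) <= 4 / x ^+ 2.
Proof.
move=> x0; have x2 : 0 < x / 2 by rewrite divr_gt0.
have := expRN_bound x2; rewrite -(@ler_pXn2r _ 2)// ?nnegrE ?expR_ge0 ?invr_ge0 ?(ltW x2)//.
rewrite -expRM_natl mulrN (_ : 2%:R * (x / 2) = x); last by field.
by rewrite (_ : (x / 2)^-1 ^+ 2 = 4 / x ^+ 2)//; field; rewrite gt_eqF.
Qed.

Lemma FTC2y_derive (f F : R -> R) (a l : R) :
  (forall x, a <= x -> 0 <= f x) -> continuous f ->
  (forall x, is_derive x 1 F (f x)) -> F x @[x --> +oo] --> l ->
  (\int[mu]_(x in `[a, +oo[) (f x)%:E = (l - F a)%:E)%E.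
Proof.
move=> f0 cf dF Fl; rewrite (@ge0_continuous_FTC2y _ _ F a l) ?EFinB//.
- exact: continuous_subspaceT.
- apply: cvg_at_right_filter; apply: differentiable_continuous.
  by apply/derivable1_diffP; exact: ex_derive.
- by move=> u _; rewrite derive1E derive_val.
Qed.

Lemma is_derive_continuous (F f : R -> R) :
  (forall x, is_derive x 1 F (f x)) -> continuous F.
Proof.
move=> dF x; apply: differentiable_continuous.
by apply/derivable1_diffP; exact: ex_derive.
Qed.

Lemma is_derive_exp_mul (c x : R) :
  is_derive x 1 (fun y => expR (c * y)) (c * expR (c * x)).
Proof. by apply: is_derive_eq; rewrite /GRing.scale /=; ring. Qed.

Lemma continuous_exp_mul (c : R) : continuous (fun y => expR (c * y)).
Proof. by apply: is_derive_continuous => x; exact: is_derive_exp_mul. Qed.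

(** Writes 1/l^2 as a mixture of exponentials in l, which makes the integral of (1 - cos(h l)) / l^2
    an iterated one. *)
Lemma integral_u_exp l : 0 < l ->
  (\int[mu]_(u in `[0%R, +oo[) (u * expR (- l * u))%:E = (l ^- 2)%:E)%E.
Proof.
move=> l0; have ln : l != 0 by rewrite gt_eqF.
pose F u := - ((u / l + l ^- 2) * expR (- l * u)).
have dF u : is_derive u 1 F (u * expR (- l * u)).
  have dE := is_derive_exp_mul (- l) u.
  by apply: is_derive_eq; rewrite /GRing.scale /=; field.
rewrite (@FTC2y_derive (fun u : R => u * expR (- l * u)) F 0 0)//.
- by rewrite /F mulr0 expR0 mul0r !add0r mulr1 opprK.
- by move=> u u0; rewrite mulr_ge0// expR_ge0.
- by move=> u; apply: cvgM; [exact: cvg_id|exact: continuous_exp_mul].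
(* 5 = 4 + 1: the term u/l is paired with the quadratic bound on the exponential, the constant term
   with the linear one. *)
- apply: (@cvgy0_bound _ (5 / l ^+ 3)) => u u0.
  rewrite /F normrN ger0_norm; last first.
    rewrite mulr_ge0 ?expR_ge0// addr_ge0//; first by rewrite divr_ge0 ?ltW.
    by rewrite invr_ge0 exprn_ge0// ltW.
  have lu : 0 < l * u by rewrite mulr_gt0.
  rewrite mulrDl (_ : 5 / l ^+ 3 / u = u / l * (4 / (l * u) ^+ 2) + l ^- 2 * (l * u)^-1); last first.
    by field; rewrite ln gt_eqF.
  rewrite mulNr; apply: lerD; apply: ler_wpM2l.
  - by rewrite divr_ge0// ltW.
  - exact: expRN_bound2.
  - by rewrite invr_ge0 exprn_ge0// ltW.
  - exact: expRN_bound.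
Qed.

Lemma integral_cos_exp u h : 0 < u ->
  (\int[mu]_(l in `[0%R, +oo[) (expR (- u * l) * (1 - cos (h * l)))%:E =
   (h ^+ 2 / (u * (u ^+ 2 + h ^+ 2)))%:E)%E.
Proof.
move=> u0; have un : u != 0 by rewrite gt_eqF.
have q0 : 0 < u ^+ 2 + h ^+ 2 by rewrite ltr_wpDr ?sqr_ge0// exprn_gt0.
have qn : u ^+ 2 + h ^+ 2 != 0 by rewrite gt_eqF.
pose F l := expR (- u * l) * ((u * cos (h * l) - h * sin (h * l)) / (u ^+ 2 + h ^+ 2) - u^-1).
have dc l : is_derive l 1 (fun y => cos (h * y)) (- h * sin (h * l)).
  by apply: is_derive_eq; rewrite /GRing.scale /=; ring.
have ds l : is_derive l 1 (fun y => sin (h * y)) (h * cos (h * l)).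
  by apply: is_derive_eq; rewrite /GRing.scale /=; ring.
have dF l : is_derive l 1 F (expR (- u * l) * (1 - cos (h * l))).
  have dE := is_derive_exp_mul (- u) l; have d1 := dc l; have d2 := ds l.
  apply: is_derive_eq; rewrite /GRing.scale /=; field.
  by rewrite qn un.
rewrite (@FTC2y_derive (fun l : R => expR (- u * l) * (1 - cos (h * l))) F 0 0)//.
- rewrite /F !mulr0 expR0 cos0 sin0 mulr0 mulr1 subr0 mul1r; congr (_%:E).
  by field; rewrite qn un.
- move=> l; apply: cvgM; first exact: continuous_exp_mul.
  by apply: cvgB; [exact: cvg_cst|exact: (is_derive_continuous dc)].
- apply: (@cvgy0_bound _ (u^-1 * ((u + `|h|) / (u ^+ 2 + h ^+ 2) + u^-1))) => l l0.
  have ul : 0 < u * l by rewrite mulr_gt0.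
  rewrite /F normrM ger0_norm ?expR_ge0//.
  rewrite mulrAC -invfM; apply: ler_pM => //.
    by rewrite mulNr; exact: expRN_bound.
  apply: le_trans (ler_normB _ _) _; apply: lerD; last first.
    by rewrite ger0_norm ?lexx// invr_ge0 ltW.
  rewrite normrM [X in _ * X]ger0_norm ?invr_ge0 ?(ltW q0)//.
  rewrite ler_pM2r ?invr_gt0//; apply: le_trans (ler_normB _ _) _.
  rewrite !normrM (ger0_norm (ltW u0)); apply: lerD; first rewrite -[leRHS]mulr1 ler_pM2l//.
    by rewrite ler_norml cos_le1 cos_geN1.
  by rewrite -[leRHS]mulr1 ler_wpM2l// ler_norml sin_le1 sin_geN1.
Qed.

Lemma integral_atan h : 0 < h ->
  (\int[mu]_(u in `[0%R, +oo[) (h ^+ 2 / (u ^+ 2 + h ^+ 2))%:E = (h * (pi / 2))%:E)%E.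
Proof.
move=> h0; have hn : h != 0 by rewrite gt_eqF.
have q0 u : 0 < u ^+ 2 + h ^+ 2 by rewrite ltr_wpDl ?sqr_ge0// exprn_gt0.
pose F u := h * atan (h^-1 * u).
have dF u : is_derive u 1 F (h ^+ 2 / (u ^+ 2 + h ^+ 2)).
  apply: is_derive_eq; rewrite /GRing.scale /= ?mulr0 ?addr0 ?add0r ?mulr1.
  have q1 : 1 + (h^-1 * u) ^+ 2 != 0 by rewrite gt_eqF// ltr_wpDr ?sqr_ge0.
  by field; rewrite hn !gt_eqF// addrC.
rewrite (@FTC2y_derive (fun u : R => h ^+ 2 / (u ^+ 2 + h ^+ 2)) F 0 (h * (pi / 2)))//.
- by rewrite /F mulr0 atan0 mulr0 subr0.
- by move=> u _; rewrite divr_ge0 ?sqr_ge0// ltW.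
- move=> u; apply: cvgM; first exact: cvg_cst.
  apply: cvgV; first by rewrite gt_eqF.
  by apply: cvgD; [exact: exprn_continuous|exact: cvg_cst].
- rewrite /F; apply: cvgM; first exact: cvg_cst.
  have : (h^-1 * u) @[u --> +oo] --> +oo.
    apply/cvgryPge => A; near=> x.
    have hx : h * A < x by near: x; apply: nbhs_pinfty_gt; exact: num_real.
    by rewrite ler_pdivlMl// ltW.
  by move=> c; apply: (@cvg_comp _ _ _ (fun u => h^-1 * u) atan _ _ _ c); exact: cvgy_atan.
Unshelve. all: by end_near. Qed.

End FejerIntegral.

Section Tonelli.
Variable R : realType.
Local Notation mu := (@lebesgue_measure R).

Lemma tonelli_on (D1 D2 : set R) (F : R -> R -> R) : measurable D1 -> measurable D2 ->
  measurable_fun setT (fun p : R * R => F p.1 p.2) ->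
  (forall x y, D1 x -> D2 y -> 0 <= F x y) ->
  (\int[mu]_(x in D1) \int[mu]_(y in D2) (F x y)%:E =
   \int[mu]_(y in D2) \int[mu]_(x in D1) (F x y)%:E)%E.
Proof.
move=> mD1 mD2 mF F0.
pose G (p : measurableTypeR R * measurableTypeR R) : \bar R :=
  (F p.1 p.2 * \1_D1 p.1 * \1_D2 p.2)%:E.
have mG : measurable_fun setT G.
  apply/measurable_EFinP; apply: measurable_funM; first apply: measurable_funM => //.
    by apply: (@measurableT_comp _ _ _ _ _ _ (\1_D1 : R -> R)); [exact: measurable_indic|exact: measurable_fst].
  by apply: (@measurableT_comp _ _ _ _ _ _ (\1_D2 : R -> R)); [exact: measurable_indic|exact: measurable_snd].
have G0 p : (0 <= G p)%E.
  rewrite lee_fin /G !indicE.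
  have [p1|p1] := boolP (p.1 \in D1); last by rewrite mulr0 mul0r.
  have [p2|p2] := boolP (p.2 \in D2); last by rewrite mulr0.
  by rewrite !mulr1; apply: F0; rewrite -in_setE.
have T := @fubini_tonelli _ _ _ _ R mu mu G mG G0.
have E1 x : ((fun x => \int[mu]_(y in D2) (F x y)%:E)%E \_ D1) x = (\int[mu]_y G (x, y))%E.
  rewrite patchE; case: ifPn => xD; last first.
    by rewrite integral0_eq// => y _; rewrite /G /= indicE (negbTE xD) mulr0 mul0r.
  rewrite integral_mkcond; apply: eq_integral => y _; rewrite patchE /G /= !indicE xD mulr1.
  by case: (y \in D2); rewrite ?mulr1 ?mulr0.
have E2 y : ((fun y => \int[mu]_(x in D1) (F x y)%:E)%E \_ D2) y = (\int[mu]_x G (x, y))%E.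
  rewrite patchE; case: ifPn => yD; last first.
    by rewrite integral0_eq// => x _; rewrite /G /= [X in _ * X]indicE (negbTE yD) mulr0.
  rewrite integral_mkcond; apply: eq_integral => x _; rewrite patchE /G /= !indicE yD mulr1.
  by case: (x \in D1); rewrite ?mulr1 ?mulr0.
transitivity (\int[mu]_x \int[mu]_y G (x, y))%E.
  by rewrite integral_mkcond; apply: eq_integral => x _; exact: E1.
by rewrite T [RHS]integral_mkcond; apply: eq_integral => y _; exact/esym/E2.
Qed.

End Tonelli.

Section FejerProcess.
Variable R : realType.
Local Notation mu := (@lebesgue_measure R).
Implicit Types u h l x : R.

Lemma continuous_meas (f : R -> R) : continuous f -> measurable_fun setT f.
Proof. exact: continuous_measurable_fun. Qed.

Lemma measurable_expRT : measurable_fun setT (@expR R).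
Proof. exact: measurable_expR. Qed.

Lemma measurable_cosT : measurable_fun setT (@cos R).
Proof. by apply: continuous_meas; exact: continuous_cos. Qed.

Lemma measurable_sinT : measurable_fun setT (@sin R).
Proof. by apply: continuous_meas; exact: continuous_sin. Qed.

(** After replacing 1/l^2 by the integral of u exp(-l u), Tonelli brings the integral over l inside.
    It is the Laplace transform of 1 - cos(h l) and leaves h^2 / (u^2 + h^2), an arctangent
    derivative. *)
Lemma integral_fejer_half h : 0 < h ->
  (\int[mu]_(l in `[0%R, +oo[) ((1 - cos (h * l)) / l ^+ 2)%:E = (h * (pi / 2))%:E)%E.
Proof.
move=> h0; rewrite -integral_atan//.
pose F l u := u * expR (- l * u) * (1 - cos (h * l)).
have c0 l : 0 <= 1 - cos (h * l) by rewrite subr_ge0 cos_le1.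
transitivity (\int[mu]_(l in `[0%R, +oo[) \int[mu]_(u in `]0%R, +oo[) (F l u)%:E)%E.
  apply: eq_integral => l; rewrite inE/= in_itv/= andbT => l0.
  under eq_integral do rewrite /F mulrC EFinM.
  have mf : measurable_fun setT (fun u : R => (u * expR (- l * u))%:E).
    apply/measurable_EFinP; apply: continuous_meas.
    by move=> u; apply: cvgM; [exact: cvg_id|exact: continuous_exp_mul].
  rewrite ge0_integralZl//; last 2 first.
  - exact: measurable_funTS.
  - move=> u; rewrite /= in_itv/= andbT => u0.
    by rewrite lee_fin mulr_ge0 ?expR_ge0// ltW.
  rewrite integral_itv_obnd_cbnd; last exact: measurable_funTS.
  have [l1|l1] := eqVneq l 0.
    by rewrite l1 mulr0 cos0 subrr mul0r mul0e.
  by rewrite integral_u_exp ?lt_neqAle ?l0 ?andbT 1?eq_sym.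
rewrite tonelli_on//; last 2 first.
- apply: measurable_funM; first apply: measurable_funM.
  + exact: measurable_snd.
  + apply: (measurableT_comp measurable_expRT); apply: measurable_funM; last exact: measurable_snd.
    by apply: measurableT_comp => //; exact: measurable_fst.
  + apply: measurable_funB => //; apply: (measurableT_comp measurable_cosT).
    by apply: measurable_funM => //; exact: measurable_fst.
- move=> x y _; rewrite /= in_itv/= andbT => y0.
  by rewrite /F mulr_ge0// mulr_ge0 ?expR_ge0// ltW.
have q0 (u : R) : 0 < u ^+ 2 + h ^+ 2 by rewrite ltr_wpDl ?sqr_ge0// exprn_gt0.
rewrite -integral_itv_obnd_cbnd; last first.
  apply: measurable_funTS; apply/measurable_EFinP; apply: continuous_meas.
  move=> u; apply: cvgM; first exact: cvg_cst.
  apply: cvgV; first by rewrite gt_eqF.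
  by apply: cvgD; [exact: exprn_continuous|exact: cvg_cst].
apply: eq_integral => u; rewrite inE/= in_itv/= andbT => u0.
transitivity (\int[mu]_(l in `[0%R, +oo[) (u%:E * (expR (- u * l) * (1 - cos (h * l)))%:E))%E.
  by apply: eq_integral => l _; rewrite -EFinM /F mulrA !mulNr (mulrC l).
rewrite ge0_integralZl//; last 2 first.
- apply: measurable_funTS; apply/measurable_EFinP; apply: measurable_funM.
    by apply: continuous_meas; exact: continuous_exp_mul.
  apply: measurable_funB => //; apply: (measurableT_comp measurable_cosT).
  exact: measurable_funM.
- by rewrite lee_fin ltW.
rewrite integral_cos_exp// -EFinM; congr (_%:E); field.
by rewrite !gt_eqF.
Qed.

(* The transform of the indicator of [0, t]; the junk value 0 at [l = 0] is harmless. *)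
Definition Eproc (t l : R) : R[i] := (1 - expi (- (l * t))) / Complex 0 l.

Lemma Eproc_conj t l : Eproc t (- l) = conjc (Eproc t l).
Proof.
rewrite /Eproc !conjcM mulNr opprK; congr (_ * _).
  by rewrite /expi cosN sinN; apply: eq_ReIm; rewrite !ReImE /=; ring.
by rewrite conjc_inv /= ; congr (_^-1); apply: eq_ReIm.
Qed.

Lemma normc2_EprocB s t l :
  normc2 (Eproc t l - Eproc s l) = 2 * ((1 - cos (`|t - s| * l)) / l ^+ 2).
Proof.
rewrite /Eproc -mulrBl normc2M normc2V {2}/normc2 /= expr0n add0r mulrA; congr (_ / _).
rewrite opprB addrC addrA subrK.
have -> : cos (`|t - s| * l) = cos (l * t - l * s).
  rewrite -mulrBr mulrC; have [h|h] := ger0P (t - s); first by [].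
  by rewrite mulrN cosN.
rewrite /normc2 /expi !ReImE /= !cosN !sinN cosB.
have := cos2Dsin2 (l * t); have := cos2Dsin2 (l * s).
move=> h1 h2.
transitivity ((cos (l * t) ^+ 2 + sin (l * t) ^+ 2) + (cos (l * s) ^+ 2 + sin (l * s) ^+ 2)
  - 2 * (cos (l * t) * cos (l * s) + sin (l * t) * sin (l * s))); first by ring.
by rewrite h1 h2; ring.
Qed.

Lemma cmeasurable_expi (f : R -> R) : measurable_fun setT f -> cmeasurable (fun x => expi (f x) : R[i]).
Proof.
by move=> mf; split; [apply: (measurableT_comp measurable_cosT)|apply: (measurableT_comp measurable_sinT)].
Qed.

Lemma cmeasurable_Eproc t : cmeasurable (Eproc t).
Proof.
apply: cmeasurableM.
  apply: cmeasurableB; first exact: cmeasurable_cst.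
  apply: cmeasurable_expi; apply: measurableT_comp => //.
  exact: measurable_funM.
by apply: cmeasurableV; split => //=; exact: measurable_cst.
Qed.

Lemma sqnorm_EprocB s t :
  sqnorm mu setT (fun l => Eproc t l - Eproc s l) = (2 * pi * `|t - s|)%:E.
Proof.
rewrite /sqnorm; under eq_integral do rewrite normc2_EprocB.
have [h0|h0] := eqVneq `|t - s| 0.
  rewrite h0 mulr0; apply: integral0_eq => l _.
  by rewrite mul0r cos0 subrr mul0r mulr0.
have hp : 0 < `|t - s| by rewrite lt_neqAle eq_sym h0 normr_ge0.
set h := `|t - s| in hp *.
pose f l := (1 - cos (h * l)) / l ^+ 2.
have mf : measurable_fun setT f.
  have := measurable_normc2 (cmeasurableB (cmeasurable_Eproc t) (cmeasurable_Eproc s)).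
  under eq_fun do rewrite normc2_EprocB.
  move=> m2; rewrite (_ : f = fun l => 2^-1 * (2 * f l)).
    exact: (measurable_funM (measurable_cst _) m2).
  by apply/funext => l; rewrite mulrA mulVf ?mul1r.
have f0 l : 0 <= f l by rewrite divr_ge0 ?sqr_ge0// subr_ge0 cos_le1.
have mfE : measurable_fun setT (EFin \o f) by exact/measurable_EFinP.
under eq_integral do rewrite EFinM -/(f _).
rewrite ge0_integralZl; try exact: mfE; try (by move=> l _; rewrite lee_fin f0);
  try by [].
rewrite (_ : 2 * pi * h = 2 * (h * (pi / 2) + h * (pi / 2))); last by field.
rewrite EFinM; congr (_ * _)%E; rewrite EFinD -integral_fejer_half//.
pose fp l := f l * \1_(`[0, +oo[%classic) l; pose fm l := f l * (1 - \1_(`[0, +oo[%classic) l).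
have mI : measurable_fun setT (\1_(`[0, +oo[%classic) : R -> R) by exact: measurable_indic.
have mfp : measurable_fun setT (EFin \o fp) by apply/measurable_EFinP; exact: measurable_funM.
have mfm : measurable_fun setT (EFin \o fm).
  by apply/measurable_EFinP; apply: measurable_funM => //; exact: measurable_funB.
have fp0 l : (0 <= (fp l)%:E)%E by rewrite lee_fin mulr_ge0// indicE.
have fm0 l : (0 <= (fm l)%:E)%E.
  by rewrite lee_fin mulr_ge0// indicE; case: (_ \in _); rewrite /= ?subrr ?subr0.
transitivity (\int[mu]_l ((fp l)%:E + (fm l)%:E))%E.
  by apply: eq_integral => l _; rewrite -EFinD /fp /fm; congr (_%:E); ring.
rewrite ge0_integralD//.
have Ep : (\int[mu]_l (fp l)%:E = \int[mu]_(l in `[0%R, +oo[) (f l)%:E)%E.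
  rewrite [RHS]integral_mkcond; apply: eq_integral => l _.
  by rewrite patchE /fp indicE; case: (_ \in _); rewrite ?mulr1 ?mulr0.
rewrite Ep; congr (_ + _)%E; rewrite -[RHS]Ep.
(* By evenness the negative half-line mirrors the positive one; at l = 0 there is no mismatch, since
   division by zero makes the integrand 0 there. *)
rewrite -(@ge0_integral_preserving _ _ (EFin \o fp) (preserving_opp R))//.
apply: eq_integral => l _ /=; rewrite /fm /fp /f mulrN cosN sqrrN !indicE !mem_setE !in_itv/= !andbT.
rewrite oppr_ge0; congr (_%:E); case: (ltgtP l 0) => [h1|h1|->]; rewrite /= ?subr0 ?subrr//.
by rewrite expr0n invr0 !(mulr0, mul0r).
Qed.

(** Covariances of increments are real because of the symmetry [Eproc_conj]: the substitution of -l
    for l conjugates both factors and so reverses the sign of the inner product that contains i. *)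
Lemma orthogonal_process_Eproc : orthogonal_process mu (2 * pi) Eproc.
Proof.
have L s t : square_integrable mu (fun l => Eproc t l - Eproc s l).
  split; first by apply: cmeasurableB; exact: cmeasurable_Eproc.
  by rewrite sqnorm_EprocB ltry.
split=> // [s t|s t u v]; first by rewrite /nrm2 sqnorm_EprocB.
have iL := sqintZ 'i%C (L s t).
have := rip_preserving (preserving_opp R) iL (L u v).
under [X in rip _ X _ = _]eq_fun do rewrite !Eproc_conj -rmorphB.
under [X in rip _ _ X = _]eq_fun do rewrite !Eproc_conj -rmorphB.
have -> : rip mu (fun l => 'i%C * conjc (Eproc t l - Eproc s l))
                 (fun l => conjc (Eproc v l - Eproc u l)) =
    - rip mu (fun l => 'i%C * (Eproc t l - Eproc s l)) (fun l => Eproc v l - Eproc u l).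
  rewrite -ripNl//; apply: eq_Rintegral => l _.
  by rewrite /rdot !ReImE /=; ring.
lra.
Qed.

End FejerProcess.

(** * Bounded Fourier multipliers *)

Section ParameterIntegrals.
Variable R : realType.
Local Notation mu := (@lebesgue_measure R).

Lemma measurable_parameter_integral_ge0 (F : R -> R -> R) (D : set R) : measurable D ->
  measurable_fun setT (fun p : R * R => F p.1 p.2) -> (forall x y, 0 <= F x y) ->
  measurable_fun setT (fun x => \int[mu]_(y in D) (F x y)%:E)%E.
Proof.
move=> mD mF F0.
pose G (p : measurableTypeR R * measurableTypeR R) : \bar R :=
  (F p.1 p.2 * \1_D p.2)%:E.
have mG : measurable_fun setT G.
  apply/measurable_EFinP; apply: measurable_funM => //.
  by apply: (@measurableT_comp _ _ _ _ _ _ (\1_D : R -> R)); [exact: measurable_indic|exact: measurable_snd].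
have G0 p : (0 <= G p)%E by rewrite lee_fin /G mulr_ge0// indicE.
have := @measurable_fun_fubini_tonelli_F _ _ _ _ R mu G mG G0.
have E x : (\int[mu]_(y in D) (F x y)%:E = \int[mu]_y G (x, y))%E.
  rewrite [LHS]integral_mkcond; apply: eq_integral => y _.
  by rewrite patchE /G /= indicE; case: (y \in D); rewrite ?mulr1 ?mulr0.
by rewrite (_ : (fun x => _) = fubini_F mu G)//; apply/funext => x; exact: E.
Qed.

Lemma measurable_parameter_integral (F : R -> R -> R) (D : set R) : measurable D ->
  measurable_fun setT (fun p : R * R => F p.1 p.2) ->
  measurable_fun setT (fun x => Rintegral mu D (F x)).
Proof.
move=> mD mF.
have mFp : measurable_fun setT (fun p : R * R => Num.max (F p.1 p.2) 0).
  by apply: measurable_maxr => //; exact: measurable_cst.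
have mFn : measurable_fun setT (fun p : R * R => Num.max (- F p.1 p.2) 0).
  by apply: measurable_maxr; [exact: measurableT_comp|exact: measurable_cst].
have mx0 (r : R) : 0 <= Num.max r 0 by rewrite le_max lexx orbT.
have h1 := @measurable_parameter_integral_ge0 (fun x y => Num.max (F x y) 0) D mD mFp
  (fun x y => mx0 _).
have h2 := @measurable_parameter_integral_ge0 (fun x y => Num.max (- F x y) 0) D mD mFn
  (fun x y => mx0 _).
rewrite /Rintegral; apply: measurableT_comp; first exact: fine_measurable.
rewrite (_ : (fun x => _) = (fun x => \int[mu]_(y in D) (Num.max (F x y) 0)%:E -
    \int[mu]_(y in D) (Num.max (- F x y) 0)%:E)%E); first exact: emeasurable_funB.
apply/funext => x; rewrite integralE; congr (_ - _)%E; apply: eq_integral => y _.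
  by rewrite funeposE EFin_max.
by rewrite funenegE EFin_max EFinN.
Qed.

(** All sections are required to be integrable, not almost all, so that the real-valued inner
    integrals agree everywhere with the extended ones. *)
Lemma Rintegral_fubini_gen (D : set R) (F : R -> R -> R) :
  measurable D -> measurable_fun setT (fun p : R * R => F p.1 p.2) ->
  (forall x, mu.-integrable D (EFin \o F x)) ->
  (forall y, D y -> mu.-integrable setT (EFin \o F ^~ y)) ->
  (\int[mu]_x \int[mu]_(y in D) `|F x y|%:E < +oo)%E ->
  Rintegral mu setT (fun x => Rintegral mu D (F x)) =
  Rintegral mu D (fun y => Rintegral mu setT (F ^~ y)).
Proof.
move=> mD mF iFx iFy Foo.
pose H (p : measurableTypeR R * measurableTypeR R) : \bar R :=
  (F p.1 p.2 * \1_D p.2)%:E.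
have mH : measurable_fun setT H.
  apply/measurable_EFinP; apply: measurable_funM => //.
  by apply: (@measurableT_comp _ _ _ _ _ _ (\1_D : R -> R)); [exact: measurable_indic|exact: measurable_snd].
have E1 x : (\int[mu]_y H (x, y) = \int[mu]_(y in D) (F x y)%:E)%E.
  rewrite [RHS]integral_mkcond; apply: eq_integral => y _.
  by rewrite patchE /H /= indicE; case: (y \in D); rewrite ?mulr1 ?mulr0.
have iH : (mu \x mu)%E.-integrable setT H.
  apply/integrable12ltyP => //; apply: le_lt_trans Foo.
  rewrite le_eqVlt; apply/orP; left; apply/eqP; apply: eq_integral => x _.
  rewrite [RHS]integral_mkcond; apply: eq_integral => y _.
  by rewrite patchE /H /= indicE; case: (y \in D); rewrite ?mulr1 ?mulr0 ?normr0.
have FUB := @Fubini _ _ _ _ R mu mu H iH.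
rewrite /Rintegral; congr fine.
transitivity (\int[mu]_x \int[mu]_y H (x, y))%E.
  by apply: eq_integral => x _; rewrite E1 fineK//; exact: (@integrable_fin_num _ _ _ mu D mD _ (iFx x)).
rewrite FUB [RHS]integral_mkcond; apply: eq_integral => y _.
rewrite patchE; case: ifPn => yD.
  have /iFy iy : D y by rewrite -in_setE.
  have := @integrable_fin_num _ _ _ mu setT measurableT _ iy => /fineK ->.
  by apply: eq_integral => x _; rewrite /H /= indicE yD mulr1.
by apply: integral0_eq => x _; rewrite /H /= indicE (negbTE yD) mulr0.
Qed.

Lemma Rintegral_fubini (D : set R) (F : R -> R -> R) (G B : R -> R) :
  measurable D -> measurable_fun setT (fun p : R * R => F p.1 p.2) ->
  mu.-integrable setT (EFin \o G) -> mu.-integrable D (EFin \o B) ->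
  (forall x y, `|F x y| <= G x * B y) ->
  Rintegral mu setT (fun x => Rintegral mu D (F x)) =
  Rintegral mu D (fun y => Rintegral mu setT (F ^~ y)).
Proof.
move=> mD mF iG iB FGB.
have iFx x : mu.-integrable D (EFin \o F x).
  apply: (@le_integrable _ _ _ mu D mD _ (EFin \o (fun y => G x * B y))).
  - apply/measurable_EFinP; apply: measurable_funTS.
    exact: (measurableT_comp mF (measurable_pair1 x)).
  - by move=> y _ /=; rewrite lee_fin (le_trans (FGB x y))// ler_norm.
  - exact: (@integrableZl _ _ _ mu D mD (G x) _ iB).
have iFy y : mu.-integrable setT (EFin \o F ^~ y).
  apply: (@le_integrable _ _ _ mu setT measurableT _ (EFin \o (fun x => B y * G x))).
  - apply/measurable_EFinP.
    exact: (measurableT_comp mF (measurable_pair2 y)).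
  - by move=> x _ /=; rewrite lee_fin mulrC (le_trans (FGB x y))// ler_norm.
  - exact: (@integrableZl _ _ _ mu setT measurableT (B y) _ iG).
apply: Rintegral_fubini_gen => //.
have /integrableP[mB fB] := iB; have /integrableP[mG fG] := iG.
have B0 : (0 <= \int[mu]_(y in D) `|(EFin \o B) y|)%E by exact: integral_ge0.
have b x : (\int[mu]_(y in D) `|F x y|%:E <= `|G x|%:E * \int[mu]_(y in D) `|(EFin \o B) y|)%E.
  rewrite -ge0_integralZl//; last exact: measurableT_comp.
  have /integrableP[mFx _] := iFx x.
  apply: ge0_le_integral => //.
  - exact: (measurableT_comp (@abse_measurable R setT) mFx).
  - by apply: measurable_funeM; exact: measurableT_comp.
  - by move=> y _ /=; rewrite lee_fin -normrM (le_trans (FGB x y))//; exact: ler_norm.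
have maF : measurable_fun setT (fun p : R * R => `|F p.1 p.2|) by exact: measurableT_comp.
apply: (@le_lt_trans _ _ (\int[mu]_x (`|G x|%:E * \int[mu]_(y in D) `|(EFin \o B) y|))%E).
  apply: ge0_le_integral => //.
  - by move=> x _; exact: integral_ge0.
  - by apply: (@measurable_parameter_integral_ge0 (fun x y => `|F x y|)).
  - apply: emeasurable_funM; last exact: measurable_cst.
    by apply: (@measurableT_comp _ _ _ _ _ _ abse _ (EFin \o G)).
have mAG : measurable_fun setT (fun x => `|(EFin \o G) x|%E) by exact: measurableT_comp.
rewrite (_ : (fun x => _) = fun x => (`|(EFin \o G) x| *
  \int[mu]_(y in D) `|(EFin \o B) y|)%E)// ge0_integralZr//.
by apply: lte_mul_pinfty => //; rewrite ?integral_ge0// ge0_fin_numE// integral_ge0.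
Qed.

End ParameterIntegrals.

Section Multipliers.
Variable R : realType.
Local Notation mu := (@lebesgue_measure R).
Implicit Types (D : set R) (beta f : R -> R[i]) (e : R -> R -> R[i]).

(** Abstracts from the sign in exp(-i l t) and exp(i l t): the first gives causal multipliers, the
    second the characteristic A of the functional. *)
Definition unit_kernel e :=
  (forall l x, normc2 (e l x) = 1) /\
  cmeasurable (fun p : R * R => e p.1 p.2).

Definition multiplier D e beta (l : R) : R[i] :=
  cintegral mu D (fun x => beta x * e l x).

Lemma rdot_cintegral D f (w : R[i]) : measurable D -> cintegrable mu D f ->
  rdot (cintegral mu D f) w = Rintegral mu D (fun x => rdot (f x) w).
Proof.
move=> mD [f1 f2]; rewrite /rdot /cintegral /=.
rewrite -(@RintegralZr _ _ _ mu D _ _ mD f1) -(@RintegralZr _ _ _ mu D _ _ mD f2).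
rewrite (@RintegralD _ _ _ mu D _ _ mD)//.
- have := @integrableZr _ _ _ mu D mD (complex.Re w) _ f1; exact: id.
- have := @integrableZr _ _ _ mu D mD (complex.Im w) _ f2; exact: id.
Qed.

(** Serves as the modulus; integrability of the two coordinates is exactly integrability of this
    sum. *)
Definition abs1 (z : R[i]) : R := `|complex.Re z| + `|complex.Im z|.

Lemma abs1_ge0 z : 0 <= abs1 z. Proof. by rewrite addr_ge0. Qed.

Lemma normr_ReM_unit (z w : R[i]) : normc2 w = 1 -> `|complex.Re (z * w)| <= abs1 z.
Proof.
move=> w1; have b (r : R) : r ^+ 2 <= 1 -> `|r| <= 1.
  by move=> r1; rewrite -(@ler_pXn2r _ 2)// ?nnegrE// expr1n -normrX ger0_norm ?sqr_ge0.
have b1 : `|complex.Re w| <= 1 by apply: b; rewrite -w1 sqr_Re_le.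
have b2 : `|complex.Im w| <= 1 by apply: b; rewrite -w1 sqr_Im_le.
rewrite Re_mul; apply: le_trans (ler_normB _ _) _; rewrite !normrM.
by apply: lerD; rewrite -[leRHS]mulr1 ler_wpM2l.
Qed.

Lemma normr_ImM_unit (z w : R[i]) : normc2 w = 1 -> `|complex.Im (z * w)| <= abs1 z.
Proof.
move=> w1; rewrite (_ : complex.Im (z * w) = complex.Re (z * (- 'i%C * w))).
  by apply: normr_ReM_unit; rewrite normc2M normc2N w1 /normc2 /= expr0n expr1n add0r mulr1.
by rewrite !ReImE /=; ring.
Qed.

Lemma cmeasurable_kernel e l : unit_kernel e -> cmeasurable (e l).
Proof.
by move=> [_ [m1 m2]]; split; [apply: (measurableT_comp m1 (measurable_pair1 l))|
  apply: (measurableT_comp m2 (measurable_pair1 l))].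
Qed.

Lemma cmeasurable_fst d1 d2 (T1 : measurableType d1) (T2 : measurableType d2)
  (f : T1 -> R[i]) : cmeasurable f -> cmeasurable (fun p : T1 * T2 => f p.1).
Proof.
by move=> [m1 m2]; split; [apply: (measurableT_comp m1)|apply: (measurableT_comp m2)];
  exact: measurable_fst.
Qed.

Lemma cmeasurable_snd d1 d2 (T1 : measurableType d1) (T2 : measurableType d2)
  (f : T2 -> R[i]) : cmeasurable f -> cmeasurable (fun p : T1 * T2 => f p.2).
Proof.
by move=> [m1 m2]; split; [apply: (measurableT_comp m1)|apply: (measurableT_comp m2)];
  exact: measurable_snd.
Qed.

Section OneMultiplier.
Variables (D : set R) (e : R -> R -> R[i]) (beta : R -> R[i]).
Hypotheses (mD : measurable D) (He : unit_kernel e) (mb : cmeasurable beta).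
Hypothesis ib : cintegrable mu D beta.

Lemma integrable_abs1 : mu.-integrable D (EFin \o (fun x => abs1 (beta x))).
Proof.
have [i1 i2] := ib.
exact: (@integrableD _ _ _ mu D mD _ _ (integrable_norm i1) (integrable_norm i2)).
Qed.

Lemma cintegrable_mul_unit l : cintegrable mu D (fun x => beta x * e l x).
Proof.
have [m1 m2] := cmeasurableM mb (cmeasurable_kernel l He).
split; apply: (@le_integrable _ _ _ mu D mD _ _ _ _ integrable_abs1) => /=.
- by apply/measurable_EFinP; exact: measurable_funTS.
- move=> x _; rewrite lee_fin [leRHS]ger0_norm ?abs1_ge0//.
  by apply: normr_ReM_unit; case: He.
- by apply/measurable_EFinP; exact: measurable_funTS.
- move=> x _; rewrite lee_fin [leRHS]ger0_norm ?abs1_ge0//.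
  by apply: normr_ImM_unit; case: He.
Qed.

Lemma cmeasurable_multiplier : cmeasurable (multiplier D e beta).
Proof.
have [m1 m2] := cmeasurableM (cmeasurable_snd R mb) (proj2 He).
by split; apply: measurable_parameter_integral.
Qed.

Lemma multiplier_bounded : exists C, forall l, normc2 (multiplier D e beta l) <= C.
Proof.
pose K := Rintegral mu D (fun x => abs1 (beta x)).
exists (K ^+ 2 + K ^+ 2) => l.
have [i1 i2] := cintegrable_mul_unit l.
have b (g : R -> R) : mu.-integrable D (EFin \o g) ->
    (forall x, `|g x| <= abs1 (beta x)) -> Rintegral mu D g ^+ 2 <= K ^+ 2.
  move=> ig gb; rewrite -(real_normK (num_real _)).
  have K0 : 0 <= K by apply: Rintegral_ge0 => x _; exact: abs1_ge0.
  rewrite ler_pXn2r ?nnegrE//.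
  apply: le_trans (@le_normr_Rintegral _ _ _ mu D g mD ig) _.
  apply: (@le_Rintegral _ _ _ mu D _ _ mD) => //.
    exact: (integrable_norm ig).
  exact: integrable_abs1.
rewrite /normc2 /=; apply: lerD; apply: b => // x.
  by apply: normr_ReM_unit; case: He.
by apply: normr_ImM_unit; case: He.
Qed.

Lemma sqint_multiplier f : square_integrable mu f ->
  square_integrable mu (fun l => multiplier D e beta l * f l).
Proof.
have [C hC] := multiplier_bounded.
exact: (@sqintM _ _ _ mu (multiplier D e beta) C f cmeasurable_multiplier hC).
Qed.

(** The multiplier is an average of modulations, so orthogonality relations valid for each modulated
    function pass to the product with the multiplier. *)
Lemma rip_multiplier f g : square_integrable mu f -> square_integrable mu g ->
  rip mu (fun l => multiplier D e beta l * f l) g =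
  Rintegral mu D (fun x => rip mu (fun l => beta x * (e l x * f l)) g).
Proof.
move=> fL gL.
pose F l x := rdot (beta x * (e l x * f l)) (g l).
transitivity (Rintegral mu setT (fun l => Rintegral mu D (F l))).
  apply: eq_Rintegral => l _; rewrite mulrC rdotMl mulrC.
  rewrite rdot_cintegral//; last exact: cintegrable_mul_unit.
  apply: eq_Rintegral => x _; rewrite /F (mulrC (g l)) -rdotMl.
  by congr rdot; ring.
rewrite (@Rintegral_fubini _ D F (fun l => normc2 (f l) + normc2 (g l))
   (fun x => abs1 (beta x)))//.
- apply: (measurable_rdot (d := _)).
  + apply: cmeasurableM; first exact: (cmeasurable_snd R mb).
    apply: cmeasurableM; first exact: (proj2 He).
    by apply: (cmeasurable_fst R); case: fL.
  + by apply: (cmeasurable_fst R); case: gL.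
- exact: (@integrableD _ _ _ mu setT measurableT _ _ (integrable_normc2 fL) (integrable_normc2 gL)).
- exact: integrable_abs1.
- move=> l x; rewrite /F.
  rewrite rdotZl; apply: le_trans (ler_normD _ _) _.
  rewrite !normrM.
  have n1 : normc2 (e l x * f l) = normc2 (f l) by rewrite normc2M (proj1 He) mul1r.
  have n2 : normc2 ('i%C * (e l x * f l)) = normc2 (f l).
    by rewrite normc2M n1 /normc2 /= expr0n expr1n add0r mul1r.
  have h1 := normr_rdot_le (e l x * f l) (g l).
  have h2 := normr_rdot_le ('i%C * (e l x * f l)) (g l).
  rewrite n1 in h1; rewrite n2 in h2.
  have nf := normc2_ge0 (f l); have ng := normc2_ge0 (g l).
  have a1 := normr_ge0 (complex.Re (beta x)); have a2 := normr_ge0 (complex.Im (beta x)).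
  rewrite [leRHS]mulrC /abs1 mulrDl; apply: lerD; apply: ler_wpM2l => //; lra.
Qed.

End OneMultiplier.

End Multipliers.

Section ComplexInner.
Context (R : realType) (d : measure_display) (U : measurableType d).
Variable m : {measure set U -> \bar R}.
Local Notation L2 := (square_integrable m).
Implicit Types f g h : U -> R[i].

Definition cip f g : R[i] := Complex (rip m f g) (rip m f (fun x => 'i%C * g x)).

Lemma rip_i_skew f g : L2 f -> L2 g ->
  rip m (fun x => 'i%C * f x) g = - rip m f (fun x => 'i%C * g x).
Proof.
move=> fL gL; rewrite ripMl -ripNr//; last exact: sqintZ.
apply: eq_Rintegral => x _; congr rdot.
by apply: eq_ReIm; rewrite !ReImE /=; ring.
Qed.

Lemma cipZl c f g : L2 f -> L2 g -> cip (fun x => c * f x) g = c * cip f g.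
Proof.
move=> fL gL; have igL := sqintZ 'i%C gL; rewrite /cip (ripZl c fL gL) (ripZl c fL igL) (rip_i_skew fL gL) (rip_i_skew fL igL).
rewrite (_ : rip m f (fun x => 'i%C * ('i%C * g x)) = - rip m f g).
  by apply: eq_ReIm; rewrite !ReImE /=; ring.
rewrite -ripNr//; apply: eq_Rintegral => x _; congr rdot.
by apply: eq_ReIm; rewrite !ReImE /=; ring.
Qed.

Lemma cip_suml (I : Type) (s : seq I) (F : I -> U -> R[i]) g :
  (forall i, L2 (F i)) -> L2 g ->
  cip (fun x => \sum_(i <- s) F i x) g = \sum_(i <- s) cip (F i) g.
Proof.
move=> FL gL; rewrite /cip !rip_suml//; last exact: sqintZ.
by apply: eq_ReIm; rewrite ?Re_sum ?Im_sum.
Qed.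

Lemma cipBl f g h : L2 f -> L2 g -> L2 h ->
  cip (fun x => f x - g x) h = cip f h - cip g h.
Proof.
by move=> *; rewrite /cip !ripBl//; try exact: sqintZ.
Qed.

(** The factor 2 comes from bounding the real and imaginary parts separately. *)
Lemma normc2_cip_le f g : L2 f -> L2 g ->
  normc2 (cip f g) <= 2 * (nrm2 m f * nrm2 m g).
Proof.
move=> fL gL; have igL := sqintZ 'i%C gL.
have := cauchy_schwarz fL gL; have := cauchy_schwarz fL igL.
rewrite nrm2Z// (_ : normc2 'i%C = 1) ?mul1r; last first.
  by rewrite /normc2 /= expr0n expr1n add0r.
rewrite /normc2 /cip /= => h1 h2; lra.
Qed.

End ComplexInner.

Lemma ae_imp (R : realType) d (U : measurableType d) (m : {measure set U -> \bar R})
    (P Q : U -> Prop) : (forall x, P x -> Q x) ->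
  {ae m, forall x, P x} -> {ae m, forall x, Q x}.
Proof. by move=> PQ; apply: filterS. Qed.

Lemma ae_imp2 (R : realType) d (U : measurableType d) (m : {measure set U -> \bar R})
    (P Q S : U -> Prop) : (forall x, P x -> Q x -> S x) ->
  {ae m, forall x, P x} -> {ae m, forall x, Q x} -> {ae m, forall x, S x}.
Proof. by move=> PQ; apply: filterS2. Qed.

Section StepCut.
Variable R : realType.
Local Notation mu := (@lebesgue_measure R).

(* Restatements on the line, whose default measurable structure and that of [lebesgue_measure] are convertible but not syntactically equal. *)
Lemma mu_sqintM (k : R -> R[i]) C (f : R -> R[i]) : cmeasurable k ->
  (forall x, normc2 (k x) <= C) -> square_integrable mu f ->
  square_integrable mu (fun x => k x * f x).
Proof. exact: (@sqintM _ _ _ mu). Qed.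

Lemma mu_eq_nrm2_ae (f f' : R -> R[i]) : cmeasurable f -> cmeasurable f' ->
  {ae mu, forall x, f x = f' x} -> nrm2 mu f = nrm2 mu f'.
Proof. exact: (@eq_nrm2_ae _ _ _ mu). Qed.

Lemma mu_le_sqnorm (f : R -> R[i]) (g : R -> R) : cmeasurable f -> measurable_fun setT g ->
  (forall x, normc2 (f x) <= g x) -> (sqnorm mu setT f <= \int[mu]_x (g x)%:E)%E.
Proof. exact: (@le_sqnorm _ _ _ mu). Qed.

(** [c] is a monotone clamp of the line onto D. Clamping the endpoints multiplies a step function by
    the indicator of D, which does not increase its distance to a function carried by D. *)
Lemma step_dense_on (D : set R) (c : R -> R) (g : R -> R[i]) e :
  measurable D ->
  (forall a b, a <= b -> c a <= c b) ->
  (forall a b x, a <= b -> \1_(`]c a, c b]%classic) x = \1_D x * \1_(`]a, b]%classic) x :> R) ->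
  square_integrable mu g -> {ae mu, forall x, g x = (\1_D x : R)%:C%C * g x} -> 0 < e ->
  exists S, [/\ ordered S, forall p, p \in S -> exists a b, p.1 = (c a, c b) &
     nrm2 mu (fun x => g x - stepfun S x) <= e].
Proof.
move=> mD ch cD gL gD e0; have [_ _ /(_ _ e0)[S [oS S1 _]]] := step_dense gL.
pose S' := [seq ((c p.1.1, c p.1.2), p.2) | p <- S].
exists S'; split.
- by move=> _ /mapP[p /oS ps ->] /=; exact: ch.
- by move=> _ /mapP[p ps ->] /=; exists p.1.1, p.1.2.
have S'E x : stepfun S' x = (\1_D x : R)%:C%C * stepfun S x.
  rewrite /stepfun big_map mulr_sumr; apply: eq_big_seq => p /oS ps /=.
  by rewrite cD// rmorphM mulrCA.
have gSL := sqintB gL (sqint_stepfun S).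
rewrite (@mu_eq_nrm2_ae _ (fun x => (\1_D x : R)%:C%C * (g x - stepfun S x))).
- apply: le_trans S1; rewrite -lee_fin -!sqnormE//; last first.
    apply: (@mu_sqintM _ 1) => //; first exact: cmeasurable_indic.
    by move=> x; rewrite normc2_real indicE; case: (_ \in _); rewrite ?expr1n ?expr0n.
  apply: mu_le_sqnorm.
  + by apply: cmeasurableM; [exact: cmeasurable_indic|case: gSL].
  + by apply: measurable_normc2; case: gSL.
  + move=> x; rewrite normc2M normc2_real indicE.
    by case: (_ \in _); rewrite ?expr1n ?expr0n ?mul1r ?mul0r ?normc2_ge0.
- by apply: cmeasurableB; [case: gL|case: (sqint_stepfun S')].
- by apply: cmeasurableM; [exact: cmeasurable_indic|case: gSL].
- by apply: ae_imp gD => x gx; rewrite S'E mulrBr -gx.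
Qed.

Lemma ae_neq (x0 : R) : {ae mu, forall x, x != x0}.
Proof.
exists [set x0]; split; [exact: measurable_set1|exact: lebesgue_measure_set1|].
by move=> x /= /negP/negPn/eqP.
Qed.

End StepCut.

(** * The Fourier-Plancherel transform *)

Section FourierRelation.
Variable R : realType.
Local Notation mu := (@lebesgue_measure R).
Implicit Types (phi Phi : R -> R[i]).

(** The Fourier-Plancherel transform as a relation: it extends the map from the indicator of ]s, t]
    to [Eproc t] - [Eproc s], and Plancherel's constant 2 pi is that of the process [Eproc]. *)
Definition FT phi Phi := ointegral mu (@Eproc R) phi Phi.

Lemma sqint_Eproc : sqint_increments mu (@Eproc R).
Proof. by case: (orthogonal_process_Eproc R). Qed.

Lemma nrm2_FT phi Phi : FT phi Phi -> nrm2 mu Phi = 2 * pi * nrm2 mu phi.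
Proof. exact: (nrm2_ointegral (orthogonal_process_Eproc R)). Qed.

Lemma rip_FT phi Phi psi Psi : FT phi Phi -> FT psi Psi ->
  rip mu Phi Psi = 2 * pi * rip mu phi psi.
Proof. exact: (rip_ointegral (orthogonal_process_Eproc R)). Qed.

Lemma FT_unique phi Phi Phi' : FT phi Phi -> FT phi Phi' ->
  {ae mu, forall l, Phi l = Phi' l}.
Proof. exact: (ointegral_unique (orthogonal_process_Eproc R)). Qed.

Lemma FTB phi Phi psi Psi : FT phi Phi -> FT psi Psi ->
  FT (fun x => phi x - psi x) (fun x => Phi x - Psi x).
Proof. exact: (ointegralB sqint_Eproc). Qed.

Lemma FT_shift phi Phi (s : R) : FT phi Phi ->
  FT (fun t => phi (t - s)) (fun l => expi (- (l * s)) * Phi l).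
Proof.
move=> [pL PL a].
have ps := preserving_shift (- s).
have me : cmeasurable (fun l : R => expi (- (l * s)) : R[i]).
  apply: cmeasurable_expi; apply: measurableT_comp => //.
  exact: measurable_funM.
have e1 l : normc2 (expi (- (l * s)) : R[i]) <= 1 by rewrite normc2_expi.
split; [exact: (sqint_preserving ps pL)|exact: (mu_sqintM me e1 PL)|move=> e e0].
have [S [oS S1 S2]] := a _ e0.
pose S' := [seq ((p.1.1 + s, p.1.2 + s), p.2) | p <- S].
exists S'; split.
- by move=> _ /mapP[p /oS p1 ->] /=; rewrite lerD2r.
- have -> : (fun x => phi (x - s) - stepfun S' x) = fun x => (fun y => phi y - stepfun S y) (x - s).
    apply/funext => x; congr (_ - _); rewrite /stepfun big_map; apply: eq_bigr => p _.
    congr (_ * (_)%:C%C); rewrite !indicE !mem_setE !in_itv/=.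
    by rewrite ltrBrDr lerBlDr.
  have mf : cmeasurable (fun y => phi y - stepfun S y).
    by apply: cmeasurableB; [case: pL|case: (sqint_stepfun S)].
  by rewrite (@nrm2_preserving R _ _ ps mf).
have -> : (fun w => expi (- (w * s)) * Phi w - stepint (@Eproc R) S' w) =
    fun w => expi (- (w * s)) * (Phi w - stepint (@Eproc R) S w).
  apply/funext => l; rewrite mulrBr; congr (_ - _).
  rewrite /stepint big_map mulr_sumr; apply: eq_bigr => p _ /=.
  rewrite mulrCA; congr (_ * _); rewrite /Eproc -!mulrBl mulrA; congr (_ * _).
  by rewrite !mulrDr !opprD !expiD; ring.
rewrite (_ : nrm2 _ _ = nrm2 mu (fun w => Phi w - stepint (@Eproc R) S w))//.
rewrite /nrm2 /sqnorm; congr fine; apply: eq_integral => l _.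
by rewrite normc2M normc2_expi mul1r.
Qed.

Lemma unit_kernel_expi (s : R) : unit_kernel (fun l t => expi (s * (l * t)) : R[i]).
Proof.
split=> [l x|]; first exact: normc2_expi.
have mm : measurable_fun setT (fun p : R * R => s * (p.1 * p.2)).
  by apply: measurable_funM => //; apply: measurable_funM;
    [exact: measurable_fst|exact: measurable_snd].
by split; [apply: (measurableT_comp (@measurable_cosT R))|apply: (measurableT_comp (@measurable_sinT R))].
Qed.

Lemma unit_kernel_neg : unit_kernel (fun l t => expi (- (l * t)) : R[i]).
Proof.
have := unit_kernel_expi (-1).
by rewrite (_ : (fun l t => _) = fun l t => expi (- (l * t)))//; apply/funext => l; apply/funext => t; rewrite mulN1r.
Qed.

Lemma unit_kernel_pos : unit_kernel (fun l t => expi (l * t) : R[i]).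
Proof.
have := unit_kernel_expi 1.
by rewrite (_ : (fun l t => _) = fun l t => expi (l * t))//; apply/funext => l; apply/funext => t; rewrite mul1r.
Qed.

Lemma integral_derive_itv (f F : R -> R) (a b : R) : a <= b ->
  continuous f -> (forall x : R, is_derive x 1 F (f x)) ->
  Rintegral mu `]a, b] f = F b - F a.
Proof.
rewrite le_eqVlt => /predU1P[<- _ _|ab cf dF].
  by rewrite set_itvoc0 Rintegral_set0 subrr.
rewrite /Rintegral integral_itv_obnd_cbnd; last first.
  by apply: measurable_funTS; apply/measurable_EFinP; exact: continuous_meas.
have cF := is_derive_continuous dF.
rewrite (@continuous_FTC2 _ f F a b ab) ?EFinB//.
- exact: continuous_subspaceT.
- split.
  + by move=> x _; exact: ex_derive.
  + by apply: cvg_at_right_filter; exact: cF.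
  + by apply: cvg_at_left_filter; exact: cF.
- by move=> x _; rewrite derive1E derive_val.
Qed.

Lemma is_derive_sin_mul (l x : R) : is_derive x 1 (fun t => sin (l * t)) (l * cos (l * x)).
Proof. by apply: is_derive_eq; rewrite /GRing.scale /=; ring. Qed.

Lemma is_derive_cos_mul (l x : R) : is_derive x 1 (fun t => cos (l * t)) (- l * sin (l * x)).
Proof. by apply: is_derive_eq; rewrite /GRing.scale /=; ring. Qed.

Lemma integral_cos_itv (l a b : R) : l != 0 -> a <= b ->
  Rintegral mu `]a, b] (fun t => cos (l * t)) = (sin (l * b) - sin (l * a)) / l.
Proof.
move=> l0 ab; pose F t := l^-1 * sin (l * t).
have dF (x : R) : is_derive x 1 F (cos (l * x)).
  have ds := is_derive_sin_mul l x.
  by apply: is_derive_eq; rewrite /GRing.scale /=; field.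
rewrite (integral_derive_itv ab (is_derive_continuous (is_derive_cos_mul l)) dF).
by rewrite /F; field.
Qed.

Lemma integral_Nsin_itv (l a b : R) : l != 0 -> a <= b ->
  Rintegral mu `]a, b] (fun t => - sin (l * t)) = (cos (l * b) - cos (l * a)) / l.
Proof.
move=> l0 ab; pose F t := l^-1 * cos (l * t).
have dF (x : R) : is_derive x 1 F (- sin (l * x)).
  have ds := is_derive_cos_mul l x.
  by apply: is_derive_eq; rewrite /GRing.scale /=; field.
have cs : continuous (fun t => - sin (l * t)).
  by move=> x; apply: cvgN; exact: (is_derive_continuous (is_derive_sin_mul l)).
by rewrite (integral_derive_itv ab cs dF) /F; field.
Qed.

(** The value of [fourier_neg] at l is the inner product with this function, hence depends
    continuously on phi for each single frequency. *)
Definition hker (T l t : R) : R[i] := (\1_(`[0, T]%classic) t : R)%:C%C * expi (l * t).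

Lemma sqint_hker T l : square_integrable mu (hker T l).
Proof.
have me : cmeasurable (fun t : R => expi (l * t) : R[i]).
  by apply: cmeasurable_expi; exact: measurable_funM.
have e1 t : normc2 (expi (l * t) : R[i]) <= 1 by rewrite normc2_expi.
have iL : square_integrable mu (fun t => (\1_(`[0, T]%classic) t : R)%:C%C).
  split; first exact: cmeasurable_indic.
  rewrite /sqnorm; under eq_integral => x _.
    rewrite normc2_real (_ : _ ^+ 2 = \1_(`[0, T]%classic) x); last first.
      by rewrite indicE; case: (_ \in _); rewrite ?expr1n ?expr0n.
    over.
  rewrite [X in (X < _)%E](_ : _ = mu `[0, T]%classic); last first.
    by rewrite (@integral_indic _ _ _ mu setT measurableT _ (measurable_itv _)) setIT.
  by rewrite lebesgue_measure_itv/=; case: ifP => _; rewrite ?ltry// -EFinD ltry.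
have := mu_sqintM me e1 iL.
by under eq_fun do rewrite mulrC.
Qed.

Lemma nrm2_hker T l : nrm2 mu (hker T l) = nrm2 mu (hker T 0).
Proof.
rewrite /nrm2 /sqnorm; congr fine; apply: eq_integral => t _.
by rewrite /hker !normc2M !normc2_expi.
Qed.

Lemma fourier_neg_cip T phi l : fourier_neg T phi l = cip mu phi (hker T l).
Proof.
rewrite /fourier_neg /cintegral /cip /rip; apply: eq_ReIm => /=.
  rewrite Rintegral_mkcond; apply: eq_Rintegral => t _; rewrite patchE /hker indicE.
  rewrite (_ : point = 0 :> R)//.
  by case: (t \in _); rewrite /rdot /expi /= ?ReImE /= ?ReImE /= ?cosN ?sinN; ring.
rewrite Rintegral_mkcond; apply: eq_Rintegral => t _; rewrite patchE /hker indicE.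
rewrite (_ : point = 0 :> R)//.
by case: (t \in _); rewrite /rdot /expi /= ?ReImE /= ?ReImE /= ?cosN ?sinN; ring.
Qed.

Lemma cip_indic_hker T l a b : l != 0 -> 0 <= a -> a <= b -> b <= T ->
  cip mu (fun x => (\1_(`]a, b]%classic) x : R)%:C%C) (hker T l) =
  Eproc b l - Eproc a l.
Proof.
move=> l0 a0 ab bT.
have sub t : t \in `]a, b]%classic -> t \in `[0, T]%classic.
  rewrite !mem_setE !in_itv/= => /andP[ta tb].
  by rewrite (le_trans a0 (ltW ta)) (le_trans tb bT).
have E1 : rip mu (fun x => (\1_(`]a, b]%classic) x : R)%:C%C) (hker T l) =
   Rintegral mu `]a, b] (fun t => cos (l * t)).
  rewrite [RHS]Rintegral_mkcond; apply: eq_Rintegral => t _.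
  rewrite patchE /rdot /hker !indicE; have := sub t.
  rewrite (_ : point = 0 :> R)//.
  by case: (t \in `]a, b]%classic) => [/(_ isT) ->|_];
    rewrite /expi /= ?ReImE /= ?ReImE /= ?ReImE /=; ring.
have E2 : rip mu (fun x => (\1_(`]a, b]%classic) x : R)%:C%C) (fun t => 'i%C * hker T l t) =
   Rintegral mu `]a, b] (fun t => - sin (l * t)).
  rewrite [RHS]Rintegral_mkcond; apply: eq_Rintegral => t _.
  rewrite patchE /rdot /hker !indicE; have := sub t.
  rewrite (_ : point = 0 :> R)//.
  by case: (t \in `]a, b]%classic) => [/(_ isT) ->|_];
    rewrite /expi /= ?ReImE /= ?ReImE /= ?ReImE /=; ring.
rewrite /cip E1 E2 integral_cos_itv//.
rewrite integral_Nsin_itv//.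
have i0 : Complex 0 l != 0 by rewrite eq_complex /= eqxx (negbTE l0).
apply: (mulIf i0); rewrite /Eproc -mulrBl mulfVK//.
by apply: eq_ReIm; rewrite !ReImE /expi /= ?cosN ?sinN; field.
Qed.

Lemma cmeasurable_fourier_neg T phi : square_integrable mu phi ->
  cmeasurable (fourier_neg T phi).
Proof.
move=> [mphi _].
have [m1 m2] := cmeasurableM (cmeasurable_snd R mphi) (proj2 unit_kernel_neg).
by split; apply: measurable_parameter_integral.
Qed.

End FourierRelation.

Section FourierTransform.
Variable R : realType.
Local Notation mu := (@lebesgue_measure R).
Implicit Types (phi Phi : R -> R[i]) (T : R).

Lemma fourier_neg_step T S l : l != 0 ->
  (forall p, p \in S -> [/\ 0 <= p.1.1, p.1.1 <= p.1.2 & p.1.2 <= T]) ->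
  fourier_neg T (stepfun S) l = stepint (@Eproc R) S l.
Proof.
move=> l0 hS; rewrite fourier_neg_cip /stepfun cip_suml; last 2 first.
- by move=> p; apply: sqintZ; exact: sqint_indic_itv.
- exact: sqint_hker.
apply: eq_big_seq => p /hS[h1 h2 h3].
rewrite cipZl; [|exact: sqint_indic_itv|exact: sqint_hker].
by rewrite cip_indic_hker.
Qed.

Lemma cconv_bound (z_ : nat -> R[i]) z K : 
  (forall k, normc2 (z - z_ k) <= K / k.+1%:R) -> cconv z_ z.
Proof.
move=> zK.
have c (u : nat -> R) r : (forall k, (r - u k) ^+ 2 <= K / k.+1%:R) -> u @ \oo --> r.
  move=> h; apply/cvgrPdist_le => e e0.
  have : (fun k : nat => K / k.+1%:R) @ \oo --> (0 : R).
    rewrite -[X in _ --> X](mulr0 K); apply: cvgM; first exact: cvg_cst.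
    exact: cvg_harmonic.
  have e2 : 0 < e ^+ 2 by rewrite exprn_gt0.
  move=> /cvgr0_norm_le/(_ _ e2); apply: filterS => k hk.
  rewrite -(@ler_pXn2r _ 2)// ?nnegrE ?(ltW e0)// -normrX ger0_norm ?sqr_ge0//.
  exact: le_trans (le_trans (h k) (ler_norm _)) hk.
split; apply: c => k; apply: le_trans (zK k).
  by rewrite -Re_opp -Re_add sqr_Re_le.
by rewrite -Im_opp -Im_add sqr_Im_le.
Qed.

(** The integral formula and the relation [FT] agree on step functions. For step functions tending
    to phi the transforms converge uniformly in l, because all [hker T l] have the same norm, and
    they are close to each other in L_2 by the isometry; Fatou's lemma identifies the two limits. *)
Lemma FT_segment T phi : 0 <= T -> L2_segment T phi -> FT phi (fourier_neg T phi).
Proof.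
move=> T0 [pL pT].
pose c x := Num.max 0 (Num.min x T).
have ch a b : a <= b -> c a <= c b.
  by move=> ab; rewrite /c; case: (leP a T) => h1; case: (leP b T) => h2;
    rewrite !ge_max !le_max; lra.
have c0 x : 0 <= c x by rewrite le_max lexx.
have cT x : c x <= T by rewrite ge_max T0 ge_min lexx orbT.
have cD a b x : a <= b -> \1_(`]c a, c b]%classic) x =
    \1_(`]0, T]%classic) x * \1_(`]a, b]%classic) x :> R.
  move=> ab; rewrite !indicE !mem_setE !in_itv/=.
  rewrite /c gt_max le_max gt_min le_min.
  by case: (ltP 0 x) => h1; case: (leP x T) => h2; case: (ltP a x) => h3;
    case: (leP x b) => h4; case: (ltP T x) => h5; case: (leP x 0) => h6; rewrite /= ?mulr1 ?mulr0//; lra.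
have pD : {ae mu, forall x, phi x = (\1_(`]0, T]%classic) x : R)%:C%C * phi x}.
  apply: ae_imp (ae_neq (0 : R)) => x x0.
  rewrite indicE mem_setE in_itv/=.
  have [|h] := boolP (0 < x <= T); first by rewrite mul1r.
  rewrite pT ?mulr0//; apply: contra h => /andP[x1 ->].
  by rewrite lt_neqAle eq_sym x0 x1.
have step e : 0 < e -> exists S, [/\ ordered S,
    forall p, p \in S -> [/\ 0 <= p.1.1, p.1.1 <= p.1.2 & p.1.2 <= T] &
    nrm2 mu (fun x => phi x - stepfun S x) <= e].
  move=> /(step_dense_on (measurable_itv `]0, T]) ch cD pL pD)[S [oS hS Se]].
  exists S; split=> // p pS; have [a [b E]] := hS p pS.
  by split; [rewrite E /= c0|exact: oS|rewrite E /= cT].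
have LE := @sqint_Eproc R; have O := orthogonal_process_Eproc R.
have p2 : 0 <= 2 * pi :> R by rewrite mulr_ge0// pi_ge0.
have mF := cmeasurable_fourier_neg T pL.
pose K := nrm2 mu (hker T 0).
have K0 : 0 <= K by exact: nrm2_ge0.
have unif S l : l != 0 ->
    (forall p, p \in S -> [/\ 0 <= p.1.1, p.1.1 <= p.1.2 & p.1.2 <= T]) ->
    normc2 (fourier_neg T phi l - stepint (@Eproc R) S l) <=
    2 * (nrm2 mu (fun x => phi x - stepfun S x) * K).
  move=> l0 hS; rewrite -(fourier_neg_step l0 hS) !fourier_neg_cip.
  rewrite -cipBl//; try exact: sqint_hker; try exact: sqint_stepfun.
  rewrite /K -(nrm2_hker T l); apply: normc2_cip_le; last exact: sqint_hker.
  by apply: sqintB => //; exact: sqint_stepfun.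
have /choice[S_ hS_] (k : nat) : exists S, [/\ ordered S,
    forall p, p \in S -> [/\ 0 <= p.1.1, p.1.1 <= p.1.2 & p.1.2 <= T] &
    nrm2 mu (fun x => phi x - stepfun S x) <= (k.+1%:R)^-1].
  by apply: step; rewrite invr_gt0.
have conv : {ae mu, forall l, cconv (fun k => stepint (@Eproc R) (S_ k) l) (fourier_neg T phi l)}.
  apply: ae_imp (ae_neq (0 : R)) => l l0.
  apply: (@cconv_bound _ _ (2 * K)) => k; have [_ h1 h2] := hS_ k.
  apply: le_trans (unif _ _ l0 h1) _.
  by rewrite (mulrC _ K) mulrA ler_wpM2l// mulr_ge0.
have near_S e : 0 < e -> exists S, ordered S /\
    nrm2 mu (fun x => phi x - stepfun S x) <= e /\
    square_integrable mu (fun l => fourier_neg T phi l - stepint (@Eproc R) S l) /\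
    nrm2 mu (fun l => fourier_neg T phi l - stepint (@Eproc R) S l) <= 2 * pi * (2 * e + 2 * e).
  move=> e0; have [S [oS hS Se]] := step _ e0; exists S; split=> //; split=> //.
  have [N Ne] : exists N : nat, (N.+1%:R)^-1 <= e.
    exists (Num.Def.archi_bound e^-1); rewrite invf_ple ?posrE//.
    by apply: ltW; apply: lt_le_trans (archi_boundP _) _; rewrite ?invr_ge0 ?(ltW e0)// ler_nat.
  (* The sequence starts at N, from where all of its terms are within e of phi, so the isometry
     bounds every difference uniformly. *)
  apply: (@nrm2_fatou _ _ _ mu (fun k l => stepint (@Eproc R) (S_ (k + N)%N) l - stepint (@Eproc R) S l)).
  - by move=> k; apply: sqintB; exact: sqint_stepint.
  - by apply: cmeasurableB => //; case: (sqint_stepint S LE).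
  - apply: ae_imp conv => l [f1 f2]; apply: cconvB; last exact: cconv_cst.
    by split; [rewrite -(cvg_shiftn N) in f1|rewrite -(cvg_shiftn N) in f2].
  - move=> k; have [oSk _ hk] := hS_ (k + N)%N.
    rewrite (nrm2_ointegral O (ointegralB LE (ointegral_step LE oSk) (ointegral_step LE oS))).
    apply: ler_wpM2l => //; apply: le_trans (nrm2_triangle (sqint_stepfun _) pL (sqint_stepfun _)) _.
    rewrite nrm2BC; apply: lerD; apply: ler_wpM2l => //.
    apply: le_trans hk (le_trans _ Ne); rewrite lef_pV2 ?posrE// ler_nat ltnS.
    exact: leq_addl.
have FL : square_integrable mu (fourier_neg T phi).
  have [S [_ [_ [h _]]]] := near_S 1 ltr01.
  by have := sqintD h (sqint_stepint S LE); under eq_fun do rewrite subrK.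
split=> // e e0.
(* 8 pi is the factor 2 pi (2 + 2) lost above; the added 1 also makes the chosen tolerance at most
   e. *)
have p8 : 0 < 8 * pi + 1 :> R by rewrite ltr_wpDl// mulr_ge0// pi_ge0.
have ep : 0 < e / (8 * pi + 1) by rewrite divr_gt0.
have [S [oS [h1 [_ h2]]]] := near_S _ ep.
have pp : 0 <= pi :> R by exact: pi_ge0.
exists S; split=> //.
  apply: le_trans h1 _; rewrite ler_pdivrMr//; nra.
apply: le_trans h2 _.
rewrite (_ : 2 * pi * _ = (8 * pi) * (e / (8 * pi + 1))); last by ring.
rewrite mulrA ler_pdivrMr//; nra.
Qed.

End FourierTransform.

(** * The transform on the half-line *)

Section FourierHalfline.
Variable R : realType.
Local Notation mu := (@lebesgue_measure R).
Implicit Types (phi Phi : R -> R[i]) (T : R).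

Definition cut T phi (t : R) : R[i] := (\1_(`[0, T]%classic) t : R)%:C%C * phi t.

Lemma normc2_indic_le (A : set R) (x : R) : normc2 ((\1_A x : R)%:C%C) <= 1.
Proof. by rewrite normc2_real indicE; case: (_ \in _); rewrite ?expr1n ?expr0n. Qed.

Lemma L2_segment_cut T phi : square_integrable mu phi -> L2_segment T (cut T phi).
Proof.
move=> pL; split.
  apply: (@mu_sqintM _ _ 1) => //; first exact: cmeasurable_indic.
  exact: normc2_indic_le.
by move=> t nt; rewrite /cut indicE mem_setE in_itv/= (negbTE nt) mul0r.
Qed.

Lemma eq_fourier_neg T phi phi' : (forall t, 0 <= t <= T -> phi t = phi' t) ->
  fourier_neg T phi = fourier_neg T phi'.
Proof.
move=> h; apply/funext => l; rewrite /fourier_neg /cintegral; congr Complex;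
  by apply: eq_Rintegral => t; rewrite inE/= in_itv/= => /h ->.
Qed.

Lemma fourier_neg_cut T phi : fourier_neg T (cut T phi) = fourier_neg T phi.
Proof.
by apply: eq_fourier_neg => t tT; rewrite /cut indicE mem_setE in_itv/= tT mul1r.
Qed.

Lemma cut_approx phi : L2_halfline phi -> forall e, 0 < e ->
  exists N : nat, forall k, (N <= k)%N -> nrm2 mu (fun x => phi x - cut k%:R phi x) <= e.
Proof.
move=> [pL p0] e e0.
have mc (k : nat) : cmeasurable (cut k%:R phi).
  by case: (L2_segment_cut k%:R pL) => [[]].
have cc x : cconv (fun k : nat => cut k%:R phi x) (phi x).
  have near1 : \forall k \near \oo, cut k%:R phi x = phi x.
    exists (Num.Def.archi_bound `|x|) => // k /= kx.
    have [x0|x0] := ltP x 0; first by rewrite /cut p0// mulr0.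
    rewrite /cut indicE mem_setE in_itv/= x0 (_ : x <= k%:R) ?mul1r//.
    apply: le_trans (ler_norm _) (ltW (lt_le_trans (archi_boundP (normr_ge0 x)) _)).
    by rewrite ler_nat.
  by split; apply: cvg_near_cst; apply: filterS near1 => k ->.
have b (k : nat) x : normc2 (phi x - cut k%:R phi x) <= normc2 (phi x).
  rewrite /cut indicE; case: (_ \in _); rewrite ?mul1r ?subrr ?mul0r ?subr0//.
  by rewrite normc2_0 normc2_ge0.
have [N hN] := @nrm2_dominated _ _ _ mu (fun k => cut k%:R phi) phi phi mc (proj1 pL) pL cc b e e0.
by exists N => k /hN[].
Qed.

Lemma is_fourier_FT phi Phi : L2_halfline phi -> is_fourier phi Phi -> FT phi Phi.
Proof.
move=> ph [PL c]; have [pL p0] := ph.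
apply: ointegral_lim => //; first exact: sqint_Eproc.
move=> e e0; have [N hN] := cut_approx ph e0.
have FL (k : nat) : FT (cut k%:R phi) (fourier_neg k%:R phi).
  by rewrite -fourier_neg_cut; apply: FT_segment; [exact: ler0n|exact: L2_segment_cut].
have SL (k : nat) : square_integrable mu (fun l => Phi l - fourier_neg k%:R phi l).
  by apply: sqintB => //; case: (FL k).
have c' : (fun k : nat => nrm2 mu (fun l => Phi l - fourier_neg k%:R phi l)) @ \oo --> (0 : R).
  exact: (fine_cvg c).
move: c' => /cvgr0_norm_le/(_ _ e0)[M _ hM].
exists (cut (N + M)%:R phi), (fourier_neg (N + M)%:R phi); split.
- exact: FL.
- by apply: hN; exact: leq_addr.
- by apply: le_trans (ler_norm _) (hM _ _); rewrite /= leq_addl.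
Qed.

(** Transforms of the truncations form a Cauchy sequence by the isometry, and L_2 is complete. *)
Lemma fourier_exists phi : L2_halfline phi -> exists Phi, is_fourier phi Phi.
Proof.
move=> ph; have [pL p0] := ph.
have FL (k : nat) : FT (cut k%:R phi) (fourier_neg k%:R phi).
  by rewrite -fourier_neg_cut; apply: FT_segment; [exact: ler0n|exact: L2_segment_cut].
have SL (k : nat) : square_integrable mu (fourier_neg k%:R phi) by case: (FL k).
have CL (k : nat) : square_integrable mu (cut k%:R phi) by case: (FL k).
have [|Phi [PL hP]] := @square_integrable_complete _ _ _ mu (fun k => fourier_neg k%:R phi) SL.
  move=> e e0.
  have p8 : 0 < 8 * pi + 1 :> R by rewrite ltr_wpDl// mulr_ge0// pi_ge0.
  have ep : 0 < e / (8 * pi + 1) by rewrite divr_gt0.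
  have [N hN] := cut_approx ph ep; exists N => k l Nk Nl.
  rewrite (nrm2_FT (FTB (FL k) (FL l))).
  apply: (@le_trans _ _ (2 * pi * (4 * (e / (8 * pi + 1))))).
    apply: ler_wpM2l; first by rewrite mulr_ge0// pi_ge0.
    apply: le_trans (nrm2_triangle (CL k) pL (CL l)) _; rewrite nrm2BC.
    have := hN _ Nk; have := hN _ Nl; lra.
  have pp : 0 <= pi :> R by exact: pi_ge0.
  rewrite (_ : 2 * pi * _ = (8 * pi) * (e / (8 * pi + 1))); last by ring.
  rewrite mulrA ler_pdivrMr//; nra.
exists Phi; split=> //.
rewrite (_ : (fun N : nat => _) = EFin \o (fun N : nat => nrm2 mu (fun l => Phi l - fourier_neg N%:R phi l))); last first.
  by apply/funext => k; rewrite /= -sqnormE//; apply: sqintB.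
apply: cvg_EFin; first exact: nearW.
apply/cvgr0Pnorm_le => e e0; have [N hN] := hP _ e0; exists N => // k /= Nk.
by rewrite ger0_norm ?nrm2_ge0// nrm2BC; exact: hN.
Qed.

(** Existence guarantees that [xget] picks an actual transform and not its default value. *)
Lemma FT_fourier phi : L2_halfline phi -> FT phi (fourier phi).
Proof.
move=> ph; apply: is_fourier_FT => //.
have [Phi hP] := fourier_exists ph.
by rewrite /fourier; case: xgetP => // h; case: (h Phi).
Qed.

Lemma L2_segment_halfline T phi : L2_segment T phi -> L2_halfline phi.
Proof.
by move=> [pL p0]; split=> // t t0; apply: p0; rewrite negb_and -!ltNge t0.
Qed.

Lemma fourier_segment T phi : 0 <= T -> L2_segment T phi ->
  {ae mu, forall l, fourier phi l = fourier_neg T phi l}.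
Proof.
move=> T0 ps; apply: FT_unique (FT_fourier (L2_segment_halfline ps)) _.
exact: FT_segment.
Qed.

Lemma L2_halfline0 : L2_halfline (fun _ : R => 0 : R[i]).
Proof. by split=> //; exact: sqint0. Qed.

(** Only almost everywhere, since [fourier] picks some representative of the class of the zero
    function. *)
Lemma fourier0 : {ae mu, forall l, fourier (fun _ : R => 0 : R[i]) l = 0}.
Proof.
have h := FT_fourier L2_halfline0.
apply: nrm2_eq0; first by case: h.
by rewrite (nrm2_FT h) nrm2_rip rip0l mulr0.
Qed.

Lemma FT_reflect phi Phi : FT phi Phi -> FT (fun t => phi (- t)) (fun l => Phi (- l)).
Proof.
move=> [pL PL a]; have po := preserving_opp R.
split; [exact: (sqint_preserving po pL)|exact: (sqint_preserving po PL)|move=> e e0].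
have [S [oS S1 S2]] := a _ e0.
pose r S := [seq ((- p.1.2, - p.1.1), p.2) | p <- S : seq (R * R * R[i])].
(* The reflection of ]s, t] is closed on the other side, so equality fails at finitely many
   endpoints. *)
have rE S0 : {ae mu, forall x, stepfun S0 (- x) = stepfun (r S0) x}.
  elim: S0 => [|p S0 ih].
    by apply: aeW => x; rewrite /stepfun !big_nil.
  have ab := ae_imp2 (fun x h1 h2 => conj h1 h2) (ae_neq (- p.1.1)) (ae_neq (- p.1.2)).
  apply: ae_imp2 ih ab => x E [n1 n2].
  rewrite /stepfun /r /= !big_cons -/(stepfun _ _) -/(r S0) E; congr (_ * (_)%:C%C + _).
  rewrite !indicE !mem_setE !in_itv/=; congr (_%:R).
  by rewrite ltrNr lerNl andbC !lt_neqAle n1 (eq_sym (- p.1.2)) n2.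
exists (r S); split.
- by move=> _ /mapP[p /oS p1 ->] /=; rewrite lerN2.
- rewrite (@mu_eq_nrm2_ae _ _ (fun t => phi (- t) - stepfun S (- t))).
  + by rewrite (@nrm2_preserving R _ (fun t => phi t - stepfun S t) po)//;
      apply: cmeasurableB; [case: pL|case: (sqint_stepfun S)].
  + by apply: cmeasurableB; [case: (sqint_preserving po pL)|case: (sqint_stepfun (r S))].
  + by apply: cmeasurableB; [case: (sqint_preserving po pL)|case: (sqint_preserving po (sqint_stepfun S))].
  + by apply: ae_imp (rE S) => x ->.
- rewrite (_ : (fun l => _) = fun l => (Phi (- l) - stepint (@Eproc R) S (- l))).
    rewrite (@nrm2_preserving R _ (fun t => Phi t - stepint (@Eproc R) S t) po)//.
    by apply: cmeasurableB; [case: PL|case: (sqint_stepint S (@sqint_Eproc R))].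
  apply/funext => l; congr (_ - _); rewrite /stepint big_map; apply: eq_bigr => p _ /=.
  congr (_ * _); rewrite /Eproc -!mulrBl.
  have -> : Complex 0 (- l) = - Complex 0 l by apply: eq_ReIm; rewrite !ReImE /= ?oppr0.
  have e1 (z : R) : - (l * - z) = l * z by ring.
  have e2 (z : R) : - (- l * z) = l * z by ring.
  by rewrite !e1 !e2 invrN; ring.
Qed.

Lemma fourier_pos_neg T g l : fourier_pos T g l = fourier_neg T g (- l).
Proof.
by rewrite /fourier_pos /fourier_neg; congr cintegral; apply/funext => t; rewrite mulNr opprK.
Qed.

Lemma FT_fourier_pos T g : 0 <= T -> L2_segment T g ->
  FT (fun t => g (- t)) (fourier_pos T g).
Proof.
move=> T0 gs; rewrite (_ : fourier_pos T g = fun l => fourier_neg T g (- l)).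
  by apply: FT_reflect; exact: FT_segment.
by apply/funext => l; exact: fourier_pos_neg.
Qed.

End FourierHalfline.

(** * The Hardy class *)

Section HardyClass.
Variable R : realType.
Local Notation mu := (@lebesgue_measure R).
Implicit Types (F G phi Phi : R -> R[i]).

(* Transforms of functions carried by the half-line [t >= 0], characterised by orthogonality to the transforms of functions carried by [t <= 0]. *)
Definition hardy F := square_integrable mu F /\
  forall g G, FT g G -> (forall t, 0 < t -> g t = 0) -> rip mu F G = 0.

Lemma hardy_FT phi Phi : FT phi Phi -> (forall t, t < 0 -> phi t = 0) -> hardy Phi.
Proof.
move=> h p0; have [pL PL _] := h; split=> // g G hg g0.
have [gL _ _] := hg.
rewrite (rip_FT h hg) (_ : rip mu phi g = 0) ?mulr0//.
rewrite (_ : 0 = rip mu (fun=> 0) g); last by rewrite rip0l.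
rewrite /rip /Rintegral; congr fine; apply: ae_eq_integral => //.
- exact: measurable_int (integrable_rdot pL gL).
- exact: measurable_int (integrable_rdot (sqint0 mu) gL).
- apply: ae_imp (ae_neq (0 : R)) => t t0 _ /=; congr (_%:E).
  have [t1|t1] := ltP t 0; first by rewrite p0.
  by rewrite g0 /rdot /= ?mulr0// lt_neqAle eq_sym t0.
Qed.

Lemma hardyD F G : hardy F -> hardy G -> hardy (fun l => F l + G l).
Proof.
move=> [FL h1] [GL h2]; split; first exact: sqintD.
by move=> g H hg g0; have [_ HL _] := hg; rewrite ripDl// (h1 g)// (h2 g)// addr0.
Qed.

(** The test functions admit complex scalars. This is why a condition on the real inner product
    alone defines a complex subspace. *)
Lemma hardyZ c F : hardy F -> hardy (fun l => c * F l).
Proof.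
move=> [FL h1]; split; first exact: sqintZ.
move=> g H hg g0; rewrite ripMl; apply: (h1 (fun t => conjc c * g t)).
  exact: (ointegralZ (conjc c) (@sqint_Eproc R) hg).
by move=> t /g0 ->; rewrite mulr0.
Qed.

Lemma hardyB F G : hardy F -> hardy G -> hardy (fun l => F l - G l).
Proof.
by move=> h1 /(hardyZ (-1)) h2; have := hardyD h1 h2; under eq_fun do rewrite mulN1r.
Qed.

Lemma hardy_sum (I : Type) (s : seq I) (H : I -> R -> R[i]) :
  (forall i, hardy (H i)) -> hardy (fun l => \sum_(i <- s) H i l).
Proof.
move=> hH; elim: s => [|i s ih].
  under eq_fun do rewrite big_nil; split; first exact: sqint0.
  by move=> g G _ _; rewrite rip0l.
by under eq_fun do rewrite big_cons; exact: hardyD.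
Qed.

Lemma hardy_ae F F' : hardy F -> cmeasurable F' -> {ae mu, forall l, F l = F' l} ->
  hardy F'.
Proof.
move=> [FL h] mF' FF'; have FL' := @sqint_ae _ _ _ mu _ _ mF' FL FF'.
split=> // g G hg g0; have [_ GL _] := hg.
by rewrite -(@eq_rip_ae _ _ _ mu F F')//; exact: (h g).
Qed.

Lemma hardy_lim F : square_integrable mu F ->
  (forall e, 0 < e -> exists F', hardy F' /\ nrm2 mu (fun l => F l - F' l) <= e) ->
  hardy F.
Proof.
move=> FL h; split=> // g G hg g0; have [_ GL _] := hg.
apply/eqP; rewrite -sqrf_eq0 eq_le sqr_ge0 andbT; apply/ler_addgt0Pr => e e0.
have K0 : 0 < nrm2 mu G + 1 by rewrite ltr_wpDl// nrm2_ge0.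
have eK : 0 < e / (nrm2 mu G + 1) by rewrite divr_gt0.
have [F' [[FL' h'] FF']] := h _ eK.
have E : rip mu F G = rip mu (fun l => F l - F' l) G by rewrite ripBl// (h' g)// subr0.
rewrite add0r E; apply: le_trans (cauchy_schwarz (sqintB FL FL') GL) _.
apply: (@le_trans _ _ (e / (nrm2 mu G + 1) * nrm2 mu G)).
  by apply: ler_wpM2r => //; exact: nrm2_ge0.
rewrite mulrAC ler_pdivrMr//; apply: ler_wpM2l; first exact: ltW.
by rewrite lerDl.
Qed.

Lemma cmeasurable_expi_mul (s : R) : cmeasurable (fun l : R => expi (- (l * s)) : R[i]).
Proof.
apply: cmeasurable_expi; apply: measurableT_comp => //.
exact: measurable_funM.
Qed.

Lemma sqint_expi (s : R) F : square_integrable mu F ->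
  square_integrable mu (fun l => expi (- (l * s)) * F l).
Proof.
apply: (@mu_sqintM _ _ 1); first exact: cmeasurable_expi_mul.
by move=> l; rewrite normc2_expi.
Qed.

(** The delay by s moves to the test function and shifts it further into the past. *)
Lemma hardy_shift (s : R) F : 0 <= s -> hardy F ->
  hardy (fun l => expi (- (l * s)) * F l).
Proof.
move=> s0 [FL h]; split; first exact: sqint_expi.
move=> g G hg g0; rewrite ripMl.
apply: (h (fun t => g (t - (- s)))).
  have := FT_shift (- s) hg.
  rewrite (_ : (fun l => _ * G l) = fun x => conjc (expi (- (x * s))) * G x)//.
  by apply/funext => l; rewrite -expiN mulrN opprK.
by move=> t t0; apply: g0; rewrite opprK ltr_wpDr.
Qed.

Lemma hardy_multiplier (D : set R) (beta : R -> R[i]) F : measurable D ->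
  (forall x, D x -> 0 <= x) -> cmeasurable beta -> cintegrable mu D beta -> hardy F ->
  hardy (fun l => multiplier D (fun l t => expi (- (l * t))) beta l * F l).
Proof.
move=> mD D0 mb ib hF; have [FL h] := hF.
have U := unit_kernel_neg R.
split; first exact: sqint_multiplier.
move=> g G hg g0; have [_ GL _] := hg; rewrite rip_multiplier//.
rewrite (@eq_Rintegral _ _ _ mu D (fun=> 0)); first by rewrite /Rintegral integral0.
move=> x; rewrite inE => Dx; have [_ hs] := hardyZ (beta x) (hardy_shift (D0 _ Dx) hF).
exact: (hs g).
Qed.

Lemma Eproc0 (l : R) : Eproc 0 l = 0.
Proof. by rewrite /Eproc mulr0 oppr0 expi0 subrr mul0r. Qed.

(** Off l = 0, [Eproc s] is the multiplier of the indicator of ]0, s], an average of delays. *)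
Lemma hardy_Eproc (s : R) F : 0 <= s -> hardy F -> hardy (fun l => Eproc s l * F l).
Proof.
move=> s0 hF; pose S : seq (R * R * R[i]) := [:: (0, s, 1)].
pose I := `[0, s]%classic.
have SL := sqint_stepfun S.
have SE x : stepfun S x = (\1_(`]0, s]%classic) x : R)%:C%C.
  by rewrite /stepfun big_seq1 mul1r.
have ib : cintegrable mu I (stepfun S).
  have i1 : mu.-integrable I (EFin \o (fun x => \1_(`]0, s]%classic) x : R)).
    apply: (@integrableS _ _ _ mu setT) => //; first exact: measurable_itv.
    have := integrable_normc2 (sqint_indic_itv 0 s).
    rewrite (_ : (fun x => normc2 _) = (\1_(`]0, s]%classic) : R -> R))//.
    apply/funext => x; rewrite normc2_real indicE.
    by case: (_ \in _); rewrite ?expr1n ?expr0n.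
  split.
    rewrite (_ : (fun x => _) = EFin \o (fun x => \1_(`]0, s]%classic) x : R))//.
    by apply/funext => x; rewrite SE.
  rewrite (_ : (fun x => _) = cst 0%E); first exact: integrable0.
  by apply/funext => x; rewrite SE.
have h := @hardy_multiplier I (stepfun S) F (measurable_itv _) _ (proj1 SL) ib hF.
have {}h := h (fun x => ltac:(by rewrite /I /= in_itv/= => /andP[])).
apply: hardy_ae h _ _.
  by apply: cmeasurableM; [exact: cmeasurable_Eproc|case: hF => [[]]].
apply: ae_imp (ae_neq (0 : R)) => l l0; congr (_ * _).
transitivity (fourier_neg s (stepfun S) l); first by [].
rewrite fourier_neg_step//.
  by rewrite /stepint big_seq1 /= Eproc0 subr0 mul1r.
by move=> p; rewrite inE => /eqP -> /=.
Qed.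

(** As (1 + i l) / (i l) = 1 + 1 / (i l), chi is a power of a difference plus an integration over
    [0, s]. In this form the pole at zero frequency is gone and both boundedness and causality are
    visible. *)
Lemma chiE n (s l : R) : chi n s l = (1 - expi (- (l * s)) + Eproc s l) ^+ n.
Proof.
rewrite /chi -exprVn -!exprMn; congr (_ ^+ n); rewrite /Eproc.
have [->|l0] := eqVneq l 0; first by rewrite mul0r oppr0 expi0 subrr !mul0r addr0.
have i0 : Complex 0 l != 0 by rewrite eq_complex /= eqxx (negbTE l0).
have -> : Complex 1 l = 1 + Complex 0 l by apply: eq_ReIm; rewrite !ReImE /= ?addr0 ?add0r.
by field.
Qed.

Lemma hardy_chi n (s : R) F : 0 <= s -> hardy F -> hardy (fun l => chi n s l * F l).
Proof.
move=> s0 hF; rewrite (_ : (fun l => _) =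
  fun l => (1 - expi (- (l * s)) + Eproc s l) ^+ n * F l); last first.
  by apply/funext => l; rewrite chiE.
elim: n => [|n ih].
  by under eq_fun do rewrite expr0 mul1r.
have h := hardyD (hardyB ih (hardy_shift s0 ih)) (hardy_Eproc s0 ih).
rewrite (_ : (fun l => _) = fun l => (1 - expi (- (l * s)) + Eproc s l) ^+ n * F l -
  expi (- (l * s)) * ((1 - expi (- (l * s)) + Eproc s l) ^+ n * F l) +
  Eproc s l * ((1 - expi (- (l * s)) + Eproc s l) ^+ n * F l))//.
by apply/funext => l; rewrite exprS; ring.
Qed.

End HardyClass.

(** * The operator D A as a truncated correlation *)

Section Correlation.
Variable R : realType.
Local Notation mu := (@lebesgue_measure R).
Implicit Types (b c psi Psi g G : R -> R[i]) (s t x : R).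

Definition tail s c x : R[i] := (\1_(`[s, +oo[%classic) x : R)%:C%C * c x.

(** The weighted hypothesis on [Da] controls its square only away from 0, so square integrability is
    asked of the tails alone. *)
Definition good_kernel c :=
  cmeasurable c /\ forall s, 0 < s -> square_integrable mu (tail s c).

(** The conjugation cancels the one in [cip]: this is the bilinear integral of c(x) psi(x - s) over
    x >= s. *)
Definition correlation c psi s : R[i] :=
  cip mu (tail s c) (fun x => conjc (psi (x - s))).

Lemma cmeasurable_shift c s : cmeasurable c -> cmeasurable (fun x => c (x - s)).
Proof. exact: (cmeasurable_preserving (preserving_shift (- s))). Qed.

Lemma sqint_shift psi s : square_integrable mu psi ->
  square_integrable mu (fun x => psi (x - s)).
Proof. exact: (sqint_preserving (preserving_shift (- s))). Qed.

Lemma nrm2_shift psi s : cmeasurable psi -> nrm2 mu (fun x => psi (x - s)) = nrm2 mu psi.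
Proof. exact: (nrm2_preserving (preserving_shift (- s))). Qed.

Lemma sqint_conj psi : square_integrable mu psi -> square_integrable mu (fun x => conjc (psi x)).
Proof.
move=> [m1 h]; split; first exact: cmeasurable_conj.
by rewrite /sqnorm; under eq_integral do rewrite normc2_conj.
Qed.

Lemma nrm2_conj psi : nrm2 mu (fun x => conjc (psi x)) = nrm2 mu psi.
Proof. by rewrite /nrm2 /sqnorm; under eq_integral do rewrite normc2_conj. Qed.

Lemma sqint_conj_shift psi s : square_integrable mu psi ->
  square_integrable mu (fun x => conjc (psi (x - s))).
Proof. by move=> pL; apply: (sqint_conj (sqint_shift s pL)). Qed.

Lemma rdot_cip f h (w : R[i]) : square_integrable mu f -> square_integrable mu h ->
  rdot (cip mu f h) w = rip mu f (fun x => w * h x).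
Proof.
by move=> fL hL; rewrite ripC ripZl// !(ripC _ _ f) /rdot /cip /= mulrC; ring.
Qed.

Lemma correlation_bound c psi s : 0 < s -> good_kernel c -> square_integrable mu psi ->
  normc2 (correlation c psi s) <= 2 * nrm2 mu psi * nrm2 mu (tail s c).
Proof.
move=> s0 [mc /(_ _ s0) cL] pL.
have := normc2_cip_le cL (sqint_conj_shift s pL).
rewrite nrm2_conj nrm2_shift; first by rewrite mulrAC mulrA.
by case: pL.
Qed.

Lemma measurable_ge_indic d (U : measurableType d) (f g : U -> R) :
  measurable_fun setT f -> measurable_fun setT g ->
  measurable_fun setT (fun p => \1_(`[f p, +oo[%classic) (g p) : R).
Proof.
move=> mf mg; rewrite (_ : (fun p => _) = fun p => (f p <= g p)%R%:R).
  apply: (@measurableT_comp _ _ _ _ _ _ (fun b : bool => b%:R : R)) => //.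
  exact: measurable_fun_ler.
by apply/funext => p; rewrite indicE mem_setE in_itv/= andbT.
Qed.

Lemma cmeasurable_diff psi : cmeasurable psi ->
  cmeasurable (fun p : R * R => psi (p.2 - p.1)).
Proof.
have md : measurable_fun setT (fun p : R * R => p.2 - p.1).
  by apply: measurable_funB; [exact: measurable_snd|exact: measurable_fst].
by move=> [m1 m2]; split; [apply: (measurableT_comp m1 md)|apply: (measurableT_comp m2 md)].
Qed.

Lemma cmeasurable_correlation c psi : cmeasurable c -> cmeasurable psi ->
  cmeasurable (correlation c psi).
Proof.
move=> mc mp.
have mt : cmeasurable (fun p : R * R => tail p.1 c p.2).
  apply: cmeasurableM; last exact: (cmeasurable_snd R mc).
  by apply: cmeasurable_real; apply: measurable_ge_indic; [exact: measurable_fst|exact: measurable_snd].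
have mpp := cmeasurable_conj (cmeasurable_diff mp).
split; rewrite /correlation /cip /rip /=.
  apply: (@measurable_parameter_integral R (fun s x => rdot (tail s c x) (conjc (psi (x - s)))) setT) => //.
  exact: measurable_rdot mt mpp.
apply: (@measurable_parameter_integral R (fun s x => rdot (tail s c x) ('i%C * conjc (psi (x - s)))) setT) => //.
apply: measurable_rdot => //; apply: cmeasurableM => //; exact: cmeasurable_cst.
Qed.

Lemma normr_rdotM_le (z w v : R[i]) :
  `|rdot (z * w) v| <= abs1 z * (normc2 w + normc2 v).
Proof.
rewrite rdotZl; apply: le_trans (ler_normD _ _) _; rewrite !normrM.
have n2 : normc2 ('i%C * w) = normc2 w.
  by rewrite normc2M /normc2 /= expr0n expr1n add0r mul1r.
have h1 := normr_rdot_le w v; have h2 := normr_rdot_le ('i%C * w) v; rewrite n2 in h2.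
have nf := normc2_ge0 w; have ng := normc2_ge0 v.
by rewrite /abs1 mulrDl; apply: lerD; apply: ler_wpM2l => //; lra.
Qed.

Section Kernel.
Variables (T : R) (b : R -> R[i]).
Hypotheses (mb : cmeasurable b) (b0 : forall x, ~~ (0 <= x <= T) -> b x = 0).
Hypothesis ib : cintegrable mu `[0, T] b.
Hypothesis b2 : (\int[mu]_(x in `[0%R, T]) (x * normc2 (b x))%:E < +oo)%E.

Let mn : measurable_fun setT (fun x => normc2 (b x)).
Proof. exact: measurable_normc2. Qed.

Lemma cmeasurable_tail s c : cmeasurable c -> cmeasurable (tail s c).
Proof. by move=> mc; apply: cmeasurableM => //; apply: cmeasurable_indic. Qed.

(** For x >= s the weight x/s is at least 1. *)
Lemma good_kernel_b : good_kernel b.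
Proof.
split=> // s s0; split; first exact: cmeasurable_tail.
apply: (@le_lt_trans _ _ (s^-1%:E * \int[mu]_(x in `[0%R, T]) (x * normc2 (b x))%:E)%E); last first.
  by rewrite lte_mul_pinfty// lee_fin invr_ge0 ltW.
rewrite -ge0_integralZl//; last 3 first.
- apply: measurable_funTS; apply/measurable_EFinP; exact: measurable_funM.
- move=> x; rewrite /= in_itv/= => /andP[x0 _].
  by rewrite lee_fin mulr_ge0// normc2_ge0.
- by rewrite lee_fin invr_ge0 ltW.
rewrite [leRHS]integral_mkcond; apply: ge0_le_integral => //.
- by move=> x _; rewrite lee_fin normc2_ge0.
- by apply/measurable_EFinP; apply: measurable_normc2; exact: cmeasurable_tail.
- apply/(measurable_restrictT _ (measurable_itv _)).
  apply: measurable_funTS; apply: measurable_funeM; apply/measurable_EFinP.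
  exact: measurable_funM.
- move=> x _; rewrite patchE mem_setE in_itv/=; case: ifPn => xT; last first.
    by rewrite /tail b0// mulr0 normc2_0.
  rewrite lee_fin /tail normc2M normc2_real indicE mem_setE in_itv/= andbT.
  have nb := normc2_ge0 (b x).
  have [sx|sx] := leP s x; rewrite /= ?expr1n ?expr0n ?mul1r ?mul0r.
    by rewrite mulrA ler_peMl// mulrC ler_pdivlMr// mul1r.
  move/andP: xT => [x0 _].
  by rewrite mulr_ge0 ?invr_ge0 ?(ltW s0)// mulr_ge0.
Qed.

Variables (psi Psi : R -> R[i]).
Hypotheses (hp : L2_halfline psi) (hF : FT psi Psi).

(** Lag 0 is set to 0, since b need not be square integrable there; after reflection of s the
    function is carried by the strict past. *)
Definition future_corr s : R[i] := if 0 < s then correlation b psi s else 0.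

Lemma future_corrE s : future_corr s = (\1_(`]0, +oo[%classic) s : R)%:C%C * correlation b psi s.
Proof.
rewrite /future_corr indicE mem_setE in_itv/= andbT.
by case: ifP; rewrite ?mul1r ?mul0r.
Qed.

Lemma cmeasurable_future_corr : cmeasurable future_corr.
Proof.
rewrite (_ : future_corr = fun s => (\1_(`]0, +oo[%classic) s : R)%:C%C * correlation b psi s).
  apply: cmeasurableM; first exact: cmeasurable_indic.
  by apply: cmeasurable_correlation => //; case: hp => [[]].
by apply/funext => s; exact: future_corrE.
Qed.

(** Cauchy-Schwarz at each lag leaves the integral over s > 0 of the squared norm of the tail beyond
    s, and by Tonelli this is the integral of x |b(x)|^2. The weighted hypothesis is thus the
    Hilbert-Schmidt condition for the Hankel operator with kernel b. *)
Lemma sqint_future_corr : square_integrable mu future_corr.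
Proof.
split; first exact: cmeasurable_future_corr.
have K0 : 0 <= 2 * nrm2 mu psi by rewrite mulr_ge0// nrm2_ge0.
have mt : measurable_fun setT (fun p : R * R => normc2 (tail p.1 b p.2)).
  apply: measurable_normc2; apply: cmeasurableM; last exact: (cmeasurable_snd R mb).
  by apply: cmeasurable_real; apply: measurable_ge_indic; [exact: measurable_fst|exact: measurable_snd].
have mD : measurable (`]0, +oo[%classic : set R) by exact: measurable_itv.
have E : (sqnorm mu setT future_corr <=
   \int[mu]_(s in `]0%R, +oo[) ((2 * nrm2 mu psi)%:E * \int[mu]_(x in setT) (normc2 (tail s b x))%:E))%E.
  rewrite [leRHS]integral_mkcond; apply: ge0_le_integral => //.
  - by move=> s _; rewrite lee_fin normc2_ge0.
  - by apply/measurable_EFinP; apply: measurable_normc2; exact: cmeasurable_future_corr.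
  - apply/(measurable_restrictT _ mD); apply: measurable_funTS; apply: measurable_funeM.
    by apply: (@measurable_parameter_integral_ge0 R (fun s x => normc2 (tail s b x)) setT) => // *; exact: normc2_ge0.
  - move=> s _; rewrite patchE mem_setE in_itv/= andbT /future_corr.
    case: ifP => s0; last by rewrite normc2_0.
    rewrite -/(sqnorm mu setT (tail s b)) sqnormE; last exact: (proj2 good_kernel_b).
    rewrite -EFinM lee_fin; apply: correlation_bound => //; first exact: good_kernel_b.
    by case: hp.
apply: le_lt_trans E _; rewrite ge0_integralZl//; last 2 first.
- apply: measurable_funTS.
  by apply: (@measurable_parameter_integral_ge0 R (fun s x => normc2 (tail s b x)) setT) => // *; exact: normc2_ge0.
- by move=> s _; apply: integral_ge0 => x _; rewrite lee_fin normc2_ge0.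
rewrite lte_mul_pinfty// tonelli_on//; last by move=> *; exact: normc2_ge0.
apply: le_lt_trans b2; rewrite [leRHS]integral_mkcond; apply: ge0_le_integral => //.
- by move=> x _; apply: integral_ge0 => s _; rewrite lee_fin normc2_ge0.
- apply: (@measurable_parameter_integral_ge0 R (fun x s => normc2 (tail s b x))) => //; last by move=> *; exact: normc2_ge0.
  apply: measurable_normc2; apply: cmeasurableM; last exact: (cmeasurable_fst R mb).
  by apply: cmeasurable_real; apply: measurable_ge_indic; [exact: measurable_snd|exact: measurable_fst].
- apply/(measurable_restrictT _ (measurable_itv _)).
  apply: measurable_funTS; apply/measurable_EFinP; exact: measurable_funM.
- move=> x _; rewrite patchE mem_setE in_itv/=; case: ifPn => xT; last first.
    by rewrite integral0_eq// => s _; rewrite /tail b0// mulr0 normc2_0.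
  move/andP: (xT) => [x0 _].
  rewrite (_ : (\int[mu]_(s in _) _ = \int[mu]_(s in `]0%R, x]) (normc2 (b x))%:E)%E); last first.
    rewrite [LHS]integral_mkcond [RHS]integral_mkcond; apply: eq_integral => s _.
    rewrite !patchE !mem_setE !in_itv/= andbT /tail normc2M normc2_real indicE mem_setE in_itv/= andbT.
    by case: ltP => _ //=; case: leP => _; rewrite /= ?expr1n ?expr0n ?mul1r ?mul0r.
  rewrite integral_cst//= lebesgue_measure_itv/= lte_fin; case: ltP => x1.
    by rewrite -EFinD subr0 -EFinM mulrC.
  by rewrite mule0 lee_fin mulr_ge0// normc2_ge0.
Qed.

End Kernel.

End Correlation.

(** * The Hankel operator as a projection to the past *)

Section HankelIdentity.
Variable R : realType.
Local Notation mu := (@lebesgue_measure R).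
Implicit Types (c g G : R -> R[i]) (s t x : R).

Lemma rdot0r (z : R[i]) : rdot z 0 = 0.
Proof. by rewrite /rdot /= !mulr0 addr0. Qed.

Lemma FT_ae_l (phi phi' Phi : R -> R[i]) : FT phi Phi -> cmeasurable phi' ->
  {ae mu, forall x, phi x = phi' x} -> FT phi' Phi.
Proof.
move=> [pL PL a] mp' pp'; have pL' := @sqint_ae _ _ _ mu _ _ mp' pL pp'.
split=> // e /a[S [oS S1 S2]]; exists S; split=> //.
rewrite (@mu_eq_nrm2_ae _ _ (fun x => phi x - stepfun S x))//.
- by case: (sqintB pL' (sqint_stepfun S)).
- by case: (sqintB pL (sqint_stepfun S)).
- by apply: ae_imp pp' => x ->.
Qed.

Variables (T : R) (b : R -> R[i]).
Hypotheses (mb : cmeasurable b) (b0 : forall x, ~~ (0 <= x <= T) -> b x = 0).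
Hypothesis ib : cintegrable mu `[0, T] b.
Hypothesis b2 : (\int[mu]_(x in `[0%R, T]) (x * normc2 (b x))%:E < +oo)%E.
Variables (psi Psi : R -> R[i]).
Hypotheses (hp : L2_halfline psi) (hF : FT psi Psi).

Let A := multiplier `[0, T] (fun l t : R => expi (l * t)) b.

(** psi vanishes at negative arguments, so psi(t + x) restricts the integral to x >= -t, the tail
    that defines the correlation at lag -t. *)
Lemma correlation_rdot t (w : R[i]) : t < 0 ->
  Rintegral mu `[0, T] (fun x => rdot (b x * psi (t - - x)) w) =
  rdot (future_corr b psi (- t)) w.
Proof.
move=> t0; have nt : 0 < - t by rewrite oppr_gt0.
rewrite /future_corr nt rdot_cip; last 2 first.
- exact: (proj2 (good_kernel_b mb b0 b2)).
- by apply: sqint_conj_shift; case: hp.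
rewrite Rintegral_mkcond /rip; apply: eq_Rintegral => x _.
rewrite patchE mem_setE in_itv/= (_ : point = 0 :> R)//.
rewrite /tail indicE mem_setE in_itv/= andbT.
have E : t - - x = x - - t by ring.
rewrite E; case: ifPn => xT; last by rewrite b0// mulr0 /rdot /= !mul0r addr0.
case: leP => tx; first by rewrite mul1r /rdot !ReImE; ring.
rewrite (proj2 hp); last by rewrite subr_lt0.
by rewrite mulr0 mul0r /rdot /= !mul0r.
Qed.

(** A averages the advances exp(i l x) with weight b(x), and each of them turns psi into psi(t + x).
    By Plancherel, pairing with a function g of the past gives the double integral of b(x) psi(t +
    x) against g(t); integrating over x first yields the correlation at lag -t. *)
Lemma rip_future_corr g G : FT g G -> (forall t, 0 < t -> g t = 0) ->
  rip mu (fun l => A l * Psi l) G =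
  2 * pi * rip mu (fun t => future_corr b psi (- t)) g.
Proof.
move=> hg gp; have [gL GL _] := hg; have [pL p0] := hp; have [_ PL _] := hF.
(* Discarding t = 0 matters for Fubini: at lag 0 the product of b and psi need not be integrable,
   while at t < 0 only a square-integrable tail of b is involved. *)
pose g0 t : R[i] := (\1_(`]-oo, 0[%classic) t : R)%:C%C * g t.
have mI : measurable (`]-oo, 0[%classic : set R) by exact: measurable_itv.
have g0L : square_integrable mu g0.
  by apply: (@mu_sqintM _ _ 1) => //; [exact: cmeasurable_indic|exact: normc2_indic_le].
have gg0 : {ae mu, forall t, g t = g0 t}.
  apply: ae_imp (ae_neq (0 : R)) => t t0; rewrite /g0 indicE mem_setE in_itv/=.
  have [t1|t1] := ltP t 0; first by rewrite mul1r.
  by rewrite mul0r gp// lt_neqAle eq_sym t0.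
have hg0 : FT g0 G by apply: FT_ae_l hg _ gg0; case: g0L.
pose g1 t : R[i] := (2 * pi)%:C%C * g0 t.
have g1L : square_integrable mu g1 by exact: sqintZ.
have kL := sqint_preserving (preserving_opp R) (sqint_future_corr mb b0 b2 hp).
have g10 t : 0 <= t -> g1 t = 0.
  by move=> t0; rewrite /g1 /g0 indicE mem_setE in_itv/= ltNge t0 mul0r mulr0.
pose F t x := rdot (b x * psi (t - - x)) (g1 t).
have mF : measurable_fun setT (fun p : R * R => F p.1 p.2).
  apply: measurable_rdot; last by apply: (cmeasurable_fst R); case: g1L.
  apply: cmeasurableM; first exact: (cmeasurable_snd R mb).
  have md : measurable_fun setT (fun p : R * R => p.1 - - p.2).
    apply: measurable_funB; first exact: measurable_fst.
    by apply: measurableT_comp => //; exact: measurable_snd.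
  by case: pL => [[m1 m2] _]; split; [apply: (measurableT_comp m1 md)|apply: (measurableT_comp m2 md)].
have iD := measurable_itv `[0, T]%R.
have Fb t x : `|F t x| <= abs1 (b x) * (normc2 (psi (t - - x)) + normc2 (g1 t)).
  exact: normr_rdotM_le.
have sL x := sqint_shift (- x) pL.
have Fu : Rintegral mu setT (fun t => Rintegral mu `[0, T] (F t)) =
    Rintegral mu `[0, T] (fun x => Rintegral mu setT (F ^~ x)).
  apply: Rintegral_fubini_gen => //.
  - move=> t; have [t0|t0] := leP 0 t.
      rewrite (_ : EFin \o _ = cst 0%E); first exact: integrable0.
      by apply/funext => x; rewrite /F /= g10// /rdot /= !mulr0 addr0.
    have nt : 0 < - t by rewrite oppr_gt0.
    have tL := proj2 (good_kernel_b mb b0 b2) _ nt.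
    have cL := sqintZ (g1 t) (sqint_conj_shift (- t) pL).
    apply: (@integrableS _ _ _ mu setT) => //.
    have := integrable_rdot tL cL.
    rewrite (_ : (fun x => rdot _ _) = F t)//.
    apply/funext => x; rewrite /F /tail indicE mem_setE in_itv/= andbT.
    have -> : t - - x = x - - t by ring.
    case: leP => tx; first by rewrite mul1r /rdot !ReImE; ring.
    rewrite p0; last by rewrite subr_lt0.
    by rewrite mulr0 mul0r /rdot /= !mul0r.
  - move=> x _; apply: (@integrable_rdot _ _ _ mu (fun t => b x * psi (t - - x)) g1) => //.
    exact: sqintZ (sL x).
  (* Absolute integrability comes from [Fb]: integration over t leaves a constant times |b(x)|,
     which is integrable. *)
  - rewrite (@tonelli_on _ setT `[0, T]%classic (fun t x => `|F t x|))//; last first.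
      exact: measurableT_comp.
    pose K := nrm2 mu psi + nrm2 mu g1.
    apply: (@le_lt_trans _ _ (\int[mu]_(x in `[0%R, T]) (K * abs1 (b x))%:E)%E).
      apply: ge0_le_integral => //.
      + by move=> x _; apply: integral_ge0.
      + apply: measurable_funTS.
        apply: (@measurable_parameter_integral_ge0 _ (fun x t => `|F t x|)) => //.
        apply: measurableT_comp => //.
        exact: (measurableT_comp mF (measurable_fun_pair measurable_snd measurable_fst)).
      + apply: measurable_funTS; apply/measurable_EFinP; apply: measurable_funM => //.
        by case: mb => m1 m2; apply: measurable_funD; exact: measurableT_comp.
      + move=> x _.
        apply: (@le_trans _ _ (\int[mu]_t ((abs1 (b x))%:E * ((normc2 (psi (t - - x)))%:E + (normc2 (g1 t))%:E)))%E).
          apply: ge0_le_integral => //.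
          * have mFx := measurableT_comp mF (measurable_pair2 x).
            by apply/measurable_EFinP; exact: (measurableT_comp _ mFx).
          * apply: measurable_funeM; apply: emeasurable_funD; apply/measurable_EFinP; apply: measurable_normc2.
              by case: (sL x).
            by case: g1L.
          * by move=> t _; rewrite -EFinD -EFinM lee_fin.
        rewrite ge0_integralZl//; last 3 first.
        * apply: emeasurable_funD; apply/measurable_EFinP; apply: measurable_normc2.
            by case: (sL x).
          by case: g1L.
        * by move=> t _; rewrite adde_ge0// lee_fin normc2_ge0.
        * by rewrite lee_fin abs1_ge0.
        rewrite ge0_integralD//; last 4 first.
        * by move=> t _; rewrite lee_fin normc2_ge0.
        * by apply/measurable_EFinP; apply: measurable_normc2; case: (sL x).
        * by move=> t _; rewrite lee_fin normc2_ge0.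
        * by apply/measurable_EFinP; apply: measurable_normc2; case: g1L.
        rewrite -!/(sqnorm mu setT _) (sqnormE (sL x)) (sqnormE g1L) nrm2_shift; last by case: pL.
        by rewrite -EFinD -EFinM lee_fin mulrC.
    have := @integrableZl _ _ _ mu _ iD K _ (integrable_abs1 iD ib).
    move=> /integrableP[_]; apply: le_lt_trans.
    apply: ge0_le_integral => //.
    + by move=> x _; rewrite lee_fin mulr_ge0 ?abs1_ge0// addr_ge0// nrm2_ge0.
    + apply: measurable_funTS; apply/measurable_EFinP; apply: measurable_funM => //.
      by case: mb => m1 m2; apply: measurable_funD; exact: measurableT_comp.
    + apply: measurableT_comp => //; apply: measurable_funTS; apply/measurable_EFinP; apply: measurable_funM => //.
      by case: mb => m1 m2; apply: measurable_funD; exact: measurableT_comp.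
    + by move=> x _ /=; rewrite lee_fin ler_norm.
transitivity (Rintegral mu `[0, T] (fun x => Rintegral mu setT (F ^~ x))).
  rewrite (rip_multiplier iD (unit_kernel_pos R) mb ib PL GL); apply: eq_Rintegral => x _.
  have h1 := ointegralZ (b x) (@sqint_Eproc R) (FT_shift (- x) hF).
  have := rip_FT h1 hg0.
  rewrite (_ : (fun w => b x * (expi (- (w * - x)) * Psi w)) = fun l => b x * (expi (l * x) * Psi l)); last first.
    by apply/funext => l; rewrite mulrN opprK.
  have bL := sqintZ (b x) (sL x).
  have E := ripRl (2 * pi) g0L bL.
  move=> ->; rewrite (ripC mu _ g0) -E; exact: ripC.
rewrite -Fu.
transitivity (rip mu (fun t => future_corr b psi (- t)) g1).
  apply: eq_Rintegral => t _; have [t0|t0] := leP 0 t; last exact: correlation_rdot.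
  rewrite (g10 _ t0) rdot0r (@eq_Rintegral _ _ _ mu _ (fun=> 0)).
    by rewrite /Rintegral integral0.
  by move=> x _; rewrite (g10 _ t0); exact: rdot0r.
have E := ripRl (2 * pi) g0L kL.
rewrite (ripC mu _ g1) E; congr (_ * _); rewrite (ripC mu _ g).
exact/esym/(@eq_rip_ae _ _ _ mu _ _ _ gL g0L kL gg0).
Qed.

(* [r] is the part of [A Psi] carried by the half-line t <= 0, the prediction error. *)
Lemma hardy_defect r : FT (fun t => future_corr b psi (- t)) r ->
  hardy (fun l => A l * Psi l - r l).
Proof.
move=> hr; have [_ PL _] := hF; have [_ rL _] := hr.
have AL : square_integrable mu (fun l => A l * Psi l).
  by apply: (sqint_multiplier (measurable_itv _) (unit_kernel_pos R) mb ib).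
split; first exact: sqintB.
move=> g G hg gp; have [_ GL _] := hg.
by rewrite ripBl// (rip_future_corr hg gp) (rip_FT hr hg) subrr.
Qed.

End HankelIdentity.

(** * From the kernel of D to the operator D A *)

Section DifferenceOperator.
Variable R : realType.
Local Notation mu := (@lebesgue_measure R).
Implicit Types (c psi : R -> R[i]) (s t x : R).

Lemma good_kernelB c c' : good_kernel c -> good_kernel c' -> good_kernel (fun t => c t - c' t).
Proof.
move=> [m1 h1] [m2 h2]; split; first exact: cmeasurableB.
move=> s s0; have := sqintB (h1 _ s0) (h2 _ s0).
by rewrite (_ : (fun x => _ - _) = tail s (fun t => c t - c' t))//; apply/funext => x; rewrite /tail mulrBr.
Qed.

Lemma good_kernelZ (z : R[i]) c : good_kernel c -> good_kernel (fun t => z * c t).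
Proof.
move=> [m1 h1]; split; first by apply: cmeasurableM => //; exact: cmeasurable_cst.
move=> s s0; have -> : tail s (fun t => z * c t) = fun x => z * tail s c x.
  by apply/funext => x; rewrite /tail mulrCA.
exact: (sqintZ z (h1 _ s0)).
Qed.

Lemma good_kernel0 : good_kernel (fun _ : R => 0 : R[i]).
Proof.
split; first exact: cmeasurable_cst.
move=> s _; rewrite (_ : tail s _ = fun=> 0); first exact: sqint0.
by apply/funext => x; rewrite /tail mulr0.
Qed.

Lemma good_kernel_sum (I : Type) (r : seq I) (c : I -> R -> R[i]) :
  (forall i, good_kernel (c i)) -> good_kernel (fun t => \sum_(i <- r) c i t).
Proof.
move=> hc; elim: r => [|i r ih].
  by under eq_fun do rewrite big_nil; exact: good_kernel0.
have h := good_kernelB (hc i) (good_kernelZ (-1) ih).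
rewrite (_ : (fun t => _) = fun t => c i t - -1 * \sum_(j <- r) c j t)//.
by apply/funext => t; rewrite big_cons mulN1r opprK.
Qed.

Lemma good_kernel_indic (D : set R) c : measurable D -> good_kernel c ->
  good_kernel (fun t => (\1_D t : R)%:C%C * c t).
Proof.
move=> mD [m1 h1]; split; first by apply: cmeasurableM => //; exact: cmeasurable_indic.
move=> s s0; have -> : tail s (fun t => (\1_D t : R)%:C%C * c t) =
    fun x => (\1_D x : R)%:C%C * tail s c x.
  by apply/funext => x; rewrite /tail mulrCA.
exact: (@mu_sqintM _ _ 1 _ (cmeasurable_indic R mD) (normc2_indic_le D) (h1 _ s0)).
Qed.

Lemma tail_shift c s x t : tail s (fun t => c (t + x)) t = tail (s + x) c (t - - x).
Proof.
by rewrite /tail opprK !indicE !mem_setE !in_itv/= !andbT lerD2r.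
Qed.

Lemma good_kernel_shift x c : 0 <= x -> good_kernel c -> good_kernel (fun t => c (t + x)).
Proof.
move=> x0 [m1 h1]; split.
  by have := cmeasurable_shift (- x) m1; under eq_fun do rewrite opprK.
move=> s s0; have := sqint_shift (- x) (h1 (s + x) (ltr_wpDr x0 s0)).
rewrite (_ : (fun y => tail _ _ (y - - x)) = tail s (fun t => c (t + x)))//.
by apply/funext => t; rewrite tail_shift.
Qed.

Lemma cip_shift (f g : R -> R[i]) x : square_integrable mu f -> square_integrable mu g ->
  cip mu (fun t => f (t - x)) (fun t => g (t - x)) = cip mu f g.
Proof.
move=> fL gL; have p := preserving_shift (- x).
rewrite /cip (rip_preserving p fL gL).
by rewrite (@rip_preserving _ _ f (fun t => 'i%C * g t) p fL (sqintZ _ gL)).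
Qed.

Lemma correlation_shift c psi s x : 0 < s -> 0 <= x -> good_kernel c ->
  square_integrable mu psi ->
  correlation (fun t => c (t + x)) psi s = correlation c psi (s + x).
Proof.
move=> s0 x0 [_ h] pL; have cL := h _ (ltr_wpDr x0 s0).
rewrite /correlation -(cip_shift (- x) cL (sqint_conj_shift _ pL)).
congr cip; apply/funext => t; first exact: tail_shift.
by congr (conjc (psi _)); ring.
Qed.

Lemma eq_correlation c c' psi s : (forall t, s <= t -> c t = c' t) ->
  correlation c psi s = correlation c' psi s.
Proof.
move=> h; rewrite /correlation; congr cip; apply/funext => t.
rewrite /tail indicE mem_setE in_itv/= andbT; case: leP => [/h ->//|_].
by rewrite !mul0r.
Qed.

Lemma correlation_sum (I : Type) (r : seq I) (c : I -> R -> R[i]) psi s : 0 < s ->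
  (forall i, good_kernel (c i)) -> square_integrable mu psi ->
  correlation (fun t => \sum_(i <- r) c i t) psi s = \sum_(i <- r) correlation (c i) psi s.
Proof.
move=> s0 hc pL; rewrite /correlation -cip_suml; last 2 first.
- by move=> i; exact: (proj2 (hc i)).
- exact: sqint_conj_shift.
by congr cip; apply/funext => t; rewrite /tail mulr_sumr.
Qed.

Lemma correlationZ (z : R[i]) c psi s : 0 < s -> good_kernel c -> square_integrable mu psi ->
  correlation (fun t => z * c t) psi s = z * correlation c psi s.
Proof.
move=> s0 [_ h] pL; rewrite /correlation -cipZl; last 2 first.
- exact: h.
- exact: sqint_conj_shift.
by congr cip; apply/funext => t; rewrite /tail mulrCA.
Qed.

Variables (n : nat) (tau T : R) (a : R -> R[i]).
Hypotheses (htau : 0 < tau) (hT : 0 < T).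
Hypothesis ha1 : cintegrable mu `[0, T] (Da n tau T a).
Hypothesis ha2 : (\int[mu]_(t in `[0%R, T]) (t * normc2 (Da n tau T a t))%:E < +oo)%E.

(** Kernels extended by 0 outside [0, T] let the variable upper index of D be replaced by the fixed
    bound [K]. *)
Definition bker t : R[i] := (\1_(`[0, T]%classic) t : R)%:C%C * Da n tau T a t.
Definition aker t : R[i] := (\1_(`[0, T]%classic) t : R)%:C%C * a t.
Let mT : measurable (`[0, T]%classic : set R). Proof. exact: measurable_itv. Qed.

Lemma bkerE t : 0 <= t <= T -> bker t = Da n tau T a t.
Proof. by move=> tT; rewrite /bker indicE mem_setE in_itv/= tT mul1r. Qed.

Lemma bker_out t : ~~ (0 <= t <= T) -> bker t = 0.
Proof. by move=> tT; rewrite /bker indicE mem_setE in_itv/= (negbTE tT) mul0r. Qed.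

Lemma akerE t : 0 <= t <= T -> aker t = a t.
Proof. by move=> tT; rewrite /aker indicE mem_setE in_itv/= tT mul1r. Qed.

Lemma aker_out t : ~~ (0 <= t <= T) -> aker t = 0.
Proof. by move=> tT; rewrite /aker indicE mem_setE in_itv/= (negbTE tT) mul0r. Qed.

Lemma cmeasurable_bker : cmeasurable bker.
Proof.
have h (f : R -> R) : measurable_fun `[0, T]%classic f ->
    measurable_fun setT (fun t => \1_(`[0, T]%classic) t * f t).
  move=> mf; have := proj1 (measurable_restrictT f mT) mf.
  rewrite (_ : f \_ _ = fun t => \1_(`[0, T]%classic) t * f t)//.
  by apply/funext => t; rewrite patchE indicE; case: (t \in _); rewrite ?mul1r ?mul0r.
case: ha1 => i1 i2; split.
  have := h _ (proj1 (measurable_EFinP _ _) (measurable_int _ i1)).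
  by rewrite (_ : (fun t => _) = fun x => complex.Re (bker x))//; apply/funext => t; rewrite /bker ReImE /= mul0r subr0.
have := h _ (proj1 (measurable_EFinP _ _) (measurable_int _ i2)).
by rewrite (_ : (fun t => _) = fun x => complex.Im (bker x))//; apply/funext => t; rewrite /bker ReImE /= mul0r addr0.
Qed.

Lemma cintegrable_bker : cintegrable mu `[0, T] bker.
Proof.
case: ha1 => i1 i2; split; [apply: eq_integrable i1|apply: eq_integrable i2] => // t;
  by rewrite inE/= in_itv/= => tT; rewrite bkerE.
Qed.

Lemma bker_weight : (\int[mu]_(t in `[0%R, T]) (t * normc2 (bker t))%:E < +oo)%E.
Proof.
apply: le_lt_trans ha2; rewrite le_eqVlt; apply/orP; left; apply/eqP.
by apply: eq_integral => t; rewrite inE/= in_itv/= => tT; rewrite bkerE.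
Qed.

Lemma A_char_multiplier l :
  A_char n tau T a l = multiplier `[0, T] (fun l t => expi (l * t)) bker l.
Proof.
rewrite /A_char /fourier_pos /multiplier /cintegral; congr Complex;
  by apply: eq_Rintegral => t; rewrite inE/= in_itv/= => tT; rewrite bkerE.
Qed.

Let K := (Num.truncn (T / tau)).+1.

(** The condition k <= [(T - t)/tau] means t + tau k <= T; moving it into the summand gives a range
    independent of t. *)
Lemma sum_truncated t (F : nat -> R[i]) : 0 <= t <= T ->
  \sum_(k < (Num.truncn ((T - t) / tau)).+1) F k =
  \sum_(k < K) (if t + tau * k%:R <= T then F k else 0).
Proof.
move=> /andP[t0 tT].
have x0 : 0 <= (T - t) / tau by rewrite divr_ge0 ?subr_ge0// ltW.
have xK : ((Num.truncn ((T - t) / tau)).+1 <= K)%N.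
  by rewrite ltnS; apply: le_truncn; rewrite ler_pM2r ?invr_gt0// lerBlDr lerDl.
rewrite (big_ord_widen _ _ xK) big_mkcond; apply: eq_bigr => k _.
congr (if _ then _ else _).
rewrite ltnS truncn_ge_nat// ler_pdivlMr// lerBrDr addrC; congr (_ + _ <= _).
exact: mulrC.
Qed.

Lemma dcoef0 : dcoef R n 0 = 1.
Proof.
rewrite /dcoef (_ : \poly_(j < 1) (1 : R[i]) = 1) ?expr1n ?coef1//.
by apply/polyP => i; rewrite coef_poly coef1 ltnS leqn0; case: eqP.
Qed.

Lemma bker_sum t : 0 <= t <= T ->
  bker t = \sum_(k < K) dcoef R n k * aker (t + tau * k%:R).
Proof.
move=> tT; rewrite bkerE// /Da (@sum_truncated t (fun k => a (t + tau * k%:R) * dcoef R n k))//.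
apply: eq_bigr => k _; have /andP[t0 _] := tT.
have tk : 0 <= t + tau * k%:R by rewrite addr_ge0// mulr_ge0// ltW.
case: ifP => h; first by rewrite akerE ?tk// mulrC.
by rewrite aker_out ?mulr0// tk h.
Qed.

Let good_b : good_kernel bker.
Proof.
exact: (good_kernel_b cmeasurable_bker bker_out bker_weight).
Qed.

(* [a] is recovered from [D a] by descending steps of length [tau] from [T]. *)
Lemma good_kernel_aker_from N :
  good_kernel (fun t => (\1_(`]T - tau * N%:R, +oo[%classic) t : R)%:C%C * aker t).
Proof.
elim: N => [|N ih].
  rewrite (_ : (fun t => _) = fun=> 0); first exact: good_kernel0.
  apply/funext => t; rewrite mulr0 subr0 indicE mem_setE in_itv/= andbT.
  case: ltP => [Tt|_]; last by rewrite mul0r.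
  by rewrite aker_out ?mulr0// negb_and -!ltNge Tt orbT.
pose C N t := (\1_(`]T - tau * N%:R, +oo[%classic) t : R)%:C%C * aker t.
have mI (x : R) : measurable (`]x, +oo[%classic : set R) by exact: measurable_itv.
(* Since d(0) = 1, [aker] is [bker] minus the terms with k >= 1, whose arguments lie at least tau
   further right, in the range settled by the induction hypothesis. *)
have h := good_kernel_indic (mI (T - tau * N.+1%:R)) (good_kernel_indic mT
  (good_kernelB good_b (@good_kernel_sum _ (enum 'I_K.-1) (fun k : 'I_K.-1 => fun t => dcoef R n k.+1 * C N (t + tau * k.+1%:R))
   (fun k => good_kernelZ (dcoef R n k.+1)
     (good_kernel_shift (mulr_ge0 (ltW htau) (ler0n R k.+1)) ih))))).
rewrite (_ : (fun t => _) = fun t : R => (\1_(`]T - tau * N.+1%:R, +oo[%classic) t : R)%:C%C *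
  ((\1_(`[0, T]%classic) t : R)%:C%C * (bker t - \sum_(k <- enum 'I_K.-1)
     dcoef R n k.+1 * C N (t + tau * k.+1%:R))))//.
apply/funext => t; rewrite !indicE !mem_setE !in_itv/= andbT.
case: ltP => tN; last by rewrite !mul0r.
rewrite !mul1r; have [tT|tT] := boolP (0 <= t <= T); last by rewrite mul0r aker_out.
rewrite mul1r bker_sum// big_ord_recl /= dcoef0 mul1r mulr0 addr0.
rewrite big_enum /= [X in _ = _ + X - _](_ : _ = \sum_(k < K.-1) dcoef R n k.+1 * C N (t + tau * k.+1%:R)) ?addrK//.
apply: eq_bigr => k _; congr (_ * _).
rewrite /C indicE mem_setE in_itv/= andbT (_ : _ < _) ?mul1r//.
have k1 : 1 <= k.+1%:R :> R by rewrite ler1n.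
have := ler_wpM2l (ltW htau) k1; rewrite mulr1.
by move: tN; rewrite -(@natr1 _ N) mulrDr mulr1; lra.
Qed.

Lemma good_kernel_aker : good_kernel aker.
Proof.
have [N hN] : exists N : nat, T - tau * N%:R < 0.
  exists (Num.Def.archi_bound (T / tau)); rewrite subr_lt0 mulrC -ltr_pdivrMr//.
  by apply: archi_boundP; rewrite divr_ge0// ltW.
have := good_kernel_aker_from N.
rewrite (_ : (fun t => _) = aker)//; apply/funext => t.
rewrite indicE mem_setE in_itv/= andbT; case: ltP => h; first by rewrite mul1r.
rewrite mul0r aker_out// negb_and -!ltNge (_ : t < 0)//.
exact: le_lt_trans h hN.
Qed.

Lemma correlation_aker psi (x : R) : L2_halfline psi -> 0 < x ->
  correlation aker psi x = cintegral mu `[0, T - x] (fun u => a (u + x) * psi u).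
Proof.
move=> [pL p0] x0; have [_ /(_ _ x0) aL] := good_kernel_aker.
rewrite /correlation -(cip_shift (- x) aL (sqint_conj_shift _ pL)).
have E u : tail x aker (u - - x) = (\1_(`[0, T - x]%classic) u : R)%:C%C * a (u + x).
  rewrite opprK /tail /aker !indicE !mem_setE !in_itv/= andbT lerBrDr -{1}[x]add0r lerD2r.
  case: (leP 0 u) => u0; last by rewrite !mul0r.
  rewrite mul1r addr_ge0// ?ltW//=.
have F u : psi (u - - x - x) = psi u by congr psi; ring.
rewrite /cip /cintegral /rip; congr Complex; rewrite [RHS]Rintegral_mkcond;
  apply: eq_Rintegral => u _; rewrite patchE E F indicE (_ : point = 0 :> R)//;
  by case: (u \in _); rewrite ?mul1r ?mul0r /rdot !ReImE /= ?mul0r ?mul1r; ring.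
Qed.

(** Splitting the correlation of [bker] into correlations of shifts of a requires a itself to have
    square-integrable tails, which is why a was recovered from D a. *)
Lemma DA_correlation psi s : L2_halfline psi -> 0 < s <= T ->
  DA n tau T a psi s = correlation bker psi s.
Proof.
move=> hp /andP[s0 sT]; have [pL p0] := hp.
have tk (k : nat) : 0 <= tau * k%:R by rewrite mulr_ge0// ltW.
rewrite /DA (@sum_truncated s (fun k => dcoef R n k * cintegral mu `[0, T - s - tau * k%:R]
  (fun u => a (u + s + tau * k%:R) * psi u))); last by rewrite ltW.
transitivity (correlation (fun t => \sum_(k < K) dcoef R n k * aker (t + tau * k%:R)) psi s); last first.
  apply: eq_correlation => t st; have [tT|tT] := leP t T.
    by rewrite bker_sum// tT (le_trans (ltW s0) st).
  rewrite bker_out; last by rewrite negb_and -!ltNge tT orbT.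
  rewrite big1// => k _; rewrite aker_out ?mulr0// negb_and -!ltNge.
  by rewrite (ltr_wpDr (tk k) tT) orbT.
rewrite correlation_sum//; last first.
  move=> k; apply: good_kernelZ; apply: good_kernel_shift => //.
  exact: good_kernel_aker.
apply: eq_bigr => k _.
have gk := good_kernel_shift (tk k) good_kernel_aker.
rewrite correlationZ// correlation_shift//; last exact: good_kernel_aker.
case: ifP => h.
  rewrite correlation_aker//; last by rewrite ltr_wpDr.
  rewrite opprD addrA; congr (_ * cintegral _ _ _).
  by apply/funext => u; rewrite addrA.
rewrite (@eq_correlation _ (fun=> 0)); last first.
  move=> t st; rewrite aker_out// negb_and -!ltNge.
  by rewrite (lt_le_trans _ st) ?orbT// ltNge h.
rewrite /correlation (_ : tail _ _ = fun=> 0) ?mulr0; last first.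
  by apply/funext => t; rewrite /tail mulr0.
by rewrite /cip !rip0l mulr0.
Qed.

Lemma future_corr_segment psi : L2_halfline psi -> L2_segment T (future_corr bker psi).
Proof.
move=> hp; split; first exact: (sqint_future_corr cmeasurable_bker bker_out bker_weight hp).
move=> s sT; rewrite /future_corr; case: ifP => // s0.
have Ts : T < s by move: sT; rewrite (ltW s0)/= -ltNge.
rewrite (@eq_correlation _ (fun=> 0)); last first.
  move=> t st; rewrite bker_out// negb_and -!ltNge.
  by rewrite (lt_le_trans Ts st) orbT.
rewrite /correlation (_ : tail _ _ = fun=> 0); last first.
  by apply/funext => t; rewrite /tail mulr0.
by rewrite /cip !rip0l.
Qed.

End DifferenceOperator.

(** * A process with a given spectral density *)

Section RestrictedMeasure.
Context d (T : measurableType d) (R : realType) (m : {measure set T -> \bar R}).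
Variables (D : set T) (mD : measurable D).

(** The measure is the sum of its restrictions to D and to the complement, and the integrand set to
    0 off D has no integral against the second. *)
Lemma ge0_integral_mrestr (g : T -> \bar R) : measurable_fun setT g ->
  (forall x, (0 <= g x)%E) ->
  (\int[mrestr m mD]_x g x = \int[m]_(x in D) g x)%E.
Proof.
move=> mg g0; have mDc : measurable (~` D) by exact: measurableC.
have mgD : measurable_fun setT (g \_ D).
  by apply/(measurable_restrictT _ mD); exact: measurable_funTS.
have gD0 x : (0 <= (g \_ D) x)%E by rewrite patchE; case: ifP.
rewrite [RHS]integral_mkcond.
transitivity (\int[measure_add (mrestr m mD) (mrestr m mDc)]_x (g \_ D) x)%E; last first.
  apply: eq_measure_integral => A mA _.
  rewrite -[LHS]/(measure_add (mrestr m mD) (mrestr m mDc) A) measure_addE.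
  by rewrite /= /mrestr addeC -setDE; exact/esym/measureDI.
rewrite ge0_integral_measure_add// -[LHS]adde0; congr (_ + _)%E.
  apply: ae_eq_integral => //.
  exists (~` D); split=> //; first by rewrite -[LHS]/(m (~` D `&` D)) setICl measure0.
  move=> x /= h Dx; apply: h => _; rewrite patchE mem_set//.
apply/esym; rewrite (ae_eq_integral (cst 0%E))//; first exact: integral0.
exists D; split=> //; first by rewrite -[LHS]/(m (D `&` ~` D)) setICr measure0.
by move=> x /= h; apply: contrapT => Dx; apply: h => _; rewrite patchE memNset.
Qed.

End RestrictedMeasure.

Section SpectralProbability.
Variable R : realType.
Local Notation mu := (@lebesgue_measure R).
Variable f : R -> R.
Hypotheses (mf : measurable_fun setT f) (f0 : forall l, 0 <= f l).
Variable F0 : R.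
Hypotheses (F00 : 0 < F0) (fF : (\int[mu]_l (f l)%:E = F0%:E)%E).

Local Notation Om := (measurableTypeR R * measurableTypeR R)%type.

(* The second coordinate carries an independent random sign, which centers the process. *)
Definition hypograph : set Om := [set p | `|p.2| < f p.1 / (2 * F0)].

Lemma measurable_hypograph : measurable hypograph.
Proof.
have h : measurable_fun setT (fun p : Om => `|p.2| < f p.1 / (2 * F0)).
  apply: measurable_fun_ltr; first by apply: measurableT_comp => //; exact: measurable_snd.
  apply: measurable_funM => //; apply: (measurableT_comp mf); exact: measurable_fst.
have := h measurableT [set true]; rewrite setTI; apply.
by [].
Qed.

Definition spectral_prob0 := mrestr (mu \x mu)%E measurable_hypograph.
Definition slab (x : R) : set R := `]- (f x / (2 * F0)), f x / (2 * F0)[%classic.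

Lemma in_slab x y : slab x y = hypograph (x, y).
Proof. by rewrite /slab /hypograph /= in_itv/= ltr_norml. Qed.

Lemma ge0_integral_prob0 (g : Om -> \bar R) : measurable_fun setT g ->
  (forall p, (0 <= g p)%E) ->
  (\int[spectral_prob0]_p g p = \int[mu]_x \int[mu]_(y in slab x) g (x, y))%E.
Proof.
move=> mg g0; rewrite ge0_integral_mrestr// integral_mkcond fubini_tonelli1//; last 2 first.
- by apply/(measurable_restrictT _ measurable_hypograph); exact: measurable_funTS.
- by move=> p; rewrite patchE; case: ifP.
apply: eq_integral => x _; rewrite [RHS]integral_mkcond; apply: eq_integral => y _.
by rewrite !patchE; congr (if _ then _ else _); apply/idP/idP; rewrite !in_setE in_slab.
Qed.

Lemma measurable_slab x : measurable (slab x).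
Proof. exact: measurable_itv. Qed.

Lemma slab_measure x : mu (slab x) = (f x / F0)%:E.
Proof.
have h : 0 <= f x / (2 * F0) by rewrite divr_ge0// mulr_ge0// ltW.
rewrite /slab lebesgue_measure_itv/= lte_fin; case: ifPn => [_|].
  by rewrite -EFinB; congr (_%:E); field; rewrite gt_eqF.
rewrite -leNgt => h2; have e : f x / (2 * F0) = 0 by lra.
have -> : f x / F0 = 2 * (f x / (2 * F0)) by field; rewrite gt_eqF.
by rewrite e mulr0.
Qed.

Lemma spectral_prob0T : spectral_prob0 setT = 1%E.
Proof.
transitivity (\int[spectral_prob0]_p cst 1%E p)%E; first by rewrite [RHS]integral_cst// mul1e.
rewrite (@ge0_integral_prob0 (cst 1%E) (measurable_cst _) (fun _ => lee01)).
transitivity (\int[mu]_x ((F0^-1)%:E * (f x)%:E))%E.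
  apply: eq_integral => x _; rewrite integral_cst; last exact: measurable_slab.
  rewrite mul1e -EFinM mulrC; exact: slab_measure.
rewrite ge0_integralZl//; last 3 first.
- exact/measurable_EFinP.
- by move=> x _; rewrite lee_fin.
- by rewrite lee_fin invr_ge0 ltW.
by rewrite fF -EFinM mulVf// gt_eqF.
Qed.

(** The mass is already 1; normalizing provides the type of a probability, and [spectral_probE]
    removes it again. *)
Definition spectral_prob : probability Om R := mnormalize spectral_prob0 (dirac point).

Lemma spectral_probE A : spectral_prob A = spectral_prob0 A.
Proof.
rewrite -[LHS]/(mnormalize spectral_prob0 (dirac point) A) /mnormalize.
have e (x y z : \bar R) : x = 1%E -> y = 1%E -> z = 1%E -> (if (x == 0) || (y == +oo) then dirac point
    else (fun U : set Om => spectral_prob0 U * (fine z)^-1%:E))%E A = spectral_prob0 A.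
  by move=> -> -> ->; rewrite eqe oner_eq0 /= invr1 mule1.
by apply: e; exact: spectral_prob0T.
Qed.

Lemma ge0_integral_prob (g : Om -> \bar R) : measurable_fun setT g ->
  (forall p, (0 <= g p)%E) ->
  (\int[spectral_prob]_p g p = \int[mu]_x \int[mu]_(y in slab x) g (x, y))%E.
Proof.
move=> mg g0; rewrite -ge0_integral_prob0//.
by apply: eq_measure_integral => A _ _; exact: spectral_probE.
Qed.

(** The fiber over l has measure f(l)/F0, and the factor F0/(2 pi) in the variance restores the
    spectral measure f/(2 pi). *)
Definition sample (F : R -> R[i]) (p : Om) : R[i] :=
  (Num.sg p.2 * Num.sqrt (F0 / (2 * pi)))%:C%C * F p.1.

(** Embeds the weighted space L_2(f/(2 pi)) isometrically into L_2(R). *)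
Definition weighted (F : R -> R[i]) (l : R) : R[i] := (Num.sqrt (f l / (2 * pi)))%:C%C * F l.

Lemma measurable_sg : measurable_fun setT (@Num.sg R).
Proof.
rewrite (_ : @Num.sg R = fun x => (0 < x)%R%:R - (x < 0)%R%:R).
  apply: measurable_funB; apply: (@measurableT_comp _ _ _ _ _ _ (fun b : bool => b%:R : R)) => //;
  exact: measurable_fun_ltr.
by apply/funext => x; case: sgrP => _; rewrite /= ?subr0 ?sub0r ?subrr.
Qed.

Lemma cmeasurable_sample F : cmeasurable F -> cmeasurable (sample F).
Proof.
move=> mF; apply: cmeasurableM; last exact: (cmeasurable_fst (measurableTypeR R) mF).
apply: cmeasurable_real; apply: measurable_funM => //.
by apply: (measurableT_comp measurable_sg); exact: measurable_snd.
Qed.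

Lemma measurable_sqrt_weight : measurable_fun setT (fun l => Num.sqrt (f l / (2 * pi))).
Proof.
apply: (@measurableT_comp _ _ _ _ _ _ (@Num.sqrt R)).
  by apply: continuous_meas; exact: sqrt_continuous.
exact: measurable_funM.
Qed.

Lemma cmeasurable_weighted F : cmeasurable F -> cmeasurable (weighted F).
Proof.
by move=> mF; apply: cmeasurableM => //; apply: cmeasurable_real; exact: measurable_sqrt_weight.
Qed.

Let pi2 : 0 < 2 * pi :> R. Proof. by rewrite mulr_gt0// pi_gt0. Qed.

Lemma normc2_weighted F l : normc2 (weighted F l) = f l / (2 * pi) * normc2 (F l).
Proof. by rewrite normc2M normc2_real sqr_sqrtr// divr_ge0// ltW. Qed.

Lemma sqnorm_sample F : cmeasurable F ->
  sqnorm spectral_prob setT (sample F) = sqnorm mu setT (weighted F).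
Proof.
move=> mF; rewrite /sqnorm ge0_integral_prob; last 2 first.
- by apply/measurable_EFinP; apply: measurable_normc2; exact: cmeasurable_sample.
- by move=> p; rewrite lee_fin normc2_ge0.
apply: eq_integral => x _.
rewrite normc2_weighted.
rewrite (ae_eq_integral (cst (F0 / (2 * pi) * normc2 (F x))%:E)); last 4 first.
- exact: measurable_slab.
- apply: measurable_funTS; apply/measurable_EFinP.
  by apply: (measurableT_comp (measurable_normc2 (cmeasurable_sample mF)) (measurable_pair1 x)).
- exact: measurable_cst.
- apply: ae_imp (ae_neq (0 : R)) => y y0 _ /=; congr (_%:E).
  rewrite /sample /= normc2M normc2_real exprMn sqr_sqrtr ?divr_ge0 ?(ltW pi2) ?(ltW F00)//.
  by rewrite sqr_sg y0 mul1r.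
rewrite integral_cst; last exact: measurable_slab.
transitivity ((F0 / (2 * pi) * normc2 (F x))%:E * (f x / F0)%:E)%E.
  by congr (_ * _)%E; exact: slab_measure.
rewrite -EFinM; congr (_%:E); move: (pi_gt0 R); move: (pi : R) => q q0; field.
by rewrite !gt_eqF.
Qed.

Lemma sampleD F G : (fun p => sample F p + sample G p) = sample (fun l => F l + G l).
Proof. by apply/funext => p; rewrite /sample -mulrDr. Qed.

Lemma sampleZ c F : (fun p => c * sample F p) = sample (fun l => c * F l).
Proof. by apply/funext => p; rewrite /sample mulrCA. Qed.

Lemma weightedD F G : (fun p => weighted F p + weighted G p) = weighted (fun l => F l + G l).
Proof. by apply/funext => p; rewrite /weighted -mulrDr. Qed.

Lemma weightedZ c F : (fun p => c * weighted F p) = weighted (fun l => c * F l).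
Proof. by apply/funext => p; rewrite /weighted mulrCA. Qed.

Lemma sqint_sample F : cmeasurable F -> square_integrable mu (weighted F) ->
  square_integrable spectral_prob (sample F).
Proof.
by move=> mF [_ h]; split; [exact: cmeasurable_sample|rewrite sqnorm_sample].
Qed.

Lemma nrm2_sample F : cmeasurable F -> nrm2 spectral_prob (sample F) = nrm2 mu (weighted F).
Proof. by move=> mF; rewrite /nrm2 sqnorm_sample. Qed.

Lemma rip_sample F G : cmeasurable F -> cmeasurable G ->
  square_integrable mu (weighted F) -> square_integrable mu (weighted G) ->
  rip spectral_prob (sample F) (sample G) = rip mu (weighted F) (weighted G).
Proof.
move=> mF mG FL GL.
have h1 := nrm2D (sqint_sample mF FL) (sqint_sample mG GL).
have h2 := nrm2D FL GL.
rewrite sampleD !nrm2_sample// in h1; last exact: cmeasurableD.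
rewrite weightedD in h2; lra.
Qed.

Lemma cip_sample F G : cmeasurable F -> cmeasurable G ->
  square_integrable mu (weighted F) -> square_integrable mu (weighted G) ->
  cip spectral_prob (sample F) (sample G) = cip mu (weighted F) (weighted G).
Proof.
move=> mF mG FL GL; rewrite /cip rip_sample//; congr Complex.
have iL : square_integrable mu (weighted (fun l => 'i%C * G l)).
  by rewrite -weightedZ; exact: sqintZ.
rewrite sampleZ weightedZ rip_sample//.
by apply: cmeasurableM => //; exact: cmeasurable_cst.
Qed.

Lemma sqint_cst (c : R[i]) : square_integrable spectral_prob (fun=> c).
Proof.
split; first exact: cmeasurable_cst.
rewrite /sqnorm integral_cst//= probability_setT mule1; exact: ltry.
Qed.

(** Changing the sign of the second coordinate preserves the measure and exchanges [sample F] + c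
    with the negative of [sample F] - c. Their norms agree, so the inner product vanishes; this
    centers the process. *)
Lemma rip_sample_cst F c : cmeasurable F -> square_integrable mu (weighted F) ->
  rip spectral_prob (sample F) (fun=> c) = 0.
Proof.
move=> mF FL; have SL := sqint_sample mF FL; have cL := sqint_cst c.
have E : nrm2 spectral_prob (fun p => sample F p + c) = nrm2 spectral_prob (fun p => sample F p - c).
  have mD := cmeasurableD (cmeasurable_sample mF) (cmeasurable_cst Om c).
  have mB := cmeasurableB (cmeasurable_sample mF) (cmeasurable_cst Om c).
  rewrite /nrm2 /sqnorm; congr fine.
  rewrite !ge0_integral_prob; try (by move=> p; rewrite lee_fin normc2_ge0);
    try by apply/measurable_EFinP; exact: measurable_normc2.
  apply: eq_integral => x _; rewrite [LHS]integral_mkcond [RHS]integral_mkcond.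
  rewrite -(ge0_integral_preserving (preserving_opp R)); last 2 first.
  - apply/(measurable_restrictT _ (measurable_slab x)); apply: measurable_funTS.
    apply/measurable_EFinP.
    exact: (measurableT_comp (measurable_normc2 mD) (measurable_pair1 x)).
  - by move=> y; rewrite patchE; case: ifP => // _; rewrite lee_fin normc2_ge0.
  apply: eq_integral => y _; rewrite !patchE !mem_setE !in_itv/=.
  rewrite ltrNl opprK ltrNl andbC; case: ifP => // _; congr (_%:E).
  by rewrite /sample /= sgrN mulNr rmorphN mulNr -normc2N opprD opprK.
have := nrm2D SL cL; have := nrm2B SL cL; rewrite E; lra.
Qed.

End SpectralProbability.

(** * Uniform bounds on chi *)

Section ChiBound.
Variable R : realType.
Implicit Types (s t l x : R).

Lemma expiX x (k : nat) : expi x ^+ k = expi (k%:R * x).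
Proof.
elim: k => [|k ih]; first by rewrite expr0 mul0r expi0.
by rewrite exprS ih -expiD; congr expi; rewrite -[in RHS]addn1 natrD; ring.
Qed.

Lemma one_sub_cos_le x : 1 - cos x <= x ^+ 2.
Proof.
wlog x0 : x / 0 <= x.
  move=> h; have [/h//|x0] := leP 0 x.
  by rewrite -cosN -sqrrN; apply: h; rewrite oppr_ge0 ltW.
have sin_le (y : R) : 0 <= y -> sin y <= y.
  move=> y0; have [|c] := @MVT_segment R sin cos 0 y y0.
    by apply: continuous_subspaceT => z; exact: continuous_sin.
  by move=> _; rewrite sin0 !subr0 => ->; rewrite ler_piMl// cos_le1.
have [|c cx] := @MVT_segment R cos (fun z => - sin z) 0 x x0.
  by apply: continuous_subspaceT => z; exact: continuous_cos.
move: cx; rewrite in_itv/= => /andP[c0 cx]; rewrite cos0 subr0 => h.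
have -> : 1 - cos x = sin c * x by rewrite -opprB h mulNr opprK.
by rewrite expr2 ler_wpM2r// (le_trans (sin_le _ c0)).
Qed.

Lemma normc2_Eproc_le s l : normc2 (Eproc s l) <= 2 * s ^+ 2.
Proof.
have -> : Eproc s l = Eproc s l - Eproc 0 l by rewrite Eproc0 subr0.
rewrite normc2_EprocB subr0 ler_wpM2l//.
have [->|l0] := eqVneq l 0; first by rewrite expr0n /= invr0 mulr0 sqr_ge0.
rewrite ler_pdivrMr ?exprn_even_gt0// -[s ^+ 2](real_normK (num_real s)) -exprMn.
exact: one_sub_cos_le.
Qed.

(** 8 + 4 s^2 is 2 (2 + 2) + 2 (2 s^2): twice the bounds for the difference and for the integration
    term of [chiE]. *)
Lemma normc2_chi_le n s l : normc2 (chi n s l) <= (8 + 4 * s ^+ 2) ^+ n.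
Proof.
rewrite chiE normc2X; apply: lerXn2r; rewrite ?nnegrE ?normc2_ge0//.
  by rewrite addr_ge0// mulr_ge0// sqr_ge0.
apply: (le_trans (normc2D_le _ _)).
have := normc2D_le 1 (- expi (- (l * s))); have := normc2_Eproc_le s l.
by rewrite normc2N normc2_1 normc2_expi; lra.
Qed.

Lemma cmeasurable_chi n s : cmeasurable (chi n s : R -> R[i]).
Proof.
rewrite (_ : chi n s = fun l => (1 - expi (- (l * s)) + Eproc s l) ^+ n); last first.
  by apply/funext => l; rewrite chiE.
apply: cmeasurableX; apply: cmeasurableD; last exact: cmeasurable_Eproc.
by apply: cmeasurableB; [exact: cmeasurable_cst|exact: cmeasurable_expi_mul].
Qed.

Lemma rdotMM (u z w : R[i]) : rdot (u * z) (u * w) = normc2 u * rdot z w.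
Proof. by rewrite /rdot /normc2 !ReImE; ring. Qed.

Lemma rdot_unit (r c u z x y : R[i]) : normc2 u = 1 ->
  rdot (r * (u * z * x)) (c * (r * (u * y))) = rdot (r * (z * x)) (c * (r * y)).
Proof.
move=> u1; rewrite (_ : r * (u * z * x) = u * (r * (z * x))); last by ring.
by rewrite (_ : c * (r * (u * y)) = u * (c * (r * y))) ?rdotMM ?u1 ?mul1r//; ring.
Qed.

Lemma cmeasurable_expi_mulr t : cmeasurable (fun l => expi (t * l) : R[i]).
Proof. by apply: cmeasurable_expi; exact: measurable_funM. Qed.

End ChiBound.

(* Uniform approximation: round the real and imaginary parts down to the grid of mesh 1/N. *)
Lemma simple_approx (R : realType) (G : R -> R[i]) (K e : R) :
  cmeasurable G -> (forall l, normc2 (G l) <= K ^+ 2) -> 0 < K -> 0 < e ->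
  exists (m : nat) (c : 'I_m -> R[i]) (A : 'I_m -> set R),
    (forall k, measurable (A k)) /\
    forall l, normc2 (G l - \sum_(k < m) c k * (\1_(A k) l : R)%:C%C) <= e.
Proof.
move=> [mRe mIm] GK K0 e0.
(* Each coordinate is off by at most 1/N, hence the requirement 2/N^2 <= e, which N >= 2/e already
   ensures. *)
pose N := (Num.Def.archi_bound (2 / e)).+1.
(* The number of half-open cells of length 1/N that cover [-K, K], right endpoint included. *)
pose M := (Num.truncn (N%:R * (2 * K))).+1.
have N0 : 0 < N%:R :> R by rewrite ltr0n.
have N1 : 1 <= N%:R :> R by rewrite ler1n.
have eN : 2 * N%:R^-1 ^+ 2 <= e.
  rewrite exprVn ler_pdivrMr ?exprn_gt0// mulrC -ler_pdivrMr//.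
  have h := archi_boundP (divr_ge0 (ler0n R 2) (ltW e0)).
  apply: (le_trans (ltW h)); apply: (@le_trans _ _ (N%:R : R)); first by rewrite ler_nat.
  by rewrite expr2 ler_peMl// ltW.
pose cell (g : R -> R) (i : 'I_M) : set R :=
  g @^-1` `[i%:R / N%:R - K, (i%:R + 1) / N%:R - K[%classic.
have mcell g i : measurable_fun setT g -> measurable (cell g i).
  by move=> mg; rewrite -[cell g i]setTI; apply: mg => //; exact: measurable_itv.
have cellP g l : `|g l| <= K -> exists i, forall j, cell g j l <-> j = i.
  rewrite ler_norml => /andP[g1 g2].
  have gK0 : 0 <= N%:R * (g l + K) by rewrite mulr_ge0 ?(ltW N0)//; lra.
  have iM : (Num.truncn (N%:R * (g l + K)) < M)%N.
    by rewrite ltnS le_truncn// ler_wpM2l ?(ltW N0)//; lra.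
  exists (Ordinal iM) => j; have /andP[t1 t2] := truncn_itv gK0.
  have cE : cell g j l <-> j%:R <= N%:R * (g l + K) < j%:R + 1.
    rewrite /cell /= in_itv/= lerBlDr ltrBrDr ler_pdivrMr// ltr_pdivlMr//.
    by rewrite ![_ * N%:R]mulrC.
  split; last by move=> je; apply: (proj2 cE); rewrite je /= t1 natr1.
  move=> cj; have /andP[j1 j2] := proj1 cE cj; apply/val_inj => /=; apply/eqP.
  have := le_lt_trans j1 t2; rewrite ltr_nat ltnS => h1.
  by have := le_lt_trans t1 j2; rewrite natr1 ltr_nat ltnS => h2; rewrite eqn_leq h1.
have ReG l : `|complex.Re (G l)| <= K.
  rewrite -(@ler_pXn2r _ 2)// ?nnegrE ?(ltW K0)// real_normK ?num_real//.
  exact: le_trans (sqr_Re_le _) (GK l).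
have ImG l : `|complex.Im (G l)| <= K.
  rewrite -(@ler_pXn2r _ 2)// ?nnegrE ?(ltW K0)// real_normK ?num_real//.
  by apply: le_trans (GK l); rewrite /normc2 lerDr sqr_ge0.
pose J : finType := ('I_M * 'I_M)%type.
pose c (j : J) : R[i] := Complex (j.1%:R / N%:R - K) (j.2%:R / N%:R - K).
pose A (j : J) := cell (fun l => complex.Re (G l)) j.1 `&` cell (fun l => complex.Im (G l)) j.2.
exists #|J|, (fun k => c (enum_val k)), (fun k => A (enum_val k)); split.
  by move=> k; apply: measurableI; exact: mcell.
move=> l; rewrite -(@big_enum_val _ _ _ _ J (fun j => c j * (\1_(A j) l : R)%:C%C)) /=.
have [i1 h1] := cellP (fun l => complex.Re (G l)) l (ReG l); have [i2 h2] := cellP (fun l => complex.Im (G l)) l (ImG l).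
rewrite (bigD1 (i1, i2))//= big1 ?addr0; last first.
  move=> [j1 j2] jne; rewrite indicE memNset ?mulr0//= => -[/h1 /= e1 /h2 /= e2].
  by move: jne; rewrite e1 e2 eqxx.
have c1 : cell (fun l => complex.Re (G l)) i1 l by exact/h1.
have c2 : cell (fun l => complex.Im (G l)) i2 l by exact/h2.
rewrite indicE mem_set//= mulr1; apply: le_trans eN.
have sq (x i : R) : i / N%:R - K <= x < (i + 1) / N%:R - K ->
    (x - (i / N%:R - K)) ^+ 2 <= N%:R^-1 ^+ 2.
  rewrite mulrDl mul1r => /andP[x1 x2]; have := invr_gt0 (N%:R : R); rewrite N0 => n0.
  by rewrite ler_pXn2r// ?nnegrE; lra.
move: c1 c2; rewrite /cell /= !in_itv/= => /sq s1 /sq s2.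
by rewrite /normc2 !ReImE /=; lra.
Qed.

Section SpectralProcess.
Variable R : realType.
Local Notation mu := (@lebesgue_measure R).
Variables (n : nat) (f : R -> R).
Hypotheses (mf : measurable_fun setT f) (f0 : forall l, 0 <= f l).
Variable F0 : R.
Hypotheses (F00 : 0 < F0) (fF : (\int[mu]_l (f l)%:E = F0%:E)%E).

Local Notation P := (spectral_prob mf F0).
Local Notation Om := (measurableTypeR R * measurableTypeR R)%type.

(** The formal spectral representation with (1 + i l)^n / (i l)^n. Its value at a fixed t may fail
    to be square integrable near zero frequency; only the increments are bounded there. *)
Definition spectral_process (t : R) : Om -> R[i] :=
  sample F0 (fun l => expi (t * l) * ((Complex 1 l) ^+ n / (Complex 0 l) ^+ n)).

Definition spectral_increment (s t l : R) : R[i] := expi (t * l) * chi n s l.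

Definition spectral_noise (A : set R) : Om -> R[i] := sample F0 (fun l => (\1_A l : R)%:C%C).

Lemma incr_spectral_process t s :
  incr n spectral_process t s = sample F0 (spectral_increment s t).
Proof.
apply/funext => p; rewrite /incr /spectral_process /sample /spectral_increment /chi.
rewrite exprBn !mulr_suml !mulr_sumr; apply: eq_bigr => k _ /=.
rewrite expr1n mulr1 expiX -mulr_natr.
have -> : expi ((t - k%:R * s) * p.1) = expi (t * p.1) * expi (k%:R * - (p.1 * s)) :> R[i].
  by rewrite -expiD; congr expi; ring.
by ring.
Qed.

Let pi2 : 0 < 2 * pi :> R. Proof. by rewrite mulr_gt0// pi_gt0. Qed.

Lemma sqnorm_weighted_le (G : R -> R[i]) C : cmeasurable G ->
  (forall l, normc2 (G l) <= C) ->
  (sqnorm mu setT (weighted f G) <= (C * (F0 / (2 * pi)))%:E)%E.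
Proof.
move=> mG GC; apply: (@le_trans _ _ (\int[mu]_l (C / (2 * pi) * f l)%:E)%E).
  apply: mu_le_sqnorm; [exact: cmeasurable_weighted|exact: measurable_funM|].
  move=> l; rewrite normc2_weighted// mulrC mulrAC -mulrA ler_wpM2r//.
  by rewrite divr_ge0// ltW.
under eq_integral do rewrite EFinM.
rewrite ge0_integralZl//; last 3 first.
- exact/measurable_EFinP.
- by move=> x _; rewrite lee_fin.
- by rewrite lee_fin divr_ge0 ?(ltW pi2)// (le_trans (normc2_ge0 _) (GC 0)).
by rewrite fF -EFinM lee_fin mulrAC mulrA.
Qed.

Lemma sqint_weighted (G : R -> R[i]) C : cmeasurable G ->
  (forall l, normc2 (G l) <= C) -> square_integrable mu (weighted f G).
Proof.
move=> mG GC; split; first exact: cmeasurable_weighted.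
exact: le_lt_trans (sqnorm_weighted_le mG GC) (ltry _).
Qed.

Lemma cmeasurable_spectral_increment s t : cmeasurable (spectral_increment s t).
Proof. by apply: cmeasurableM; [exact: cmeasurable_expi_mulr|exact: cmeasurable_chi]. Qed.

Lemma normc2_spectral_increment s t l :
  normc2 (spectral_increment s t l) <= (8 + 4 * s ^+ 2) ^+ n.
Proof. by rewrite normc2M normc2_expi mul1r normc2_chi_le. Qed.

Lemma sqint_spectral_increment s t :
  square_integrable mu (weighted f (spectral_increment s t)).
Proof.
exact: sqint_weighted (cmeasurable_spectral_increment s t) (normc2_spectral_increment s t).
Qed.

Lemma cov_cip d (U : measurableType d) (Q : probability U R) (X Y : U -> R[i]) :
  cov Q X Y = cip Q X Y.
Proof.
rewrite /cov /expectation_c /cintegral /cip /rip; congr Complex;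
by apply: eq_Rintegral => x _; rewrite /rdot !ReImE /=; ring.
Qed.

Lemma cip_spectral_increment t0 t1 t s1 s2 :
  cip mu (weighted f (spectral_increment s1 (t0 + t))) (weighted f (spectral_increment s2 t0)) =
  cip mu (weighted f (spectral_increment s1 (t1 + t))) (weighted f (spectral_increment s2 t1)).
Proof.
have e (c : R[i]) : forall t, rip mu (weighted f (spectral_increment s1 (t0 + t)))
    (fun l => c * weighted f (spectral_increment s2 t0) l) =
  rip mu (weighted f (spectral_increment s1 (t1 + t)))
    (fun l => c * weighted f (spectral_increment s2 t1) l).
  move=> u; apply: eq_Rintegral => l _; rewrite /weighted /spectral_increment.
  have r (v : R) : rdot ((Num.sqrt (f l / (2 * pi)))%:C%C * (expi ((v + u) * l) * chi n s1 l))
      (c * ((Num.sqrt (f l / (2 * pi)))%:C%C * (expi (v * l) * chi n s2 l))) =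
    rdot ((Num.sqrt (f l / (2 * pi)))%:C%C * (expi (u * l) * chi n s1 l))
      (c * ((Num.sqrt (f l / (2 * pi)))%:C%C * chi n s2 l)).
    by rewrite (mulrDl v u l) expiD rdot_unit// normc2_expi.
  by rewrite !r.
congr Complex; last exact: e.
have := e 1 t; rewrite (_ : (fun l => 1 * _) = weighted f (spectral_increment s2 t0)); last first.
  by apply/funext => l; rewrite mul1r.
by rewrite (_ : (fun l => 1 * _) = weighted f (spectral_increment s2 t1))//;
  apply/funext => l; rewrite mul1r.
Qed.

Lemma stationary_spectral_process : stationary_increments P n spectral_process.
Proof.
split.
- move=> t; apply: cmeasurable_sample; apply: cmeasurableM; first exact: cmeasurable_expi_mulr.
  by apply: cmeasurableM; [|apply: cmeasurableV]; apply: cmeasurableX; split => //=;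
    exact: measurable_cst.
- move=> t s _; rewrite incr_spectral_process; apply: (sqint_sample mf f0 F00 fF).
    exact: cmeasurable_spectral_increment.
  exact: sqint_spectral_increment.
- move=> t s _; rewrite incr_spectral_process.
  have h c := rip_sample_cst mf f0 F00 fF c (cmeasurable_spectral_increment s t)
    (sqint_spectral_increment s t).
  rewrite /expectation_c /cintegral; apply: eq_ReIm => /=.
    by rewrite -[RHS](h 1); apply: eq_Rintegral => p _; rewrite /rdot /=; ring.
  by rewrite -[RHS](h 'i%C); apply: eq_Rintegral => p _; rewrite /rdot /=; ring.
- move=> t0 t1 t s1 s2 _ _; rewrite !incr_spectral_process !cov_cip !(cip_sample mf f0 F00 fF);
    try exact: cmeasurable_spectral_increment; try exact: sqint_spectral_increment.
  exact: cip_spectral_increment.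
Qed.

Lemma sqint_weighted_indic A : measurable A ->
  square_integrable mu (weighted f (fun l => (\1_A l : R)%:C%C)).
Proof.
move=> mA; apply: (@sqint_weighted _ 1); first exact: cmeasurable_indic.
by move=> l; rewrite normc2_real indicE; case: (_ \in _); rewrite ?expr1n ?expr0n.
Qed.

Lemma orthogonal_spectral_noise : orthogonal_random_measure P f spectral_noise.
Proof.
split.
- move=> A mA; apply: (sqint_sample mf f0 F00 fF); first exact: cmeasurable_indic.
  exact: sqint_weighted_indic.
- move=> A B mA mB AB; apply: aeW => p; rewrite /spectral_noise /sample -mulrDr -rmorphD.
  congr (_ * (_)%:C%C); rewrite !indicE in_setU.
  have [pA|pA] := boolP (p.1 \in A); have [pB|pB] := boolP (p.1 \in B);
    rewrite /= ?addr0 ?add0r//.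
  have : (A `&` B) p.1 by split; exact: set_mem.
  by rewrite AB.
- move=> A B mA mB; rewrite cov_cip (cip_sample mf f0 F00 fF); try exact: cmeasurable_indic;
    try exact: sqint_weighted_indic.
  apply: eq_ReIm => /=.
    rewrite /rip /spectral_measure /Rintegral; congr fine.
    rewrite [RHS]integral_mkcond; apply: eq_integral => l _.
    rewrite /weighted -!rmorphM /rdot /= mulr0 addr0 mulrACA -expr2 sqr_sqrtr; last first.
      by rewrite divr_ge0// ltW.
    rewrite patchE in_setI !indicE; case: (l \in A); case: (l \in B);
      by rewrite /= ?mulr1 ?mulr0 ?mul0r.
  rewrite /rip; under eq_Rintegral => l _.
    rewrite (_ : rdot _ _ = 0); first over.
    by rewrite /weighted /rdot !ReImE /=; ring.
  by rewrite Rintegral_cst ?mul0r.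
Qed.

Lemma has_spectral_density_spectral_process : has_spectral_density P n spectral_process f.
Proof.
split; first exact: stationary_spectral_process.
  by split=> //; rewrite fF ltry.
exists spectral_noise; split; first exact: orthogonal_spectral_noise.
move=> t s _; rewrite incr_spectral_process; split.
  apply: (sqint_sample mf f0 F00 fF); first exact: cmeasurable_spectral_increment.
  exact: sqint_spectral_increment.
(* The summand 1 makes K >= 1, so that the bound on G is below K^2, the form that [simple_approx]
   expects. *)
move=> e e0; pose G := spectral_increment s t; pose K := 1 + (8 + 4 * s ^+ 2) ^+ n.
have s0 : 0 <= s ^+ 2 := sqr_ge0 s.
have K1 : 1 <= K by rewrite lerDl exprn_ge0//; lra.
have GK l : normc2 (G l) <= K ^+ 2.
  apply: (le_trans (normc2_spectral_increment s t l)).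
  apply: (@le_trans _ _ K); first by rewrite lerDr.
  by rewrite expr2 ler_peMl//; lra.
pose e' := e / 2 / (F0 / (2 * pi)).
have FP : 0 < F0 / (2 * pi) by rewrite divr_gt0.
have e'0 : 0 < e' by rewrite !divr_gt0.
have [m [c [A [mA GA]]]] := simple_approx (cmeasurable_spectral_increment s t) GK
  (lt_le_trans ltr01 K1) e'0.
pose D l := G l - \sum_(k < m) c k * (\1_(A k) l : R)%:C%C.
have mD : cmeasurable D.
  apply: cmeasurableB; first exact: cmeasurable_spectral_increment.
  by apply: cmeasurable_sum => k; apply: cmeasurableM;
    [exact: cmeasurable_cst|exact: cmeasurable_indic].
have De : (sqnorm mu setT (weighted f D) < e%:E)%E.
  apply: (le_lt_trans (sqnorm_weighted_le mD GA)).
  by rewrite lte_fin /e' divfK ?gt_eqF//; lra.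
exists m, c, A; split=> //.
  apply: le_lt_trans De; rewrite le_eqVlt; apply/orP; left; apply/eqP.
  by apply: eq_integral => l _; rewrite normc2_weighted// mulrC.
rewrite (_ : (fun v => _) = sample F0 D) ?(sqnorm_sample mf f0 F00 fF)//.
apply/funext => v; rewrite /spectral_noise /sample /D mulrBr mulr_sumr.
by congr (_ - _); apply: eq_bigr => k _; rewrite mulrCA.
Qed.

End SpectralProcess.

(** * Density of the observed past *)

Section InnovationProcess.
Variables (R : realType) (d : measure_display) (U : measurableType d).
Variable P : probability U R.
Local Notation mu := (@lebesgue_measure R).
Local Notation L2 := (square_integrable P).

(* All increments are differences of increments from a common origin, whose mutual covariances
   are real by the orthogonality clause. *)
Lemma orthogonal_increments_process (eta : R -> U -> R[i]) :
  orthogonal_increments P eta -> orthogonal_process P 1 eta.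
Proof.
move=> [hL hN hO]; split=> //.
  by move=> s t; rewrite /nrm2 hN mul1r.
pose I (s t : R) (w : U) : R[i] := eta t w - eta s w.
have ri0 (F : U -> R[i]) : rip P (fun w => 'i%C * F w) F = 0.
  rewrite /rip; under eq_Rintegral => w _.
    rewrite (_ : rdot _ _ = 0); first over.
    by rewrite /rdot !ReImE /=; ring.
  by rewrite Rintegral_cst ?mul0r.
have orth b p q : b <= p -> b <= q -> rip P (fun w => 'i%C * I b p w) (I b q) = 0.
  wlog pq : p q / p <= q => [h bp bq|bp bq].
    have [|/ltW qp] := leP p q => [pq|]; first exact: h.
    rewrite rip_i_skew; [|exact: hL|exact: hL].
    by rewrite (ripC P (I b p)) (h _ _ qp bq bp) oppr0.
  rewrite (_ : I b q = fun w => I b p w + I p q w); last first.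
    by apply/funext => w; rewrite /I; ring.
  rewrite (ripDr (hL b p) (hL p q) (sqintZ 'i%C (hL b p))) ri0 add0r.
  rewrite rip_i_skew; [|exact: hL|exact: hL].
  have := hO b p p q bp (lexx p) pq; rewrite cov_cip => /(congr1 (@complex.Im R)) /= ->.
  by rewrite oppr0.
move=> s t u v; pose b := Num.min (Num.min s t) (Num.min u v).
have [bs bt] : b <= s /\ b <= t by rewrite /b !ge_min !lexx !orbT.
have [bu bv] : b <= u /\ b <= v by rewrite /b !ge_min !lexx !orbT.
have dI p q : (fun w => eta q w - eta p w) = fun w => I b q w - I b p w.
  by apply/funext => w; rewrite /I opprB addrA subrK.
rewrite [X in rip P _ X]dI.
rewrite (_ : (fun w => 'i%C * _) = fun w => 'i%C * I b t w - 'i%C * I b s w); last first.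
  by apply/funext => w; rewrite -mulrBr /I opprB addrA subrK.
have iL p : L2 (fun w => 'i%C * I b p w) by apply: sqintZ; exact: hL.
have R0 p : b <= p -> rip P (fun w => 'i%C * I b p w) (fun w => I b v w - I b u w) = 0.
  move=> bp; rewrite (ripC P _ (fun w => I b v w - I b u w)).
  rewrite (ripBl (hL b v) (hL b u) (iL p)) (ripC P (I b v)) (ripC P (I b u)).
  by rewrite !orth// subrr.
by rewrite (ripBl (iL t) (iL s) (sqintB (hL b v) (hL b u))) !R0// subrr.
Qed.

Lemma orth_integral_ointegral (eta : R -> U -> R[i]) g X :
  square_integrable mu g -> orth_integral P eta g X -> ointegral P eta g X.
Proof.
move=> gL [XL h]; split=> // e e0; have [m [c [j [jle h1 h2]]]] := h e e0.
exists [seq (j k, c k) | k <- enum 'I_m]; split.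
- by move=> _ /mapP[k _ ->] /=; exact: jle.
- rewrite -lee_fin -sqnormE; last by apply: sqintB => //; exact: sqint_stepfun.
  apply/ltW; move: h1; under eq_integral do rewrite mulr1.
  congr (_ < _)%E; apply: eq_integral => x _; congr ((normc2 (_ - _))%:E).
  by rewrite /stepfun big_map big_enum.
- have SE w : stepint eta [seq (j k, c k) | k <- enum 'I_m] w =
      \sum_(k < m) c k * (eta (j k).2 w - eta (j k).1 w).
    by rewrite /stepint big_map big_enum.
  under [X in nrm2 _ X]eq_fun do rewrite SE.
  have := ltW h2; rewrite /nrm2 => h3; rewrite -lee_fin fineK// ge0_fin_numE ?sqnorm_ge0//.
  exact: lt_trans h2 (ltry _).
Qed.

End InnovationProcess.

Section CanonicalDensity.
Variable R : realType.
Local Notation mu := (@lebesgue_measure R).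
Variable n : nat.

(** Either the choice in [W] is a genuine solution or it is the default 0. In the second case the
    residual is null and the estimates hold trivially. *)
Lemma W_cases (s : R) (phi : R -> R[i]) : L2_halfline (W n s phi) /\
  ({ae mu, forall l, fourier (W n s phi) l = chi n s l * fourier phi l} \/
   W n s phi = fun=> 0).
Proof.
rewrite /W; case: xgetP => [psi -> [p1 p2]|_]; first by split=> //; left.
by split; [exact: L2_halfline0|right].
Qed.

Lemma FT_W (s u : R) (phi : R -> R[i]) :
  FT (fun t => W n s phi (t + u)) (fun l => expi (l * u) * fourier (W n s phi) l).
Proof.
have := FT_shift (- u) (FT_fourier (proj1 (W_cases s phi))).
have -> : (fun t => W n s phi (t - - u)) = fun t => W n s phi (t + u).
  by apply/funext => t; rewrite opprK.
congr FT; apply/funext => l; by rewrite mulrN opprK.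
Qed.

Lemma EprocN (t l : R) : Eproc t (- l) = - Eproc (- t) l.
Proof.
rewrite /Eproc mulrN opprK mulNr opprK (_ : Complex 0 (- l) = - Complex 0 l); last first.
  by apply: eq_ReIm; rewrite !ReImE /= ?oppr0.
by rewrite invrN mulrN.
Qed.

Variables (f : R -> R) (phi : R -> R[i]).
Hypotheses (fd : spectral_density f) (fpos : (0 < \int[mu]_l (f l)%:E)%E).
Hypothesis hc : canonical_factorization n f phi.

(** The innovation increment over ]-b, -a] lies in the past span of eta up to time 0, hence in that
    of the increments of xi, and is close to a combination of increments at times u <= 0. Each of
    those is an integral of [W n s phi] (u - x) against eta, so the isometry carries the
    approximation to L_2(R); reflecting time and transforming yields the claim. *)
Lemma canonical_past (a b e : R) : 0 <= a -> a <= b -> 0 < e ->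
  exists (m : nat) (c : 'I_m -> R[i]) (u s : 'I_m -> R),
    (forall k, u k <= 0 /\ 0 < s k) /\
    nrm2 mu (fun l => Eproc b l - Eproc a l -
      \sum_(k < m) c k * (expi (l * u k) * fourier (W n (s k) phi) l)) <= e.
Proof.
move=> a0 ab e0; have [mf f0 ffin] := fd.
pose F0 := fine (\int[mu]_l (f l)%:E)%E.
have fF : (\int[mu]_l (f l)%:E = F0%:E)%E by rewrite fineK// ge0_fin_numE// ltW.
have F00 : 0 < F0 by rewrite -lte_fin -fF.
have [_ _ hfac] := hc.
have [eta [oi Hz MA]] := hfac _ _ _ _ (has_spectral_density_spectral_process n mf f0 F00 fF).
set P := spectral_prob mf F0 in oi Hz MA; set xi := spectral_process n F0 in Hz MA.
have op := orthogonal_increments_process oi; have [etaL _ _] := op.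
pose I := fun w => eta (- a) w - eta (- b) w.
have IH : H_orth P eta 0 I.
  split; first exact: etaL.
  move=> e' e'0; exists 1%N, (fun=> 1), (fun=> I); split.
    by move=> _; exists (- b), (- a); split=> //; rewrite ?lerN2// oppr_le0.
  rewrite (_ : (fun w => _) = fun=> 0).
    by rewrite (sqnormE (sqint0 _)) nrm2_rip rip0l lte_fin.
  by apply/funext => w; rewrite big_ord1 mul1r subrr.
have pi2 : 0 < 2 * pi :> R by rewrite mulr_gt0// pi_gt0.
rewrite -Hz in IH; have [_ /(_ (e / (2 * pi)) (divr_gt0 e0 pi2))[m [c [Y [HY cY]]]]] := IH.
have /choice[us hus] k : exists us : R * R,
    [/\ us.1 <= 0, 0 < us.2 & Y k = incr n xi us.1 us.2].
  by have [u [s [u0 s0 Yk]]] := HY k; exists (u, s).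
exists m, c, (fun k => (us k).1), (fun k => (us k).2); split.
  by move=> k; have [] := hus k.
pose w k := W n (us k).2 phi.
have wL k : L2_halfline (w k) := proj1 (W_cases _ _).
have oY k : ointegral P eta (fun x => w k ((us k).1 - x)) (Y k).
  have [u0 s0 ->] := hus k; apply: orth_integral_ointegral.
    have h := sqint_preserving (preserving_shift (us k).1) (proj1 (wL k)).
    have := sqint_preserving (preserving_opp R) h.
    by congr square_integrable; apply/funext => x; rewrite addrC.
  have := MA _ s0 (us k).1; congr (orth_integral _ _ _ _); apply/funext => x.
  case: leP => // ux; rewrite (proj2 (wL k))// subr_lt0//.
have oI : ointegral P eta (stepfun [:: ((- b, - a), 1)]) (stepint eta [:: ((- b, - a), 1)]).
  by apply: ointegral_step => // p; rewrite inE => /eqP -> /=; rewrite lerN2.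
have oS := ointegral_sum (s := index_enum 'I_m) etaL (fun k _ => ointegralZ (c k) etaL (oY k)).
have oD := ointegralB etaL oI oS.
(* Reflection sends the past interval ]-b, -a] to [a, b[, whose transform is the stated
   difference. *)
have FI : FT (fun t => stepfun [:: ((- b, - a), 1)] (- t)) (fun l => Eproc b l - Eproc a l).
  have := FT_reflect (ointegral_step (S := [:: ((- b, - a), 1)]) (@sqint_Eproc R) _).
  rewrite /FT (_ : (fun l => stepint _ _ (- l)) = fun l => Eproc b l - Eproc a l).
    by apply => p; rewrite inE => /eqP -> /=; rewrite lerN2.
  by apply/funext => l; rewrite /stepint big_seq1 /= mul1r !EprocN !opprK addrC.
have FS : FT (fun t => \sum_(k < m) c k * w k (t + (us k).1))
    (fun l => \sum_(k < m) c k * (expi (l * (us k).1) * fourier (w k) l)).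
  apply: ointegral_sum; first exact: sqint_Eproc.
  by move=> k _; apply: ointegralZ; [exact: sqint_Eproc|exact: FT_W].
rewrite (nrm2_FT (FTB FI FS)) -ler_pdivlMl// mulrC.
have := nrm2_ointegral op oD; rewrite mul1r => hn.
pose D x := stepfun [:: ((- b, - a), 1)] x - \sum_(k < m) c k * w k ((us k).1 - x).
rewrite (_ : (fun t => _ - _) = fun t => D (- t)); last first.
  apply/funext => t; rewrite /D; congr (_ - _); apply: eq_bigr => k _.
  by rewrite opprK addrC.
rewrite (nrm2_preserving (preserving_opp R)); last by have [[]] := oD.
rewrite -/(D) -hn /nrm2 -lee_fin fineK; last first.
  by rewrite ge0_fin_numE ?sqnorm_ge0//; have [_ []] := oD.
apply/ltW; apply: le_lt_trans cY; rewrite le_eqVlt; apply/orP; left; apply/eqP.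
congr (sqnorm _ _ _); apply/funext => x.
by rewrite /stepint big_seq1 /= mul1r.
Qed.

(* The span of the functions expi(l u) chi_s Phi, u <= 0, is dense in the transforms of
   L_2([0,oo)) because the observed past of the increments and that of eta have the same span. *)
Lemma canonical_hardy_multiplier (k : R -> R[i]) C : cmeasurable k ->
  (forall l, normc2 (k l) <= C) -> hardy (fun l => k l * fourier phi l) ->
  forall psi Psi, L2_halfline psi -> FT psi Psi -> hardy (fun l => k l * Psi l).
Proof.
move=> mk kC hk psi Psi psiL FP.
have C0 : 0 <= C := le_trans (normc2_ge0 _) (kC 0).
(* Because k is bounded, the set of F with k F in the Hardy class is closed, so a dense family
   suffices. *)
have lim (F : R -> R[i]) : square_integrable mu F ->
    (forall e, 0 < e -> exists G, [/\ square_integrable mu G, hardy (fun l => k l * G l) &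
       nrm2 mu (fun l => F l - G l) <= e]) -> hardy (fun l => k l * F l).
  move=> FL h; apply: hardy_lim; first exact: (mu_sqintM mk kC).
  move=> e e0; have eC : 0 < e / (C + 1) by rewrite divr_gt0// ltr_wpDl.
  have [G [GL hG nG]] := h _ eC; exists (fun l => k l * G l); split=> //.
  rewrite (_ : (fun l => _ - _) = fun l => k l * (F l - G l)); last first.
    by apply/funext => l; rewrite mulrBr.
  have DL := sqintB FL GL.
  apply: (@le_trans _ _ (C * nrm2 mu (fun l => F l - G l))); last first.
    apply: (@le_trans _ _ ((C + 1) * (e / (C + 1)))).
      by apply: ler_pM => //; [exact: nrm2_ge0|rewrite lerDl].
    by rewrite mulrCA divff ?mulr1// gt_eqF// ltr_wpDl.
  rewrite -lee_fin -sqnormE; last exact: (mu_sqintM mk kC).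
  apply: (@le_trans _ _ (\int[mu]_l (C * normc2 (F l - G l))%:E)%E).
    apply: mu_le_sqnorm; first by apply: cmeasurableM => //; case: DL.
      by apply: measurable_funM => //; apply: measurable_normc2; case: DL.
    by move=> l; rewrite normc2M ler_wpM2r// normc2_ge0.
  under eq_integral do rewrite EFinM.
  rewrite ge0_integralZl_EFin//; last 2 first.
  - by move=> x _; rewrite lee_fin normc2_ge0.
  - by apply/measurable_EFinP; apply: measurable_normc2; case: DL.
  by rewrite EFinM -(sqnormE DL).
(* k commutes with chi_s, and chi_s is causal. *)
have hW s : 0 < s -> hardy (fun l => k l * fourier (W n s phi) l).
  move=> s0; have [WL [Wae|W0]] := W_cases s phi.
    apply: hardy_ae (hardy_chi n (ltW s0) hk) _ _.
      by apply: cmeasurableM => //; have [_ [[]]] := FT_fourier WL.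
    by apply: ae_imp Wae => l ->; rewrite mulrCA.
  rewrite W0; apply: (@hardy_ae _ (fun=> 0)).
  - by have := hardyZ 0 hk; under eq_fun do rewrite mul0r.
  - by apply: cmeasurableM => //; have [_ [[]]] := FT_fourier (L2_halfline0 R).
  - by apply: ae_imp (fourier0 R) => l ->; rewrite mulr0.
(* exp(i l u) with u <= 0 is a delay, so each approximating combination remains in the Hardy class
   after multiplication by k. *)
have hE a b : 0 <= a -> a <= b -> hardy (fun l => k l * (Eproc b l - Eproc a l)).
  move=> a0 ab; apply: lim; first exact: sqint_Eproc.
  move=> e e0; have [m [c [u [s [us h]]]]] := canonical_past a0 ab e0.
  exists (fun l => \sum_(j < m) c j * (expi (l * u j) * fourier (W n (s j) phi) l)); split=> //.
    apply: sqint_sum => j; apply: sqintZ.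
    by have [] := FT_W (s j) (u j) phi.
  rewrite (_ : (fun l => _) = fun l => \sum_(j < m) c j *
      (expi (- (l * - u j)) * (k l * fourier (W n (s j) phi) l))).
    apply: hardy_sum => j; apply: hardyZ; apply: hardy_shift; last exact: hW (proj2 (us j)).
    by rewrite oppr_ge0; case: (us j).
  apply/funext => l; rewrite mulr_sumr; apply: eq_bigr => j _.
  by rewrite mulrN opprK; ring.
apply: lim; first by case: FP.
move=> e e0; have pi2 : 0 < 2 * pi :> R by rewrite mulr_gt0// pi_gt0.
have mD : measurable (`]0, +oo[%classic : set R) by exact: measurable_itv.
have [||||S [oS S0 S1]] := @step_dense_on _ `]0, +oo[%classic (Num.max 0) psi (e / (2 * pi)) mD _ _ (proj1 psiL).
- by move=> a b ab; rewrite ge_max le_max lexx /= le_max ab orbT.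
- move=> a b x ab; rewrite !indicE !mem_setE !in_itv/= gt_max le_max andbT.
  by case: (ltP 0 x) => x0; rewrite ?mul0r// mul1r.
- move: (ae_neq (0 : R)); apply: ae_imp => x x0; rewrite indicE mem_setE in_itv/= andbT.
  by case: ltgtP x0 => // x0 _; rewrite ?mul1r// (proj2 psiL)// mulr0.
- by rewrite divr_gt0.
exists (stepint (@Eproc R) S); split.
- by case: (ointegral_step (@sqint_Eproc R) oS).
- rewrite (_ : (fun l => _) = fun l => \sum_(p <- S)
      p.2 * (k l * (Eproc (Num.max 0 p.1.2) l - Eproc (Num.max 0 p.1.1) l))).
    apply: hardy_sum => p; apply: hardyZ.
    have [h|/ltW h] := leP (Num.max 0 p.1.1) (Num.max 0 p.1.2).
      by apply: hE => //; rewrite le_max lexx.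
    have := hardyZ (-1) (hE _ _ _ h); rewrite le_max lexx => /(_ isT).
    by congr hardy; apply/funext => l; ring.
  apply/funext => l; rewrite /stepint mulr_sumr; apply: eq_big_seq => p pS.
  have [a [b pab]] := S0 _ pS.
  have m0 (x : R) : Num.max 0 (Num.max 0 x) = Num.max 0 x by rewrite maxA maxxx.
  have -> : Num.max 0 p.1.1 = p.1.1 by rewrite pab; exact: m0.
  have -> : Num.max 0 p.1.2 = p.1.2 by rewrite pab; exact: m0.
  exact: mulrCA.
rewrite (nrm2_FT (FTB FP (ointegral_step (@sqint_Eproc R) oS))) -ler_pdivlMl//.
by rewrite mulrC.
Qed.

End CanonicalDensity.

(** * The prediction error and its extremal bound *)

Section Prediction.
Variable R : realType.
Local Notation mu := (@lebesgue_measure R).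

Lemma sqnorm_segment (T : R) f : L2_segment T f ->
  sqnorm mu `[0, T] f = sqnorm mu setT f.
Proof.
move=> [_ f0]; rewrite /sqnorm [LHS]integral_mkcond; apply: eq_integral => t _.
rewrite patchE mem_setE in_itv/=; case: ifPn => // /f0 ->.
by rewrite normc2_0.
Qed.

(** The hypothesis says that F - r is orthogonal to r: a projection does not increase the norm. *)
Lemma nrm2_hardyB (F r : R -> R[i]) : square_integrable mu F -> square_integrable mu r ->
  rip mu F r = nrm2 mu r -> nrm2 mu r <= nrm2 mu F.
Proof.
move=> FL rL Fr; have := nrm2_ge0 mu (fun l => F l - r l).
by rewrite nrm2B// Fr; lra.
Qed.

Lemma nrm2_fourier (phi : R -> R[i]) : L2_halfline phi -> nrm2 mu (fourier phi) = 2 * pi * nrm2 mu phi.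
Proof. by move=> /FT_fourier /nrm2_FT. Qed.

Lemma cmeasurable_fourier (phi : R -> R[i]) : L2_halfline phi -> cmeasurable (fourier phi).
Proof. by move=> /FT_fourier[_ []]. Qed.

Lemma sqint_fourier (phi : R -> R[i]) : L2_halfline phi -> square_integrable mu (fourier phi).
Proof. by move=> /FT_fourier[]. Qed.

Lemma sqint_chi n (s : R) F : square_integrable mu F ->
  square_integrable mu (fun l => chi n s l * F l).
Proof.
move=> FL; apply: (@mu_sqintM _ (chi n s) ((8 + 4 * s ^+ 2) ^+ n)) => //.
  exact: cmeasurable_chi.
by move=> l; exact: normc2_chi_le.
Qed.

Variables (n : nat) (tau T : R) (a : R -> R[i]).
Hypotheses (htau : 0 < tau) (hT : 0 < T).
Hypothesis ha1 : cintegrable mu `[0, T] (Da n tau T a).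
Hypothesis ha2 : (\int[mu]_(t in `[0%R, T]) (t * normc2 (Da n tau T a t))%:E < +oo)%E.

Let b := bker n tau T a.
Let A := A_char n tau T a.
Let kap (phi : R -> R[i]) (s : R) : R[i] := future_corr b (W n tau phi) s +
  (\1_[set 0 : R] s : R)%:C%C * DA n tau T a (W n tau phi) 0.

(* At s = 0 the kernel of DA need not be integrable, and DA takes an irrelevant value. *)
Let DA_kap phi s : 0 <= s <= T -> DA n tau T a (W n tau phi) s = kap phi s.
Proof.
move=> /andP[s0 sT]; have [WL _] := W_cases n tau phi; rewrite /kap.
have [->|s1] := eqVneq s 0.
  by rewrite /future_corr ltxx add0r indicE mem_set// mul1r.
have s2 : 0 < s by rewrite lt_neqAle eq_sym s1.
rewrite /future_corr s2 (DA_correlation htau hT ha1 ha2 WL) ?s2//.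
by rewrite indicE memNset ?mul0r ?addr0//=; exact/eqP.
Qed.

Let kap_ae phi : {ae mu, forall s, kap phi s = future_corr b (W n tau phi) s}.
Proof.
apply: ae_imp (ae_neq (0 : R)) => s s0; rewrite /kap indicE memNset ?mul0r ?addr0//=.
exact/eqP.
Qed.

Let fc_segment phi : L2_segment T (future_corr b (W n tau phi)).
Proof. by apply: future_corr_segment => //; exact: (proj1 (W_cases n tau phi)). Qed.

Let kap_segment phi : L2_segment T (kap phi).
Proof.
have [fL f0] := fc_segment phi; split.
  apply: (@sqint_ae _ _ _ mu (future_corr b (W n tau phi))) => //.
    apply: cmeasurableD; first by case: fL.
    by apply: cmeasurableM; [exact: cmeasurable_indic|exact: cmeasurable_cst].
  by apply: ae_imp (kap_ae phi) => s ->.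
move=> s sT; rewrite /kap f0// add0r indicE memNset ?mul0r//= => s0.
by move: sT; rewrite s0 lexx ltW.
Qed.

Definition residual (phi : R -> R[i]) : R -> R[i] := fourier_pos T (DA n tau T a (W n tau phi)).

Let residualE phi : residual phi = fourier_pos T (kap phi).
Proof.
apply/funext => l; rewrite /residual !fourier_pos_neg.
by rewrite (eq_fourier_neg (DA_kap phi)).
Qed.

Let FT_residual phi : FT (fun t => kap phi (- t)) (residual phi).
Proof. by rewrite residualE; apply: FT_fourier_pos (ltW hT) (kap_segment phi). Qed.

Lemma sqint_residual phi : square_integrable mu (residual phi).
Proof. by case: (FT_residual phi). Qed.

Lemma DAW_residual phi : DAW_norm2 n tau T a phi = ((2 * pi)^-1 * nrm2 mu (residual phi))%:E.
Proof.
have -> : DAW_norm2 n tau T a phi = sqnorm mu `[0, T] (kap phi).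
  rewrite /DAW_norm2 /sqnorm; apply: eq_integral => t.
  by rewrite inE/= in_itv/= => /DA_kap ->.
rewrite (sqnorm_segment (kap_segment phi)) (sqnormE (proj1 (kap_segment phi))).
have pi0 := pi_gt0 R.
rewrite (nrm2_FT (FT_residual phi)) mulrA mulVf ?mul1r; last by rewrite gt_eqF// mulr_gt0.
by rewrite (nrm2_preserving (preserving_opp R))//; case: (kap_segment phi) => [[]].
Qed.

Lemma hardy_residual F phi : hardy F -> rip mu F (residual phi) = 0.
Proof.
move=> [_ h]; apply: h (FT_residual phi) _ => t t0; apply: (proj2 (kap_segment phi)).
by rewrite negb_and -!ltNge oppr_lt0 t0.
Qed.

Lemma A_char_bounded : exists C, forall l, normc2 (A l) <= C.
Proof.
have [C hC] := multiplier_bounded (measurable_itv `[0, T]) (unit_kernel_pos R)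
  (cmeasurable_bker ha1) (cintegrable_bker ha1).
by exists C => l; rewrite /A A_char_multiplier.
Qed.

Lemma cmeasurable_A_char : cmeasurable A.
Proof.
have := cmeasurable_multiplier (measurable_itv `[0, T]) (unit_kernel_pos R)
  (cmeasurable_bker ha1).
by congr cmeasurable; apply/funext => l; rewrite /A A_char_multiplier.
Qed.

Let Psi phi := fourier (W n tau phi).

Lemma sqint_A_char F : square_integrable mu F -> square_integrable mu (fun l => A l * F l).
Proof. by have [C hC] := A_char_bounded; exact: (mu_sqintM cmeasurable_A_char hC). Qed.

Lemma hardy_A_char phi : hardy (fun l => A l * Psi phi l - residual phi l).
Proof.
have WL := proj1 (W_cases n tau phi).
have FR : FT (fun t => future_corr b (W n tau phi) (- t)) (residual phi).
  have := FT_residual phi; rewrite residualE => h; apply: FT_ae_l h _ _.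
    by apply: (cmeasurable_preserving (preserving_opp R)); case: (fc_segment phi) => [[]].
  apply: ae_imp (ae_neq (0 : R)) => t t0; rewrite /kap indicE memNset ?mul0r ?addr0//=.
  by move/eqP; rewrite oppr_eq0 (negbTE t0).
have := hardy_defect (cmeasurable_bker ha1) (@bker_out R n tau T a) (cintegrable_bker ha1)
  (bker_weight ha2) WL (FT_fourier WL) FR.
by congr hardy; apply/funext => l; rewrite /A A_char_multiplier.
Qed.

(** A Psi differs from its residual by a member of the Hardy class, which is orthogonal to every
    residual. *)
Lemma rip_A_char phi phi' :
  rip mu (fun l => A l * Psi phi l) (residual phi') = rip mu (residual phi) (residual phi').
Proof.
have WL := proj1 (W_cases n tau phi); have [_ PL _] := FT_fourier WL.
have rL := sqint_residual phi; have rL' := sqint_residual phi'.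
have := hardy_residual phi' (hardy_A_char phi).
by rewrite (ripBl (sqint_A_char PL) rL rL') => /eqP; rewrite subr_eq0 => /eqP.
Qed.

Lemma residual_W0 phi : W n tau phi = (fun=> 0) -> nrm2 mu (residual phi) = 0.
Proof.
move=> W0; rewrite nrm2_rip -rip_A_char /Psi W0.
have [_ PL _] := FT_fourier (L2_halfline0 R).
rewrite -(@eq_rip_ae _ _ _ mu (fun=> 0)) ?rip0l//.
- exact: sqint0.
- exact: sqint_A_char.
- exact: sqint_residual.
- by apply: ae_imp (fourier0 R) => l ->; rewrite mulr0.
Qed.

Section Core.
Variables (f : R -> R) (phi0 : R -> R[i]) (s2 : R).
Hypotheses (fd : spectral_density f) (fpos : (0 < \int[mu]_l (f l)%:E)%E).
Hypotheses (hc : canonical_factorization n f phi0) (s20 : 0 < s2).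
Hypothesis r0 : {ae mu, forall l,
  normc2 (residual phi0 l) = s2 * normc2 (fourier phi0 l)}.

Let phi0L : L2_halfline phi0. Proof. by case: hc. Qed.
(** The cut to [E] makes the quotient bounded by s2 at every frequency and not just almost
    everywhere, as multiplier lemmas require; where Phi0 is 0 the quotient is 0 by division by
    zero. *)
Let E : set R := [set l | normc2 (residual phi0 l) <= s2 * normc2 (fourier phi0 l)].
Let g l : R[i] := (\1_E l : R)%:C%C * (residual phi0 l / fourier phi0 l).

Let mg : cmeasurable g.
Proof.
have mr : cmeasurable (residual phi0) by case: (sqint_residual phi0).
have mF := cmeasurable_fourier phi0L.
apply: cmeasurableM; last by apply: cmeasurableM => //; exact: cmeasurableV.
apply: cmeasurable_indic.
have h : measurable_fun setT (fun l => normc2 (residual phi0 l) <= s2 * normc2 (fourier phi0 l)).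
  apply: measurable_fun_ler; first exact: measurable_normc2.
  by apply: measurable_funM => //; exact: measurable_normc2.
by have := h measurableT [set true]; rewrite setTI; apply.
Qed.

Let g_le l : normc2 (g l) <= s2.
Proof.
rewrite /g indicE; have [lE|_] := boolP (l \in E); last by rewrite mul0r normc2_0 ltW.
rewrite mul1r normc2M normc2V; have [h|h] := eqVneq (normc2 (fourier phi0 l)) 0.
  by rewrite h invr0 mulr0 ltW.
have h0 : 0 < normc2 (fourier phi0 l) by rewrite lt_neqAle eq_sym h normc2_ge0.
by rewrite ler_pdivrMr//; move: lE; rewrite inE.
Qed.

Let g_ae : {ae mu, forall l, g l * fourier phi0 l = residual phi0 l}.
Proof.
apply: ae_imp r0 => l rl; rewrite /g indicE mem_set ?mul1r; last by rewrite /E /= rl.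
have [h|h] := eqVneq (fourier phi0 l) 0; last by rewrite divfK.
move/eqP: rl; rewrite h normc2_0 mulr0 normc2_eq0 => /eqP ->.
by rewrite mulr0.
Qed.

Let k l : R[i] := A l * chi n tau l - g l.

Let mk : cmeasurable k.
Proof.
apply: cmeasurableB mg; apply: cmeasurableM; first exact: cmeasurable_A_char.
exact: cmeasurable_chi.
Qed.

Let k_bounded : exists C, forall l, normc2 (k l) <= C.
Proof.
have [C hC] := A_char_bounded; have C0 := le_trans (normc2_ge0 _) (hC 0).
exists (2 * (C * (8 + 4 * tau ^+ 2) ^+ n) + 2 * s2) => l.
apply: le_trans (normc2D_le _ _) _; rewrite normc2N lerD// ler_wpM2l//.
by rewrite normc2M; apply: ler_pM; rewrite ?normc2_ge0// normc2_chi_le.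
Qed.

Let gL F : square_integrable mu F -> square_integrable mu (fun l => g l * F l).
Proof. exact: (mu_sqintM mg g_le). Qed.

(** Rules out that [W] takes its default value at [phi0], which would make this residual null. *)
Let fourier0_neq0 : nrm2 mu (residual phi0) != 0.
Proof.
apply/negP => /eqP n0.
have rz := @nrm2_eq0 _ _ _ mu _ (sqint_residual phi0) n0.
have [_ ff _] := hc; have [mf f0 _] := fd.
have fz : {ae mu, forall l, f l = 0}.
  have h : {ae mu, forall l, fourier phi0 l = 0}.
    apply: ae_imp2 rz r0 => l -> /eqP; rewrite normc2_0 eq_sym mulf_eq0 (gt_eqF s20) /=.
    by rewrite normc2_eq0 => /eqP.
  by apply: ae_imp2 ff h => l -> ->; rewrite normc2_0.
move: fpos; rewrite (ae_eq_integral (cst 0%E)) ?integral0 ?ltxx//.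
- exact/measurable_EFinP.
- by apply: ae_imp fz => l -> _.
Qed.

Let hardy_k phi : L2_halfline phi -> hardy (fun l => k l * fourier phi l).
Proof.
move=> pL; have [C hC] := k_bounded.
apply: (canonical_hardy_multiplier fd fpos hc mk hC) pL (FT_fourier pL).
have [WL [Wae|/residual_W0 W0]] := W_cases n tau phi0; last by move: fourier0_neq0; rewrite W0 eqxx.
apply: hardy_ae (hardy_A_char phi0) _ _.
  by apply: cmeasurableM => //; exact: cmeasurable_fourier.
apply: ae_imp2 Wae g_ae => l W1 g1.
by rewrite /k mulrBl g1 /Psi W1 mulrA.
Qed.

(* The multiplier g = r0 / Phi0 has modulus at most sqrt s2, and the residual of any phi is the
   projection of g Phi to the transforms of functions of the past. *)
Let rip_g phi : L2_halfline phi ->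
  {ae mu, forall l, Psi phi l = chi n tau l * fourier phi l} ->
  rip mu (fun l => g l * fourier phi l) (residual phi) = nrm2 mu (residual phi).
Proof.
move=> pL Wae; have FL := sqint_fourier pL; have rL := sqint_residual phi.
have WL := sqint_fourier (proj1 (W_cases n tau phi)).
have cL := sqint_chi n tau FL.
have e1 : rip mu (fun l => A l * Psi phi l) (residual phi) =
    rip mu (fun l => A l * (chi n tau l * fourier phi l)) (residual phi).
  apply: (@eq_rip_ae _ _ _ mu _ _ _ (sqint_A_char WL) (sqint_A_char cL) rL).
  by apply: ae_imp Wae => l Wl; congr (A l * _).
have e2 := hardy_residual phi (hardy_k pL).
have e3 : (fun l => k l * fourier phi l) =
    fun l => A l * (chi n tau l * fourier phi l) - g l * fourier phi l.
  by apply/funext => l; rewrite /k mulrBl mulrA.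
rewrite e3 in e2; have e4 := ripBl (sqint_A_char cL) (gL FL) rL.
have /eqP := etrans (esym e4) e2; rewrite subr_eq0 => /eqP e5.
exact: etrans (esym e5) (etrans (esym e1) (etrans (rip_A_char phi phi) (esym (nrm2_rip mu _)))).
Qed.

Let nrm2_g phi : L2_halfline phi ->
  nrm2 mu (fun l => g l * fourier phi l) <= s2 * nrm2 mu (fourier phi).
Proof.
move=> pL; have FL := sqint_fourier pL.
rewrite -lee_fin -sqnormE; last exact: gL.
apply: (@le_trans _ _ (\int[mu]_l (s2 * normc2 (fourier phi l))%:E)%E).
  apply: mu_le_sqnorm; first by case: (gL FL).
    by apply: measurable_funM => //; apply: measurable_normc2; case: FL.
  by move=> l; rewrite normc2M ler_wpM2r// normc2_ge0.
under eq_integral do rewrite EFinM.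
rewrite ge0_integralZl_EFin//; last 3 first.
- by move=> x _; rewrite lee_fin normc2_ge0.
- by apply/measurable_EFinP; apply: measurable_normc2; case: FL.
- exact: ltW.
by rewrite EFinM -(sqnormE FL).
Qed.

Lemma residual_le phi : L2_halfline phi ->
  nrm2 mu (residual phi) <= s2 * nrm2 mu (fourier phi).
Proof.
move=> pL; have [WL [Wae|/residual_W0 ->]] := W_cases n tau phi; last first.
  by rewrite mulr_ge0 ?(ltW s20)// nrm2_ge0.
apply: le_trans (nrm2_g pL).
by apply: nrm2_hardyB (rip_g pL Wae); [exact: gL (sqint_fourier pL)|exact: sqint_residual].
Qed.

Lemma residual_eq phi : L2_halfline phi ->
  nrm2 mu (residual phi) = s2 * nrm2 mu (fourier phi) ->
  {ae mu, forall l, normc2 (residual phi l) <= s2 * normc2 (fourier phi l)}.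
Proof.
move=> pL e; have rL := sqint_residual phi; have gFL := gL (sqint_fourier pL).
have [WL [Wae|/residual_W0 W0]] := W_cases n tau phi; last first.
  apply: ae_imp (@nrm2_eq0 _ _ _ mu _ rL W0) => l ->.
  by rewrite normc2_0 mulr_ge0 ?(ltW s20)// normc2_ge0.
(* The squared distance equals the squared norm of g Phi minus that of the residual, and the assumed
   equality leaves no room between them. *)
have d0 : nrm2 mu (fun l => g l * fourier phi l - residual phi l) = 0.
  apply/eqP; rewrite eq_le nrm2_ge0 andbT (nrm2B gFL rL) (rip_g pL Wae) e.
  have := nrm2_g pL; lra.
apply: ae_imp (@nrm2_eq0 _ _ _ mu _ (sqintB gFL rL) d0) => l /eqP.
rewrite subr_eq0 => /eqP <-; rewrite normc2M ler_wpM2r ?normc2_ge0//.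
Qed.

Lemma residual0_eq : nrm2 mu (residual phi0) = s2 * nrm2 mu (fourier phi0).
Proof.
apply/eqP; rewrite eq_le residual_le//=.
have FL := sqint_fourier phi0L; have rL := sqint_residual phi0.
have -> : s2 * nrm2 mu (fourier phi0) = nrm2 mu (residual phi0); last by [].
rewrite /nrm2; transitivity (fine (s2%:E * sqnorm mu setT (fourier phi0))).
  by rewrite (sqnormE FL).
congr fine; rewrite /sqnorm -ge0_integralZl_EFin//; last 3 first.
- by move=> x _; rewrite lee_fin normc2_ge0.
- by apply/measurable_EFinP; apply: measurable_normc2; case: FL.
- exact: ltW.
apply: ae_eq_integral => //.
- by apply/measurable_EFinP; apply: measurable_funM => //; apply: measurable_normc2; case: FL.
- by apply/measurable_EFinP; apply: measurable_normc2; case: rL.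
- by apply: ae_imp r0 => l -> _; rewrite EFinM.
Qed.

End Core.
End Prediction.

(** * Mean square errors over the class *)

Section ChiZeros.
Variable R : realType.
Local Notation mu := (@lebesgue_measure R).

(** Two solutions with the same integer part of l s have values of l s less than 1 apart, where
    injectivity of the cosine on [0, pi] makes them equal. Integer parts thus enumerate the
    solutions. *)
Lemma countable_expi1 (s : R) : 0 < s -> countable [set l : R | expi (- (l * s)) = 1 :> R[i]].
Proof.
move=> s0; apply/countable_injP; exists (fun l => pickle (Num.floor (l * s))).
move=> l l'; rewrite !inE /= => -[c1 s1] [c2 s2] /(pcan_inj pickleK) fe.
have /andP[a1 a2] := floor_itv (l * s); have /andP[b1 b2] := floor_itv (l' * s).
rewrite -fe in b1 b2; rewrite intrD in a2 b2.
have d1 : `|l * s - l' * s| < 1 by rewrite ltr_norml; apply/andP; split; lra.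
rewrite cosN in c1; rewrite cosN in c2; rewrite sinN in s1; rewrite sinN in s2.
have c : cos `|l * s - l' * s| = cos 0.
  rewrite cos_norm cosB c1 c2 cos0 (_ : sin (l * s) = 0) ?mul0r ?mulr1 ?addr0//.
  by rewrite -[LHS]opprK s1 oppr0.
have pi1 : 1 <= pi :> R by apply: le_trans (pi_ge2 R); rewrite -[1]/(1%:R) ler_nat.
have /eqP : `|l * s - l' * s| = 0.
  apply: (cos_inj _ _ c); rewrite in_itv/= ?lexx ?(ltW (pi_gt0 R))//.
  by rewrite normr_ge0 (le_trans (ltW d1) pi1).
rewrite normr_eq0 subr_eq0 => /eqP h.
by apply: (@mulIf _ s) => //; rewrite gt_eqF.
Qed.

Lemma ae_chi_neq0 n (s : R) : 0 < s -> {ae mu, forall l, chi n s l != 0}.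
Proof.
move=> s0; pose E := [set l : R | expi (- (l * s)) = 1 :> R[i]].
have cE := countable_expi1 s0.
have hE : {ae mu, forall l, ~ E l}.
  exists E; split; [exact: countable_measurable|exact: countable_lebesgue_measure0|].
  by move=> l /= /contrapT.
apply: ae_imp2 hE (ae_neq (0 : R)) => l lE l0.
rewrite /chi !mulf_neq0 ?invr_eq0 ?expf_neq0//.
- by rewrite subr_eq0 eq_sym; apply/eqP.
- by rewrite eq_complex /= oner_eq0.
- by rewrite eq_complex /= eqxx (negbTE l0).
Qed.

End ChiZeros.

Section Robustness.
Variable R : realType.
Local Notation mu := (@lebesgue_measure R).
Implicit Types (f : R -> R) (phi h : R -> R[i]).
Variables (n : nat) (tau T : R) (a : R -> R[i]).
Hypotheses (htau : 0 < tau) (hT : 0 < T).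
Hypothesis ha1 : cintegrable mu `[0, T] (Da n tau T a).
Hypothesis ha2 : (\int[mu]_(t in `[0%R, T]) (t * normc2 (Da n tau T a t))%:E < +oo)%E.

Local Notation res := (residual n tau T a).
Local Notation Psi phi := (fourier (W n tau phi)).
Local Notation A := (A_char n tau T a).

Let pi2 : 0 < 2 * pi :> R. Proof. by rewrite mulr_gt0// pi_gt0. Qed.
Let mres phi : cmeasurable (res phi).
Proof. by case: (sqint_residual htau hT ha1 ha2 phi). Qed.
Let mPsi phi : cmeasurable (Psi phi).
Proof. by apply: cmeasurable_fourier; case: (W_cases n tau phi). Qed.

Lemma mse_opt_charE phi f : mse n tau T a (opt_char n tau T a phi) f =
  (((2 * pi)^-1)%:E * \int[mu]_l (normc2 (res phi l / Psi phi l)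
    * normc2 (chi n tau l) * f l)%:E)%E.
Proof.
congr (_ * _)%E; apply: eq_integral => l _; rewrite /opt_char.
by rewrite opprB addrC subrK.
Qed.

Let m_integrand phi f : measurable_fun setT f -> measurable_fun setT
  (fun l => normc2 (res phi l / Psi phi l) * normc2 (chi n tau l) * f l).
Proof.
move=> mf; apply: measurable_funM => //; apply: measurable_funM; apply: measurable_normc2.
  by apply: cmeasurableM => //; exact: cmeasurableV.
exact: cmeasurable_chi.
Qed.

Let le_mse (I J : \bar R) : (I <= J)%E -> (((2 * pi)^-1)%:E * I <= ((2 * pi)^-1)%:E * J)%E.
Proof. by move=> IJ; apply: lee_wpmul2l => //; rewrite lee_fin invr_ge0 ltW. Qed.

Let res_nrm2 phi : (((2 * pi)^-1)%:E * sqnorm mu setT (res phi) =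
  ((2 * pi)^-1 * nrm2 mu (res phi))%:E)%E.
Proof. by rewrite (sqnormE (sqint_residual htau hT ha1 ha2 phi)) EFinM. Qed.

Let Psi0_ae phi : W n tau phi = (fun=> 0) -> {ae mu, forall l, Psi phi l = 0}.
Proof. by move=> ->; exact: fourier0. Qed.

(** Only an upper bound: on the zeros of Psi the quotient defining the characteristic is 0 by
    default, while the residual may be nonzero there. *)
Lemma mse_opt_char_le phi f : measurable_fun setT f -> (forall l, 0 <= f l) ->
  {ae mu, forall l, f l = normc2 (fourier phi l)} ->
  (mse n tau T a (opt_char n tau T a phi) f <= ((2 * pi)^-1 * nrm2 mu (res phi))%:E)%E.
Proof.
move=> mf f0 ff; rewrite mse_opt_charE -res_nrm2; apply: le_mse.
have mr := measurable_normc2 (mres phi).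
apply: (@ae_ge0_le_integral _ _ _ mu) => //.
- by move=> l _; rewrite lee_fin !mulr_ge0 ?normc2_ge0.
- by apply/measurable_EFinP; exact: m_integrand.
- by move=> l _; rewrite lee_fin normc2_ge0.
- exact/measurable_EFinP.
have [_ [Wae|/Psi0_ae W0]] := W_cases n tau phi; last first.
  by apply: ae_imp W0 => l -> _; rewrite invr0 mulr0 normc2_0 !mul0r lee_fin normc2_ge0.
apply: ae_imp2 Wae ff => l Wl -> _; rewrite lee_fin -mulrA -normc2M -Wl -normc2M.
have [->|h] := eqVneq (Psi phi l) 0; first by rewrite mulr0 normc2_0 normc2_ge0.
by rewrite divfK.
Qed.

(** The domination of the residual by Phi makes it vanish wherever Psi does, almost everywhere,
    since chi has only a null set of zeros. Nothing is then lost to division by zero. *)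
Lemma mse_opt_char_ge phi f s2 : measurable_fun setT f -> (forall l, 0 <= f l) ->
  {ae mu, forall l, f l = normc2 (fourier phi l)} ->
  {ae mu, forall l, normc2 (res phi l) <= s2 * normc2 (fourier phi l)} ->
  (((2 * pi)^-1 * nrm2 mu (res phi))%:E <= mse n tau T a (opt_char n tau T a phi) f)%E.
Proof.
move=> mf f0 ff rf; rewrite mse_opt_charE.
have [_ [Wae|/(residual_W0 htau hT ha1 ha2) ->]] := W_cases n tau phi; last first.
  rewrite mulr0; apply: mule_ge0; first by rewrite lee_fin invr_ge0 ltW.
  by apply: integral_ge0 => l _; rewrite lee_fin !mulr_ge0 ?normc2_ge0.
rewrite -res_nrm2; apply: le_mse.
have mr := measurable_normc2 (mres phi).
apply: (@ae_ge0_le_integral _ _ _ mu) => //.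
- by move=> l _; rewrite lee_fin normc2_ge0.
- exact/measurable_EFinP.
- by move=> l _; rewrite lee_fin !mulr_ge0 ?normc2_ge0.
- by apply/measurable_EFinP; exact: m_integrand.
have h : {ae mu, forall l, normc2 (res phi l) <= s2 * normc2 (fourier phi l) /\
    chi n tau l != 0} by apply: ae_imp2 rf (ae_chi_neq0 n htau).
have h2 : {ae mu, forall l, Psi phi l = chi n tau l * fourier phi l /\
    f l = normc2 (fourier phi l)} by apply: ae_imp2 Wae ff.
apply: ae_imp2 h h2 => l [rl cl] [Wl ->] _.
rewrite lee_fin -mulrA -normc2M -Wl -normc2M.
have [h0|h0] := eqVneq (fourier phi l) 0; last first.
  have P0 : Psi phi l != 0 by rewrite Wl; exact: mulf_neq0 cl h0.
  by rewrite (divfK P0).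
by move: rl; rewrite h0 normc2_0 mulr0 => h1; apply: le_trans h1 (normc2_ge0 _).
Qed.

(** chi cancels between Psi and the weight, so the error integrand is |r/Phi|^2 f <= s2 f, and only
    the total mass of f enters. *)
Lemma mse_opt_char_D0 P0 phi f s2 : 0 <= s2 -> D0 P0 f ->
  {ae mu, forall l, normc2 (res phi l) <= s2 * normc2 (fourier phi l)} ->
  (mse n tau T a (opt_char n tau T a phi) f <= (s2 * P0)%:E)%E.
Proof.
move=> s20 [[mf f0 ffin] fP] rf; rewrite mse_opt_charE.
apply: (@le_trans _ _ (((2 * pi)^-1)%:E * \int[mu]_l (s2%:E * (f l)%:E))%E).
  apply: le_mse; apply: (@ae_ge0_le_integral _ _ _ mu) => //.
  - by move=> l _; rewrite lee_fin !mulr_ge0 ?normc2_ge0.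
  - by apply/measurable_EFinP; exact: m_integrand.
  - by move=> l _; rewrite lee_fin mulr_ge0.
  - by apply/measurable_EFinP; exact: measurable_funM.
  have [_ [Wae|/Psi0_ae W0]] := W_cases n tau phi; last first.
    by apply: ae_imp W0 => l -> _; rewrite invr0 mulr0 normc2_0 !mul0r lee_fin mulr_ge0.
  apply: ae_imp2 Wae rf => l Wl rl _; rewrite lee_fin ler_wpM2r//.
  rewrite -normc2M Wl; have [h|h] := eqVneq (chi n tau l * fourier phi l) 0.
    by rewrite h invr0 mulr0 mul0r normc2_0.
  have [c0 F0] : chi n tau l != 0 /\ fourier phi l != 0.
    by apply/andP; move: h; rewrite mulf_eq0 negb_or.
  have cancel (r c z : R[i]) : c != 0 -> r / (c * z) * c = r / z.
    by move=> cn; rewrite invfM mulrAC mulrA mulfK.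
  rewrite (cancel _ _ _ c0).
  rewrite normc2M normc2V ler_pdivrMr// lt_neqAle normc2_ge0 andbT eq_sym normc2_eq0//.
rewrite ge0_integralZl_EFin//; last 2 first.
- by move=> l _; rewrite lee_fin.
- exact/measurable_EFinP.
rewrite muleCA EFinM; exact: lee_wpmul2l.
Qed.

(** Multiplication by Phi is an isometry from L_2(f) to L_2(R). It sends the generators chi G, with
    G the transform of a causal integrable function, into the Hardy class, which is closed. *)
Lemma hardy_L2_minus phi f h : L2_halfline phi ->
  {ae mu, forall l, f l = normc2 (fourier phi l)} -> measurable_fun setT f ->
  L2_minus n tau f h -> hardy (fun l => h l * chi n tau l * fourier phi l).
Proof.
move=> pL ff mf [mX Xf Xg]; have FL := sqint_fourier pL.
have mF := cmeasurable_fourier pL.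
have Ef (Y : R -> R[i]) : cmeasurable Y ->
    (\int[mu]_l (normc2 (Y l) * f l)%:E)%E = sqnorm mu setT (fun l => Y l * fourier phi l).
  move=> mY; apply: ae_eq_integral => //.
  - by apply/measurable_EFinP; apply: measurable_funM => //; exact: measurable_normc2.
  - by apply/measurable_EFinP; apply: measurable_normc2; exact: cmeasurableM.
  - by apply: ae_imp ff => l -> _; rewrite normc2M.
rewrite Ef// in Xf.
apply: hardy_lim; first by split; [exact: cmeasurableM|].
move=> e e0; have [g [ig gX]] := Xg e e0.
pose D : set R := `[0, +oo[%classic.
have mD : measurable D by exact: measurable_itv.
(* g is controlled on the half-line only; its extension by 0 is measurable on the whole line. *)
pose g' t : R[i] := (\1_D t : R)%:C%C * g t.
have gg t : D t -> g' t = g t by move=> Dt; rewrite /g' indicE mem_set// mul1r.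
have ig' : cintegrable mu D g'.
  by case: ig => i1 i2; split; [apply: eq_integrable i1|apply: eq_integrable i2] => // t;
    rewrite inE => /gg ->.
have mg' : cmeasurable g'.
  case: ig => /integrableP[/measurable_EFinP m1 _] /integrableP[/measurable_EFinP m2 _].
  have E (u : R -> R) : measurable_fun D u -> measurable_fun setT (fun t => \1_D t * u t).
    move=> mu'; have := (measurable_restrictT u mD).1 mu'.
    congr (measurable_fun _ _); apply/funext => t; rewrite patchE indicE.
    by case: ifP => _; rewrite ?mul1r ?mul0r.
  split; [have := E _ m1|have := E _ m2]; congr (measurable_fun _ _); apply/funext => t;
    by rewrite !ReImE /= mul0r ?subr0 ?addr0.
pose G l := cintegral mu D (fun t => g t * expi (- (l * t))).
have GE l : G l = multiplier D (fun l t => expi (- (l * t))) g' l.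
  rewrite /G /multiplier /cintegral; congr Complex;
    by apply: eq_Rintegral => t; rewrite inE => /gg ->.
have hG : hardy (fun l => G l * fourier phi l).
  have := hardy_multiplier mD _ mg' ig' (hardy_FT (FT_fourier pL) (proj2 pL)).
  move=> /(_ (fun t => ltac:(by rewrite /D /= in_itv/= andbT))).
  by congr hardy; apply/funext => l; rewrite GE.
exists (fun l => chi n tau l * (G l * fourier phi l)); split.
  exact: hardy_chi (ltW htau) hG.
have mG : cmeasurable G.
  rewrite (_ : G = multiplier D (fun l t => expi (- (l * t))) g'); last exact/funext.
  exact: (cmeasurable_multiplier mD (unit_kernel_neg R) mg').
have mY : cmeasurable (fun l => h l * chi n tau l - chi n tau l * G l).
  by apply: cmeasurableB => //; apply: cmeasurableM => //; exact: cmeasurable_chi.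
rewrite (_ : (fun l => _) = fun l => (h l * chi n tau l - chi n tau l * G l) * fourier phi l);
  last by apply/funext => l; rewrite mulrBl mulrA.
have {}gX : (sqnorm mu setT (fun l => (h l * chi n tau l - chi n tau l * G l) * fourier phi l)%R
    < e%:E)%E by rewrite -Ef.
rewrite /nrm2 -lee_fin fineK ?(ltW gX)// ge0_fin_numE ?sqnorm_ge0//.
exact: lt_trans gX (ltry _).
Qed.

(* (A - h) chi Phi differs from the residual by a function orthogonal to it. *)
Lemma mse_ge phi f h : L2_halfline phi -> measurable_fun setT f -> (forall l, 0 <= f l) ->
  {ae mu, forall l, f l = normc2 (fourier phi l)} -> L2_minus n tau f h ->
  (((2 * pi)^-1 * nrm2 mu (res phi))%:E <= mse n tau T a h f)%E.
Proof.
move=> pL mf f0 ff hm; have FL := sqint_fourier pL.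
have rL := sqint_residual htau hT ha1 ha2 phi.
have [WL [Wae|/(residual_W0 htau hT ha1 ha2) ->]] := W_cases n tau phi; last first.
  rewrite mulr0; apply: mule_ge0; first by rewrite lee_fin invr_ge0 ltW.
  by apply: integral_ge0 => l _; rewrite lee_fin !mulr_ge0 ?normc2_ge0.
have hX := hardy_L2_minus pL ff mf hm; have XL := proj1 hX.
have AL := sqint_A_char ha1 (sqint_fourier WL).
have D := nrm2_hardyB (sqintB AL XL) rL.
have mh : cmeasurable (fun l => h l * chi n tau l) by case: hm.
have mY : cmeasurable (fun l => A l * chi n tau l - h l * chi n tau l).
  apply: cmeasurableB => //; apply: cmeasurableM; last exact: cmeasurable_chi.
  exact: (cmeasurable_A_char ha1).
have mE : mse n tau T a h f = ((2 * pi)^-1 *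
    nrm2 mu (fun l => A l * Psi phi l - h l * chi n tau l * fourier phi l))%:E.
  rewrite EFinM -(sqnormE (sqintB AL XL)); congr (_ * _)%E.
  apply: ae_eq_integral => //.
  - apply/measurable_EFinP; apply: measurable_funM => //.
    have := measurable_normc2 mY; congr (measurable_fun _ _); apply/funext => l.
    by rewrite -mulrBl normc2M.
  - by apply/measurable_EFinP; apply: measurable_normc2; case: (sqintB AL XL).
  - by apply: ae_imp2 Wae ff => l -> -> _; rewrite mulrA -mulrBl -mulrBl !normc2M.
rewrite mE lee_fin ler_wpM2l ?invr_ge0 ?(ltW pi2)//; apply: D.
have e2 := hardy_residual htau hT ha1 ha2 phi hX.
apply: (etrans (ripBl AL XL rL)).
apply: (etrans (congr2 (fun x y => x - y) (rip_A_char htau hT ha1 ha2 phi phi) e2)).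
by rewrite subr0 nrm2_rip.
Qed.

Variable P0 : R.
Hypothesis hP0 : 0 < P0.

Lemma nrm2_segment phi : L2_segment T phi -> sqnorm mu `[0, T] phi = P0%:E ->
  nrm2 mu phi = P0.
Proof. by move=> pL; rewrite (sqnorm_segment pL) /nrm2 => ->. Qed.

Lemma ae_density_of phi : L2_segment T phi ->
  {ae mu, forall l, density_of T phi l = normc2 (fourier phi l)}.
Proof.
by move=> pL; apply: ae_imp (fourier_segment (ltW hT) pL) => l; rewrite /density_of => ->.
Qed.

Lemma measurable_density_of phi : L2_segment T phi -> measurable_fun setT (density_of T phi).
Proof. by move=> [pL _]; apply: measurable_normc2; exact: cmeasurable_fourier_neg. Qed.

Lemma density_of_ge0 phi l : 0 <= density_of T phi l. Proof. exact: normc2_ge0. Qed.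

Lemma integral_density_of phi : L2_segment T phi ->
  (\int[mu]_l (density_of T phi l)%:E = (2 * pi * nrm2 mu phi)%:E)%E.
Proof.
move=> pL; have hL := L2_segment_halfline pL.
rewrite -(nrm2_fourier hL) -(sqnormE (sqint_fourier hL)); apply: ae_eq_integral => //.
- by apply/measurable_EFinP; exact: measurable_density_of.
- by apply/measurable_EFinP; apply: measurable_normc2; exact: cmeasurable_fourier.
- by apply: ae_imp (ae_density_of pL) => l -> _.
Qed.

Lemma spectral_density_of phi : L2_segment T phi -> spectral_density (density_of T phi).
Proof.
move=> pL; split; [exact: measurable_density_of|exact: density_of_ge0|].
by rewrite integral_density_of// ltry.
Qed.

(** By Plancherel the class restricts the functions on the segment to a ball of L_2. *)
Lemma D0_density_of phi : L2_segment T phi -> D0 P0 (density_of T phi) <-> nrm2 mu phi <= P0.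
Proof.
move=> pL; split => [[_]|h].
  by rewrite integral_density_of// -EFinM mulrA mulVf ?mul1r ?lee_fin// gt_eqF.
split; first exact: spectral_density_of.
by rewrite integral_density_of// -EFinM mulrA mulVf ?mul1r ?lee_fin// gt_eqF.
Qed.

(* s2 is the inverse of |c|^2 in the form (F) of the density. *)
Lemma S_plus_multiplier phis : S_plus n tau T a P0 phis -> exists s2, [/\ 0 < s2,
  DAW_norm2 n tau T a phis = (s2 * P0)%:E,
  forall phi, L2_halfline phi -> nrm2 mu (res phi) <= s2 * nrm2 mu (fourier phi) &
  forall phi, L2_halfline phi -> nrm2 mu (res phi) = s2 * nrm2 mu (fourier phi) ->
    {ae mu, forall l, normc2 (res phi l) <= s2 * normc2 (fourier phi l)}].
Proof.
move=> [pL pn [c pc] hc]; have hL := L2_segment_halfline pL.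
have nP := nrm2_segment pL pn.
have fpos : (0 < \int[mu]_l (density_of T phis l)%:E)%E.
  by rewrite integral_density_of// nP lte_fin mulr_gt0.
have c0 : 0 < normc2 c.
  rewrite lt_neqAle normc2_ge0 andbT eq_sym; apply/negP => /eqP c0.
  move: fpos; rewrite (ae_eq_integral (cst 0%E)) ?integral0 ?ltxx//.
    by apply/measurable_EFinP; exact: measurable_density_of.
  by apply: ae_imp pc => l -> _; rewrite normc2M c0 mul0r.
have s20 : 0 < (normc2 c)^-1 by rewrite invr_gt0.
have r0 : {ae mu, forall l, normc2 (res phis l) = (normc2 c)^-1 * normc2 (fourier phis l)}.
  apply: ae_imp2 pc (ae_density_of pL) => l h1 h2.
  by rewrite -h2 h1 normc2M mulrA mulVf ?mul1r// gt_eqF.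
have sd := spectral_density_of pL.
exists (normc2 c)^-1; split=> //.
- rewrite (DAW_residual htau hT ha1 ha2) (residual0_eq htau hT ha1 ha2 sd fpos hc s20 r0).
  rewrite nrm2_fourier// nP; congr (_%:E); move: (pi_gt0 R); move: (pi : R) => q q0; field.
  by rewrite !gt_eqF.
- exact: (residual_le htau hT ha1 ha2 sd fpos hc s20 r0).
- exact: (residual_eq htau hT ha1 ha2 sd fpos hc s20 r0).
Qed.

Lemma DAW_le_multiplier s2 phi : 0 <= s2 ->
  (forall phi, L2_halfline phi -> nrm2 mu (res phi) <= s2 * nrm2 mu (fourier phi)) ->
  L2_segment T phi -> D0 P0 (density_of T phi) ->
  (DAW_norm2 n tau T a phi <= (s2 * P0)%:E)%E.
Proof.
move=> s20 h pL /(D0_density_of pL) pP; have hL := L2_segment_halfline pL.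
rewrite (DAW_residual htau hT ha1 ha2) lee_fin ler_pdivrMl//.
apply: le_trans (h _ hL) _; rewrite nrm2_fourier// mulrCA.
by apply: ler_wpM2l; [exact: ltW|exact: ler_wpM2l].
Qed.

(** [phis] supplies the multiplier bound, while [phi0] may be another function: in (i) it solves
    (E1) or (E2) and is not known to have the form (F). Reaching the same value puts it in the
    equality case of the bound, which is all that the saddle point needs. *)
Lemma robust_of_S_plus phis phi0 : S_plus n tau T a P0 phis ->
  L2_segment T phi0 -> sqnorm mu `[0, T] phi0 = P0%:E ->
  canonical_factorization n (density_of T phi0) phi0 ->
  DAW_norm2 n tau T a phi0 = DAW_norm2 n tau T a phis ->
  least_favorable n tau T a (D0 P0) (density_of T phi0) /\
  (H_class n tau (D0 P0) (opt_char n tau T a phi0) ->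
   minimax_robust n tau T a (D0 P0) (opt_char n tau T a phi0)).
Proof.
move=> /S_plus_multiplier[s2 [s20 -> sle seq]] pL pn hc.
rewrite (DAW_residual htau hT ha1 ha2) => -[rP].
have hL := L2_segment_halfline pL; have nP := nrm2_segment pL pn.
have f0D : D0 P0 (density_of T phi0) by apply/D0_density_of; rewrite ?nP.
have mf := measurable_density_of pL; have fge := density_of_ge0 phi0.
have ff := ae_density_of pL.
have r0 : {ae mu, forall l, normc2 (res phi0 l) <= s2 * normc2 (fourier phi0 l)}.
  apply: seq => //; rewrite nrm2_fourier// nP mulrCA -rP mulrA mulfV ?mul1r//.
  by rewrite gt_eqF.
have up := @mse_opt_char_D0 P0 phi0 _ s2 (ltW s20) _ r0.
split.
  split=> //; exists (opt_char n tau T a phi0); split; first by exists phi0.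
  move=> f h [[mf' f0' _] fP] [phi [[phiL phif _] ->]].
  have := mse_opt_char_ge mf fge ff r0; rewrite rP => lo.
  apply: le_trans lo; apply: le_trans (mse_opt_char_le mf' f0' phif) _.
  have : (((2 * pi)^-1)%:E * sqnorm mu setT (fourier phi) <= P0%:E)%E.
    apply: le_trans fP; apply: le_mse; rewrite le_eqVlt; apply/orP; left; apply/eqP.
    apply: ae_eq_integral => //.
    - by apply/measurable_EFinP; apply: measurable_normc2; exact: cmeasurable_fourier.
    - exact/measurable_EFinP.
    - by apply: ae_imp phif => l -> _.
  rewrite (sqnormE (sqint_fourier phiL)) -EFinM !lee_fin => h1.
  apply: le_trans (ler_wpM2l _ (sle _ phiL)) _; first by rewrite invr_ge0 ltW.
  by rewrite mulrCA; apply: ler_wpM2l => //; exact: ltW.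
move=> hH; split=> // h hD.
apply: (@le_trans _ _ (s2 * P0)%:E).
  by apply: ge_ereal_sup => _ [f fD <-]; exact: up.
apply: (@le_trans _ _ (mse n tau T a h (density_of T phi0))).
  by rewrite -rP; apply: mse_ge => //; exact: hD.
by apply: ereal_sup_ubound; exists (density_of T phi0).
Qed.

Lemma DAW_norm2_ge0 phi : (0 <= DAW_norm2 n tau T a phi)%E.
Proof. exact: sqnorm_ge0. Qed.

End Robustness.

Theorem theorem8 (R : realType) (n : nat) (tau T P0 : R) (a : R -> R[i])
    (nu nuplus : \bar R)
    (hn : (1 <= n)%N) (htau : 0 < tau) (hT : 0 < T) (hP0 : 0 < P0)
    (ha1 : cintegrable (@lebesgue_measure R) `[0, T] (Da n tau T a))
    (ha2 : (\int[@lebesgue_measure R]_(t in `[0%R, T])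
              (t * normc2 (Da n tau T a t))%:E < +oo)%E)
    (hnu : is_max_DAW n tau T a (S_eq n tau T a P0) (nu * P0%:E)%E)
    (hnuplus : is_max_DAW n tau T a (S_plus n tau T a P0) (nuplus * P0%:E)%E) :
  (forall phi0 : R -> R[i], S_eq n tau T a P0 phi0 ->
     (nu * P0%:E = nuplus * P0%:E)%E ->
     (nuplus * P0%:E)%E = DAW_norm2 n tau T a phi0 ->
     [/\ least_favorable n tau T a (D0 P0) (density_of T phi0),
         (forall (d : measure_display) (Omega : measurableType d)
            (P : probability Omega R) (xi : R -> Omega -> R[i]),
            has_spectral_density P n xi (density_of T phi0) ->
            exists eta : R -> Omega -> R[i],
              [/\ orthogonal_increments P eta,
                  (forall z, H_incr P n xi z = H_orth P eta z) &
                  one_sided_MA P eta (W n tau phi0)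
                    (fun t => incr n xi t tau)]) &
         (H_class n tau (D0 P0) (opt_char n tau T a phi0) ->
          minimax_robust n tau T a (D0 P0) (opt_char n tau T a phi0))]) /\
  ((nu < nuplus)%E ->
     let optimal phi0 :=
       [/\ extremal n tau T a P0 phi0, F_form n tau T a phi0 &
           canonical_factorization n (density_of T phi0) phi0] in
     (exists phi0 : R -> R[i], optimal phi0) /\
     (forall phi0 : R -> R[i], optimal phi0 ->
        least_favorable n tau T a (D0 P0) (density_of T phi0) /\
        (H_class n tau (D0 P0) (opt_char n tau T a phi0) ->
         minimax_robust n tau T a (D0 P0) (opt_char n tau T a phi0)))).
Proof.
have DAW0 phi := @DAW_norm2_ge0 R n tau T a phi.
have [supE attained] := hnuplus.
split.
  move=> phi0 [pL _ pn p0D hc] _ nuE.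
  (* An empty [S_plus] would have supremum -oo, but the common value is the squared norm of
     [phi0]. *)
  have [|phis Sphis DAWs] := attained.
    apply: contrapT => /set0P/negP; rewrite negbK => /eqP S0.
    have := DAW0 phi0; rewrite -nuE supE S0 image_set0 ereal_sup0.
    by rewrite leeNy_eq.
  have DAWeq : DAW_norm2 n tau T a phi0 = DAW_norm2 n tau T a phis by rewrite DAWs nuE.
  have [lf mr] := robust_of_S_plus htau hT ha1 ha2 hP0 Sphis pL pn hc DAWeq.
  split; [exact: lf| |exact: mr] => d Omega P xi hxi.
  have [_ _ hf] := hc; have [eta [e1 e2 e3]] := hf d Omega P xi hxi.
  by exists eta; split; [exact: e1|exact: e2|exact: (e3 tau htau)].
move=> nulp optimal; split; last first.
  move=> phi0 [[pL _ pn _] pF hc].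
  by apply: (robust_of_S_plus htau hT ha1 ha2 hP0 (phis := phi0)).
(* For an empty [S_plus] the product of [nuplus] and P0 would be -oo, hence [nuplus] itself, which
   exceeds nothing. *)
have [|phis Sphis _] := attained.
  apply: contrapT => /set0P/negP; rewrite negbK => /eqP S0.
  move: supE; rewrite S0 image_set0 ereal_sup0.
  case: nuplus nulp {hnuplus attained} => [r|_|].
  - by rewrite -EFinM.
  - by rewrite gt0_mulye// lte_fin.
  - by rewrite ltNge leNye.
(* Any member of [S_plus] is extremal: its own multiplier bounds the functional on the whole class
   by the value it attains. *)
exists phis; have [pL pn pF hc] := Sphis; split; [|exact: pF|exact: hc].
have [s2 [s20 DAWE sle _]] := S_plus_multiplier htau hT ha1 ha2 hP0 Sphis.
split; [exact: pL| |exact: pn|move=> phi phiL phiD; rewrite DAWE].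
  by apply: (proj2 (D0_density_of hT P0 pL)); rewrite (nrm2_segment pL pn).
exact: (DAW_le_multiplier htau hT ha1 ha2 (ltW s20) sle phiL phiD).
Qed.
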